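(* Let $X$ be a UMD Banach space, let $1<p<\infty$ and let $d\ge 1$ be an integer. For every $i\in\{1,\dots,d\}$, the $i$-th Riesz transform $\mathcal{R}_i$ on $\mathbb{R}^d$ and the $i$-th dyadic Riesz transform $\mathcal{S}_i$ satisfy $$\|\mathcal{R}_i\|_{p\to p}\le \|\mathcal{S}_i\|_{p\to p},$$ where $\|\mathcal{R}_i\|_{p\to p}$ is the operator norm of $\mathcal{R}_i$ on $L^p(\mathbb{R}^d,X)$ and $\|\mathcal{S}_i\|_{p\to p}$ is the operator norm of $\mathcal{S}_i$ on $L^p([0,1),X)$.
   Context: $L^p(\cdot,X)$ is the Bochner space of $X$-valued functions with norm $\|f\|_p=(\int |f|_X^p\,dx)^{1/p}$. $\mathcal{R}_i$ ($1\le i\le d$) is the usual $i$-th Riesz transform on $\mathbb{R}^d$ (Fourier multiplier $\xi_i/|\xi|$ up to a factor of modulus one), acting on $X$-valued functions. Dyadic setting: $I_0=[0,1)$; $\mathcal{D}_k=\{[m2^{-k},(m+1)2^{-k}):0\le m\le 2^k-1\}$ for $k\ge 0$; $\mathcal{D}=\bigcup_{k\ge0}\mathcal{D}_k$. For $I\in\mathcal{D}$, $I_-$ and $I_+$ are its left and right halves (children), and $h_I=(\mathbf{1}_{I_+}-\mathbf{1}_{I_-})/\sqrt{|I|}$. The Haar decomposition of $f$ on $I_0$ is $f=\langle f\rangle_{I_0}+\sum_{I\in\mathcal{D}}(f,h_I)h_I$, with $\langle f\rangle_{I_0}=\int_{I_0}f\,dx$ and $(f,h_I)=\int_{I_0}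 f h_I\,dx$. For $1\le i\le d$ the $i$-th dyadic Riesz transform is the linear operator $$\mathcal{S}_i f=\sum_{k=0}^{\infty}\ \sum_{I\in\mathcal{D}_{kd+i-1}}\big(-(f,h_{I_-})\,h_{I_+}+(f,h_{I_+})\,h_{I_-}\big).$$ That is, for intervals whose generation number is of the form $kd+i$ with $k\ge0$, $\mathcal{S}_i$ maps $h_{I_-}\mapsto -h_{I_+}$ and $h_{I_+}\mapsto h_{I_-}$ (where $I$ is the common parent), and it sends constants and all other Haar functions to $0$. *)

(* Defs.v *)
From HB Require Import structures.
From mathcomp Require Import all_boot all_order all_algebra.
From mathcomp Require Import all_classical all_reals all_analysis.
From mathcomp Require Import complex.

Set Implicit Arguments.
Unset Strict Implicit.
Unset Printing Implicit Defensive.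
Import Order.TTheory GRing.Theory Num.Theory.
Import numFieldNormedType.Exports.

Local Open Scope classical_set_scope.
Local Open Scope ring_scope.

(** * Lebesgue measure on R^d, the row vectors ['rV[R]_d] *)

(* The sigma-algebra on ['rV[R]_d] is the one generated by the coordinates,
   that is, the Borel sigma-algebra. *)
Section rV_measurable.
Context {R : realType} (d : nat).

Let coord : 'I_d -> 'rV[R]_d -> R := fun j x => x ord0 j.

Let rV_set0 : g_sigma_preimage coord set0.
Proof. exact: sigma_algebra0. Qed.

Let rV_setC A : g_sigma_preimage coord A -> g_sigma_preimage coord (~` A).
Proof. exact: sigma_algebraC. Qed.

Let rV_bigcup (F : (set 'rV[R]_d)^nat) :
  (forall k, g_sigma_preimage coord (F k)) ->
  g_sigma_preimage coord (\bigcup_k F k).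
Proof. exact: sigma_algebra_bigcup. Qed.

HB.instance Definition _ := @isMeasurable.Build default_measure_display
  'rV[R]_d (g_sigma_preimage coord) rV_set0 rV_setC rV_bigcup.

Lemma measurable_coord (j : 'I_d) :
  measurable_fun setT (fun x : 'rV[R]_d => x ord0 j).
Proof.
move=> _ Y mY; rewrite setTI; apply: sub_sigma_algebra => /=.
rewrite -bigcup_seq/=; exists j => /=; first by rewrite mem_index_enum.
by exists Y => //; rewrite setTI.
Qed.

Lemma measurable_fun_rV d1 (T : measurableType d1) (f : T -> 'rV[R]_d) :
  (forall j, measurable_fun setT (fun x => f x ord0 j)) ->
  measurable_fun setT f.
Proof.
move=> mf.
suff fS : g_sigma_preimage (fun j => coord j \o f) `<=` measurable.
  move=> _ A mA; apply: fS; rewrite g_sigma_preimage_comp.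
  by exists A.
apply: smallest_sub; first exact: sigma_algebra_measurable.
move=> A; rewrite -bigcup_seq/= => -[j _ [B mB <-]].
exact: mf.
Qed.

End rV_measurable.

Section rV_cons.
Context {R : realType} (n : nat).

Definition rV_cons (z : R * 'rV[R]_n) : 'rV[R]_n.+1 :=
  \row_j oapp (fun k => z.2 ord0 k) z.1 (unlift ord0 j).

Definition rV_uncons (x : 'rV[R]_n.+1) : R * 'rV[R]_n :=
  (x ord0 ord0, \row_k x ord0 (lift ord0 k)).

Lemma rV_consK : cancel rV_cons rV_uncons.
Proof.
move=> [t x]; rewrite /rV_uncons /rV_cons mxE unlift_none /=; congr pair.
by apply/rowP => k; rewrite !mxE liftK.
Qed.

Lemma measurable_rV_cons : measurable_fun setT rV_cons.
Proof.
apply: measurable_fun_rV => j.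
under eq_fun do rewrite mxE.
case: unliftP => [k|] _ /=; last exact: measurable_fst.
apply: (@measurableT_comp _ _ _ _ _ _ (fun x : 'rV[R]_n => x ord0 k) _ snd).
  exact: measurable_coord.
exact: measurable_snd.
Qed.

Lemma measurable_rV_uncons : measurable_fun setT rV_uncons.
Proof.
apply/measurable_fun_pairP; split; first exact: measurable_coord.
apply: measurable_fun_rV => k.
under eq_fun do rewrite /= mxE.
exact: measurable_coord.
Qed.

Variable mu : {sigma_finite_measure set 'rV[R]_n -> \bar R}.

Definition cons_measure : set 'rV[R]_n.+1 -> \bar R :=
  pushforward (@lebesgue_measure R \x mu)%E rV_cons.

HB.instance Definition _ := Measure.copy cons_measure
  (measure_function_pushforward__canonical__measure_function_Measure
     (@lebesgue_measure R \x mu)%E measurable_rV_cons).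

Lemma cons_measure_sigma_finite : sigma_finite setT cons_measure.
Proof.
have /sigma_finiteP[F [TF ndF Foo]] := @sigma_finiteT _ _ _ (@lebesgue_measure R).
have /sigma_finiteP[G [TG ndG Goo]] := sigma_finiteT mu.
exists (fun k => rV_uncons @^-1` (F k `*` G k)).
  apply/esym; rewrite -subTset => x _.
  have [k _ Fk] : (\bigcup_k F k) (rV_uncons x).1 by rewrite -TF.
  have [l _ Gl] : (\bigcup_l G l) (rV_uncons x).2 by rewrite -TG.
  exists (maxn k l) => //; split.
    by move: Fk; exact/subsetPset/ndF/leq_maxl.
  by move: Gl; exact/subsetPset/ndG/leq_maxr.
move=> k; have [mF Fk] := Foo k; have [mG Gk] := Goo k; split.
  rewrite -[X in measurable X]setTI; apply: measurable_rV_uncons => //.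
  exact: measurableX.
rewrite /cons_measure /pushforward (_ : _ @^-1` _ = F k `*` G k); last first.
  by rewrite -comp_preimage (_ : _ \o _ = id)//; apply/funext/rV_consK.
by rewrite product_measure1E// lte_mul_pinfty// ge0_fin_numE.
Qed.

HB.instance Definition _ := Measure_isSigmaFinite.Build _ _ _ cons_measure
  cons_measure_sigma_finite.

End rV_cons.

Fixpoint lebesgue_rV (R : realType) (d : nat) :
    {sigma_finite_measure set 'rV[R]_d -> \bar R} :=
  match d with
  | 0 => @dirac _ _ (0 : 'rV[R]_0) R
  | n.+1 => cons_measure (lebesgue_rV R n)
  end.

Lemma lebesgue_rV_box (R : realType) (d : nat) (a b : 'rV[R]_d) :
  (forall j, a ord0 j <= b ord0 j) ->
  lebesgue_rV R d [set x | forall j, a ord0 j <= x ord0 j <= b ord0 j] =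
  (\prod_j (b ord0 j - a ord0 j))%:E.
Proof.
elim: d => [|n IH] in a b *; move=> ab.
  by rewrite big_ord0 /= diracE mem_set//= => -[].
rewrite big_ord_recl EFinM /= /cons_measure /pushforward.
pose a' := (rV_uncons a).2; pose b' := (rV_uncons b).2.
pose B := [set x : 'rV[R]_n | forall j, a' ord0 j <= x ord0 j <= b' ord0 j].
rewrite (_ : _ @^-1` _ = `[a ord0 ord0, b ord0 ord0] `*` B); last first.
  apply/seteqP; split => -[t x] /=.
    move=> tx; split; first by have := tx ord0; rewrite mxE unlift_none in_itv.
    by move=> j; have := tx (lift ord0 j); rewrite !mxE liftK.
  move=> [/=]; rewrite in_itv/= => tab xab j; rewrite mxE.
  by case: unliftP => [k ->|->]//=; have := xab k; rewrite !mxE.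
rewrite product_measure1E//.
- transitivity (lebesgue_measure `[a ord0 ord0, b ord0 ord0] * lebesgue_rV R n B)%E; first by [].
  rewrite lebesgue_measure_itv /= lte_fin IH; last first.
    by move=> j; rewrite !mxE.
  congr (_ * _)%E; last first.
    by congr EFin; apply: eq_bigr => j _; rewrite !mxE.
  case: ltP => //= ba; congr EFin.
  by apply/esym/eqP; rewrite subr_eq0 eq_le ab ba.
- rewrite (_ : B = \bigcap_(j in [set: 'I_n])
     ((fun x : 'rV[R]_n => x ord0 j) @^-1` `[a' ord0 j, b' ord0 j])).
    apply: fin_bigcap_measurable => // j _.
    by rewrite -[X in measurable X]setTI; exact: measurable_coord.
  apply/seteqP; split => x /= xB j; first by move=> _; exact: xB.
  by have := xB j I; rewrite /= in_itv.
Qed.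

(** * Functions with values in a normed space *)

Section vector_valued.
Context {R : realType} {X : normedModType R}.
Context {disp : measure_display} {T : measurableType disp}.

Definition simple_fun (G : set (set T)) (s : T -> X) : Prop :=
  finite_set (range s) /\ forall v, G (s @^-1` [set v]).

(* The limit is required at every point and not only almost everywhere; every
   class of a.e. equal Bochner measurable functions has such an element. *)
Definition strongly_measurable (G : set (set T)) (f : T -> X) : Prop :=
  exists s : nat -> T -> X, (forall n, simple_fun G (s n)) /\
    forall x, s n x @[n --> \oo] --> f x.

Context (mu : {measure set T -> \bar R}).

Definition integral_simple (s : T -> X) : X :=
  \sum_(v \in range s) fine (mu (s @^-1` [set v])) *: v.

Definition bochner_integrable (f : T -> X) : Prop :=
  strongly_measurable measurable f /\ (\int[mu]_x (`|f x|%R)%:E < +oo)%E.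

(* For a Bochner integrable [f], the distance to [f] forces the simple functions
   [s n] to be integrable for [n] large. *)
Definition is_bochner_integral (f : T -> X) (v : X) : Prop :=
  bochner_integrable f /\
  exists s : nat -> T -> X, [/\ forall n, simple_fun measurable (s n),
    (\int[mu]_x (`|f x - s n x|%R)%:E)%E @[n --> \oo] --> 0%E &
    integral_simple (s n) @[n --> \oo] --> v].

Definition bochner (f : T -> X) : X := xget 0 [set v | is_bochner_integral f v].

Definition normLp (p : R) (f : T -> X) : \bar R :=
  Lnorm mu p%:E (fun x => `|f x|%:E).

Definition LpX (p : R) (f : T -> X) : Prop :=
  strongly_measurable measurable f /\ (normLp p f < +oo)%E.

Definition cvg_LpX (p : R) (f_ : nat -> T -> X) (f : T -> X) : Prop :=
  normLp p (f_ n \- f) @[n --> \oo] --> 0%E.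

(* An operator on [L^p(mu; X)] is given by its graph. *)
Definition opnorm (p : R) (A : (T -> X) -> (T -> X) -> Prop) : \bar R :=
  ereal_sup [set c | exists f g, [/\ LpX p f, (normLp p f <= 1)%E,
                                     A f g & c = normLp p g]].

End vector_valued.

(** * UMD spaces *)

Definition filtration (disp : measure_display) (T : measurableType disp)
    (F : nat -> set (set T)) : Prop :=
  [/\ forall n, sigma_algebra setT (F n), forall n, F n `<=` measurable &
      forall n, F n `<=` F n.+1].

(* [D 0] is only required to be adapted, so that the partial sums of [D] are
   exactly the [L^q]-martingales. *)
Definition martingale_differences (R : realType) (X : normedModType R)
    (disp : measure_display) (T : measurableType disp) (P : probability T R)
    (q : R) (F : nat -> set (set T)) (D : nat -> T -> X) : Prop :=
  [/\ forall n, strongly_measurable (F n) (D n),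
      forall n, LpX P q (D n) &
      forall n A, F n A -> bochner P (fun x => \1_A x *: D n.+1 x) = 0].

Definition UMD_bound (R : realType) (X : normedModType R) (q C : R) : Prop :=
  forall (disp : measure_display) (T : measurableType disp)
    (P : probability T R) (F : nat -> set (set T)) (D : nat -> T -> X),
  filtration F -> martingale_differences P q F D ->
  forall (N : nat) (eps : nat -> bool),
  (normLp P q (fun x => \sum_(n < N) (-1) ^+ eps n *: D n x)%R
   <= C%:E * normLp P q (fun x => \sum_(n < N) D n x)%R)%E.

Definition UMD (R : realType) (X : normedModType R) : Prop :=
  exists q : R, 1 < q /\ exists C : R, UMD_bound X q C.

(** * Riesz transforms on R^d *)

Section riesz.
Context {R : realType} {d : nat}.
Local Notation leb := (lebesgue_rV R d).

(* On ['rV[R]_d] the library norm is the maximum norm. *)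
Definition dotv (x y : 'rV[R]_d) : R := \sum_j x ord0 j * y ord0 j.
Definition norm2 (x : 'rV[R]_d) : R := Num.sqrt (dotv x x).

Fixpoint partial_derivs (s : seq 'I_d) (phi : 'rV[R]_d -> R) : 'rV[R]_d -> R :=
  if s is j :: s' then fun x => 'D_(delta_mx ord0 j) (partial_derivs s' phi) x
  else phi.

Definition schwartz (phi : 'rV[R]_d -> R) : Prop :=
  forall s : seq 'I_d,
    (forall x, differentiable (partial_derivs s phi) x) /\
    forall N : nat, exists C : R,
      forall x, (1 + norm2 x) ^+ N * `|partial_derivs s phi x| <= C.

Definition cexp (t : R) : complex R := Complex (cos t) (sin t).

Definition cintegral (f : 'rV[R]_d -> complex R) : complex R :=
  Complex (\int[leb]_x complex.Re (f x))%R (\int[leb]_x complex.Im (f x))%R.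

Definition fourier (f : 'rV[R]_d -> complex R) (xi : 'rV[R]_d) : complex R :=
  cintegral (fun x => f x * cexp (- (2 * pi * dotv x xi))).

Definition inv_fourier (f : 'rV[R]_d -> complex R) (x : 'rV[R]_d) : complex R :=
  cintegral (fun xi => f xi * cexp (2 * pi * dotv x xi)).

Definition riesz_symbol (i : 'I_d) (xi : 'rV[R]_d) : complex R :=
  Complex 0 (- (xi ord0 i / norm2 xi)).

(* The factor [- 'i] in the symbol makes the transform of a real function real,
   so that taking the real part loses nothing. *)
Definition riesz_scalar (i : 'I_d) (phi : 'rV[R]_d -> R) (x : 'rV[R]_d) : R :=
  complex.Re (inv_fourier (fun xi =>
    riesz_symbol i xi * fourier (fun y => Complex (phi y) 0) xi) x).

Context {X : normedModType R}.

Definition riesz_tensor (i : 'I_d) (f g : 'rV[R]_d -> X) : Prop :=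
  exists (n : nat) (phi : 'I_n -> 'rV[R]_d -> R) (v : 'I_n -> X),
    [/\ forall k, schwartz (phi k),
        forall x, f x = \sum_k phi k x *: v k &
        forall x, g x = \sum_k riesz_scalar i (phi k) x *: v k].

(* The extension of [riesz_tensor] from the dense subspace of Schwartz tensors
   to [L^p], i.e. the closure of its graph in [L^p x L^p]. *)
Definition riesz (p : R) (i : 'I_d) (f g : 'rV[R]_d -> X) : Prop :=
  [/\ LpX leb p f, LpX leb p g &
      exists f_ g_ : nat -> 'rV[R]_d -> X,
        [/\ forall n, riesz_tensor i (f_ n) (g_ n),
            cvg_LpX leb p f_ f & cvg_LpX leb p g_ g]].

End riesz.

(** * Dyadic Riesz transforms on [0, 1) *)

Section dyadic_riesz.
Context {R : realType}.

Definition lebesgue01 : {measure set (measurableTypeR R) -> \bar R} :=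
  mrestr lebesgue_measure (measurable_itv `[(0 : R), 1[).

(* The interval number [m] of generation [k]; its children are the intervals
   [m.*2] (left) and [m.*2.+1] (right) of generation [k.+1]. *)
Definition dyadic (k m : nat) : set R :=
  `[m%:R / 2 ^+ k, m.+1%:R / 2 ^+ k[%classic.

Definition haar (k m : nat) (x : R) : R :=
  (\1_(dyadic k.+1 m.*2.+1) x - \1_(dyadic k.+1 m.*2) x) /
  Num.sqrt (2 ^- k).

Context {X : normedModType R}.

Definition haar_coef (f : measurableTypeR R -> X) (k m : nat) : X :=
  bochner lebesgue01 (fun x => haar k m x *: f x).

(* Contribution of the [m]-th interval of generation [g] as common parent. *)
Definition dyadic_riesz_term (f : measurableTypeR R -> X) (g m : nat) (x : R) : X :=
  - (haar g.+1 m.*2.+1 x *: haar_coef f g.+1 m.*2)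
  + haar g.+1 m.*2 x *: haar_coef f g.+1 m.*2.+1.

(* Indices in ['I_d] start at [0], so the parents have generation [k * d + i]. *)
Definition dyadic_riesz_partial (d : nat) (i : 'I_d) (n : nat)
    (f : measurableTypeR R -> X) (x : measurableTypeR R) : X :=
  \sum_(k < n) \sum_(m < 2 ^ (k * d + i)) dyadic_riesz_term f (k * d + i) m x.

(* The series defining the operator converges in [L^p]. *)
Definition dyadic_riesz (d : nat) (p : R) (i : 'I_d)
    (f g : measurableTypeR R -> X) : Prop :=
  [/\ LpX lebesgue01 p f, LpX lebesgue01 p g &
      cvg_LpX lebesgue01 p (fun n => dyadic_riesz_partial i n f) g].

End dyadic_riesz.

(* Main.v *)
(* Let Y be a random vector of R^d, a function of N fair coin tosses.  For f on
   R^d and a point z, the function F w' = f (z + Y w' - Y w) of N binary digits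
   can be fed to S_i; averaging (S_i F) w over w gives an operator T f z.  By
   convexity and translation invariance ||T|| <= ||S_i||.  On Schwartz functions
   T is a Fourier multiplier whose symbol is computed digit by digit.  Take for Y
   the horizontal displacement of a random walk with mesh t in a half-space,
   until it leaves the half-space or has made n steps: at each step the direction
   of the i-th horizontal coordinate and that of the vertical one are read on a
   digit of generation i modulo d and on the next digit.  When n, then the
   starting height, tend to infinity and finally t tends to 0, the symbols, all
   bounded by 1, converge to that of R_i; dominated convergence and Fatou's lemma
   carry the bound from T over to R_i. *)
Require Import Defs.
From HB Require Import structures.
From mathcomp Require Import all_boot all_order all_algebra.
From mathcomp Require Import all_classical all_reals all_analysis.
From mathcomp Require Import complex measurable_realfun ring lra.
Import Order.TTheory GRing.Theory Num.Theory.
Import numFieldNormedType.Exports.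
Local Open Scope classical_set_scope.
Local Open Scope ring_scope.

(** * Kernels on binary words and random walks *)

Section words.

(** The transform acts on one step of the walk as a quarter turn. The sign of the second digit
    drives the i-th coordinate, and its product with the sign of the first one drives the height;
    these two increments are, up to scaling, the sum and the difference of the Haar functions of the
    two halves of the parent, which [S_i] exchanges up to sign. Rotating the i-th and the vertical
    component of the gradient of the harmonic extension to a half-space, and projecting back to the
    boundary, is a classical description of [R_i]; the walk is its discrete form. The height is not
    part of [Y]: it only decides when to stop. One obstacle is that every generation congruent to i
    modulo d acts, and for d = 1 this is every generation, including those inside a step. The digits
    that are read are therefore followed by an unread one, on which the relevant Haar coefficients
    vanish. This is why a step has three digits and a block [3 * d]. Another one is that the bound 1
    for the symbols is not stable under a step. The induction carries [|m| <= 1 - v ^+ 2] instead,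
    [v] being the characteristic function. *)

Fixpoint words (N : nat) : seq (seq bool) :=
  if N is n.+1 then map (cons false) (words n) ++ map (cons true) (words n)
  else [:: [::]].

Lemma mem_words N w : w \in words N -> size w = N.
Proof.
elim: N w => [|n IH] w /=; first by rewrite inE => /eqP ->.
by rewrite mem_cat => /orP[] /mapP[v /IH <- ->].
Qed.

Lemma sum_words0 (V : nmodType) (F : seq bool -> V) :
  \sum_(w <- words 0) F w = F [::].
Proof. by rewrite big_seq1. Qed.

Lemma sum_wordsS (V : nmodType) N (F : seq bool -> V) :
  \sum_(w <- words N.+1) F w =
  \sum_(w <- words N) F (false :: w) + \sum_(w <- words N) F (true :: w).
Proof. by rewrite big_cat !big_map. Qed.

End words.

Section kernel.
Context {R : realType}.
Implicit Types (A : pred nat) (f g : seq bool -> R).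

(** The value 0 on the empty word reflects that a function of finitely many digits is orthogonal to
    the Haar functions of finer intervals. *)
Definition lead (w : seq bool) : R := if w is c :: _ then (-1) ^+ c else 0.

(* The matrix, on functions of the binary digits, of the dyadic transform whose
   parent intervals have a generation in [A]: it compares two words at the first
   digit where they differ and at the next one. *)
Fixpoint dker A (w w' : seq bool) : R :=
  match w, w' with
  | b :: v, b' :: v' =>
      if b == b' then dker (fun k => A k.+1) v v'
      else (A 0%N)%:R * (-1) ^+ b * (lead v * lead v') / 2 ^+ size v
  | _, _ => 0
  end.

Lemma dker_cons A b b' v v' : dker A (b :: v) (b' :: v') =
  if b == b' then dker (fun k => A k.+1) v v'
  else (A 0%N)%:R * (-1) ^+ b * (lead v * lead v') / 2 ^+ size v.
Proof. by []. Qed.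

Lemma dkerC A w w' : size w = size w' -> dker A w' w = - dker A w w'.
Proof.
elim: w w' A => [|b v IH] [|b' v'] A //=; rewrite ?oppr0// => -[sv].
rewrite (eq_sym b'); have [_|bb'] := eqVneq b b'; first exact: IH.
rewrite -sv (_ : (-1) ^+ b' = - (-1) ^+ b :> R); first by ring.
by case: b b' bb' => -[]//= _; rewrite ?expr0 ?expr1 ?opprK.
Qed.

Arguments dker : simpl never.

Definition mean N f := (\sum_(w <- words N) f w) / 2 ^+ N.

Definition lead_mean N f := mean N (fun w => lead w * f w).

(** There is only one factor [2 ^+ N] because the matrix [dker] is already normalised: this is the
    mean of [f] times the transform of [g]. *)
Definition dform A N f g :=
  (\sum_(w <- words N) \sum_(w' <- words N) dker A w w' * (f w * g w')) / 2 ^+ N.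

Lemma meanS N f :
  mean N.+1 f = (mean N (fun w => f (false :: w)) + mean N (fun w => f (true :: w))) / 2.
Proof. by rewrite /mean sum_wordsS exprS invfM; ring. Qed.

Lemma mean_behead N f : mean N.+1 (f \o behead) = mean N f.
Proof. by rewrite meanS /=; field. Qed.

Lemma meanZD N a b f g :
  mean N (fun w => a * f w + b * g w) = a * mean N f + b * mean N g.
Proof. by rewrite /mean big_split/= -!mulr_sumr mulrDl !mulrA. Qed.

Lemma lead_mean_behead N f : lead_mean N.+1 (f \o behead) = 0.
Proof. by rewrite /lead_mean meanS /mean /= -!mulr_sumr expr0 expr1; ring. Qed.

Lemma lead_meanS N f :
  lead_mean N.+1 f = (mean N (fun w => f (false :: w)) - mean N (fun w => f (true :: w))) / 2.
Proof. by rewrite /lead_mean meanS /mean /= -!mulr_sumr expr0 expr1; ring. Qed.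

(** Words with equal first digits see the transform of one half, with generations shifted by one.
    Words with different first digits interact only if generation 0 is a parent, and then only
    through the Haar coefficients of the two halves. *)
Lemma dformS A N f g (fb := fun b w => f (b :: w)) (gb := fun b w => g (b :: w)) :
  dform A N.+1 f g =
  (A 0%N)%:R * (lead_mean N (fb false) * lead_mean N (gb true)
              - lead_mean N (fb true) * lead_mean N (gb false)) / 2 +
  (dform (fun k => A k.+1) N (fb false) (gb false)
   + dform (fun k => A k.+1) N (fb true) (gb true)) / 2.
Proof.
have cross b b' : b != b' ->
    \sum_(w <- words N) \sum_(w' <- words N)
      dker A (b :: w) (b' :: w') * (f (b :: w) * g (b' :: w')) =
    (A 0%N)%:R * (-1) ^+ b * 2 ^+ N *
      (lead_mean N (fb b) * lead_mean N (gb b')).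
  move=> bb'; rewrite /lead_mean /mean [RHS](_ : _ = (A 0%N)%:R * (-1) ^+ b / 2 ^+ N *
     ((\sum_(w <- words N) lead w * fb b w) *
      (\sum_(w <- words N) lead w * gb b' w))); last first.
    by field; rewrite expf_neq0.
  rewrite mulr_suml mulr_sumr [LHS]big_seq_cond [RHS]big_seq_cond.
  apply: eq_bigr => w; rewrite andbT => /mem_words sw.
  rewrite !mulr_sumr; apply: eq_bigr => w' _ /=.
  by rewrite dker_cons (negbTE bb') sw /fb /gb; ring.
rewrite /dform sum_wordsS.
under eq_bigr do rewrite sum_wordsS.
under [X in _ + X]eq_bigr do rewrite sum_wordsS.
rewrite !big_split/= [X in _ + X + _]cross// [X in _ + (X + _)]cross//.
by rewrite exprS invfM /fb /gb/= expr0 expr1; field; rewrite expf_neq0.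
Qed.

Lemma dformC A N f g : dform A N g f = - dform A N f g.
Proof.
rewrite /dform -mulNr; congr (_ / _); rewrite exchange_big/= -sumrN.
rewrite [LHS]big_seq_cond [RHS]big_seq_cond.
apply: eq_bigr => w; rewrite andbT => /mem_words sw; rewrite -sumrN.
rewrite [LHS]big_seq_cond [RHS]big_seq_cond.
apply: eq_bigr => w'; rewrite andbT => /mem_words sw'.
by rewrite dkerC ?sw ?sw'//; ring.
Qed.

Lemma dformff A N f : dform A N f f = 0.
Proof. by have := dformC A N f f; lra. Qed.

Lemma dformZDl A N a b f1 f2 g :
  dform A N (fun w => a * f1 w + b * f2 w) g = a * dform A N f1 g + b * dform A N f2 g.
Proof.
rewrite /dform !mulrA -mulrDl; congr (_ / _).
rewrite !mulr_sumr -big_split/=; apply: eq_bigr => w _.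
by rewrite !mulr_sumr -big_split/=; apply: eq_bigr => w' _; ring.
Qed.

Lemma dformZDr A N a b f g1 g2 :
  dform A N f (fun w => a * g1 w + b * g2 w) = a * dform A N f g1 + b * dform A N f g2.
Proof. by rewrite dformC dformZDl !(dformC A N f); ring. Qed.

(** An antisymmetric form is multiplied by the determinant of a plane substitution. Translating the
    random vector rotates the pair of its cosine and sine, hence does not change the symbol. *)
Lemma dform_rot A N a b f g :
  dform A N (fun w => a * f w + (- b) * g w) (fun w => b * f w + a * g w) =
  (a ^+ 2 + b ^+ 2) * dform A N f g.
Proof. by rewrite dformZDl !dformZDr !dformff (dformC A N f g); ring. Qed.

Lemma dform_behead A N f g :
  dform A N.+1 (f \o behead) (g \o behead) = dform (fun k => A k.+1) N f g.
Proof. by rewrite dformS /=; field. Qed.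

End kernel.

(** * Characteristic functions and symbols of random vectors driven by digits *)

Section symbol.
Context {R : realType} {d : nat}.
Implicit Types (A : pred nat) (X : seq bool -> 'rV[R]_d) (v m : 'rV[R]_d -> R).

Definition phase X (xi : 'rV[R]_d) w : R := 2 * pi * dotv (X w) xi.

Definition coscos X xi := fun w => cos (phase X xi w).
Definition sinsin X xi := fun w => sin (phase X xi w).

(* [X] is a random vector, a function of [N] fair coin tosses, with
   characteristic function [v] and symbol ['i m]. *)
Definition realizes A N X v m := forall xi,
  [/\ mean N (coscos X xi) = v xi, mean N (sinsin X xi) = 0 &
      2 * dform A N (coscos X xi) (sinsin X xi) = m xi].

Definition realizable A N v m := exists X, realizes A N X v m.

Lemma realizable0 A : realizable A 0 (fun=> 1) (fun=> 0).
Proof.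
exists (fun=> 0) => xi.
rewrite /mean /dform !sum_words0 /= /coscos /sinsin /phase /dotv.
rewrite big1 => [|j _]; last by rewrite mxE mul0r.
by rewrite mulr0 cos0 sin0 expr0 !divr1 !mul0r mulr0.
Qed.

(** An unread digit shifts the generations and leaves the law of the vector alone. It also makes
    [lead_mean] vanish, which removes unwanted terms from [dformS]. *)
Lemma realizes_behead A N X v m :
  realizes (fun k => A k.+1) N X v m -> realizes A N.+1 (X \o behead) v m.
Proof.
move=> rX xi; have [vX sX mX] := rX xi; split.
- by rewrite -vX; exact: (mean_behead N (coscos X xi)).
- by rewrite -sX; exact: (mean_behead N (sinsin X xi)).
- by rewrite -mX; congr (2 * _); exact: (dform_behead A N (coscos X xi) (sinsin X xi)).
Qed.

Lemma realizable_dummy A N v m :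
  realizable (fun k => A k.+1) N v m -> realizable A N.+1 v m.
Proof.
by move=> [X rX]; exists (X \o behead); exact: realizes_behead.
Qed.

Lemma realizable_pad A n N v m :
  realizable (fun k => A (n + k)%N) N v m -> realizable A (n + N) v m.
Proof.
elim: n A => [//|n IH] A rA; apply: realizable_dummy; apply: IH.
by under [X in realizable X]eq_fun do rewrite -addSn.
Qed.

Lemma dotvDl (x y z : 'rV[R]_d) : dotv (x + y) z = dotv x z + dotv y z.
Proof. by rewrite /dotv -big_split/=; apply: eq_bigr => j _; rewrite mxE mulrDl. Qed.

Lemma dotvZl a (x z : 'rV[R]_d) : dotv (a *: x) z = a * dotv x z.
Proof. by rewrite /dotv mulr_sumr; apply: eq_bigr => j _; rewrite mxE mulrA. Qed.

Let shiftX (s : bool) (h : 'rV[R]_d) X w : 'rV[R]_d := (-1) ^+ s *: h + X w.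

Let phase_shift s h X xi w :
  phase (shiftX s h X) xi w = (-1) ^+ s * (2 * pi * dotv h xi) + phase X xi w.
Proof. by rewrite /phase /shiftX dotvDl dotvZl; ring. Qed.

Let th (h xi : 'rV[R]_d) : R := 2 * pi * dotv h xi.

Let cos_sgn (s : bool) (t : R) : cos ((-1) ^+ s * t) = cos t.
Proof. by case: s; rewrite ?expr1 ?mulN1r ?cosN ?expr0 ?mul1r. Qed.

Let sin_sgn (s : bool) (t : R) : sin ((-1) ^+ s * t) = (-1) ^+ s * sin t.
Proof. by case: s; rewrite ?expr1 ?mulN1r ?sinN ?expr0 ?mul1r. Qed.

Let coscos_shift s h X xi : coscos (shiftX s h X) xi =
  fun w => cos (th h xi) * coscos X xi w + (- ((-1) ^+ s * sin (th h xi))) * sinsin X xi w.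
Proof.
apply/funext => w; rewrite /coscos phase_shift cosD cos_sgn sin_sgn.
by rewrite /sinsin /th; ring.
Qed.

Let sinsin_shift s h X xi : sinsin (shiftX s h X) xi =
  fun w => (-1) ^+ s * sin (th h xi) * coscos X xi w + cos (th h xi) * sinsin X xi w.
Proof.
by apply/funext => w; rewrite /sinsin phase_shift sinD cos_sgn sin_sgn.
Qed.

Let dform_shift A N s h X xi :
  dform A N (coscos (shiftX s h X) xi) (sinsin (shiftX s h X) xi) =
  dform A N (coscos X xi) (sinsin X xi).
Proof.
rewrite coscos_shift sinsin_shift dform_rot exprMn sqrr_sign mul1r cos2Dsin2.
exact: mul1r.
Qed.

Let mean_cos_shift A N s h X v m xi : realizes A N X v m ->
  mean N (coscos (shiftX s h X) xi) = cos (th h xi) * v xi.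
Proof.
by move=> rX; have [<- sX _] := rX xi; rewrite coscos_shift meanZD sX mulr0 addr0.
Qed.

Let mean_sin_shift A N s h X v m xi : realizes A N X v m ->
  mean N (sinsin (shiftX s h X) xi) = (-1) ^+ s * (sin (th h xi) * v xi).
Proof.
by move=> rX; have [<- sX _] := rX xi; rewrite sinsin_shift meanZD sX mulr0 addr0 -mulrA.
Qed.

(** The first digit is the sign of the step. The second one is unread, so the terms with [lead_mean]
    in [dformS] vanish whether or not generation 0 is in [A], and the symbol does not change. *)
Lemma realizable_move A N h v m : realizable (fun k => A k.+2) N v m ->
  realizable A N.+2 (fun xi => cos (2 * pi * dotv h xi) * v xi) m.
Proof.
move=> [X rX].
pose X' w := if w is b :: w' then shiftX b h (X \o behead) w' else 0.
exists X' => xi.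
have rX' : realizes (fun k => A k.+1) N.+1 (X \o behead) v m.
  exact: realizes_behead.
rewrite !(meanS N.+1) dformS.
have lc b : lead_mean N.+1 (fun w => coscos X' xi (b :: w)) = 0.
  exact: (lead_mean_behead _ (coscos (shiftX b h X) xi)).
have ls b : lead_mean N.+1 (fun w => sinsin X' xi (b :: w)) = 0.
  exact: (lead_mean_behead _ (sinsin (shiftX b h X) xi)).
have mc b : mean N.+1 (fun w => coscos X' xi (b :: w)) = cos (th h xi) * v xi.
  exact: (mean_cos_shift _ _ b h _ _ _ xi rX').
have ms b : mean N.+1 (fun w => sinsin X' xi (b :: w)) =
    (-1) ^+ b * (sin (th h xi) * v xi).
  exact: (mean_sin_shift _ _ b h _ _ _ xi rX').
have md b : dform (fun k => A k.+1) N.+1 (fun w => coscos X' xi (b :: w))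
      (fun w => sinsin X' xi (b :: w)) = m xi / 2.
  have [_ _ <-] := rX' xi.
  by rewrite [LHS](dform_shift _ _ b h (X \o behead) xi); field.
by rewrite !lc !ls !mc !ms !md expr0 expr1 /th; split; field.
Qed.

(* The second digit moves the walk by [h] or [-h]; the product of the two signs
   is an independent fair sign, which selects the continuation. *)
Lemma realizable_split A N h v0 m0 v1 m1 : A 0%N ->
  realizable (fun k => A k.+3) N v0 m0 ->
  realizable (fun k => A k.+3) N v1 m1 ->
  realizable A N.+3
    (fun xi => cos (2 * pi * dotv h xi) * ((v0 xi + v1 xi) / 2))
    (fun xi => (m0 xi + m1 xi) / 2 + cos (2 * pi * dotv h xi) *
       sin (2 * pi * dotv h xi) * (v0 xi ^+ 2 - v1 xi ^+ 2) / 2).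
Proof.
move=> A0 [X0 rX0] [X1 rX1].
pose X' w := if w is b :: c :: w' then
  shiftX c h (if b == c then X0 \o behead else X1 \o behead) w' else 0.
exists X' => xi.
move: rX0 rX1 => /(realizes_behead (fun k => A k.+2)) rX0 /(realizes_behead (fun k => A k.+2)) rX1.
(* The third digit is unread: generation 1, which may lie in [A], contributes nothing. *)
have lc b c : lead_mean N.+1 (fun w => coscos X' xi [:: b, c & w]) = 0.
  by rewrite /X' /coscos /phase/=; case: eqP => _;
    [exact: (lead_mean_behead _ (coscos (shiftX c h X0) xi))
    |exact: (lead_mean_behead _ (coscos (shiftX c h X1) xi))].
have ls b c : lead_mean N.+1 (fun w => sinsin X' xi [:: b, c & w]) = 0.
  by rewrite /X' /sinsin /phase/=; case: eqP => _;
    [exact: (lead_mean_behead _ (sinsin (shiftX c h X0) xi))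
    |exact: (lead_mean_behead _ (sinsin (shiftX c h X1) xi))].
have mc b c : mean N.+1 (fun w => coscos X' xi [:: b, c & w]) =
    cos (th h xi) * (if b == c then v0 xi else v1 xi).
  by rewrite /X' /coscos /phase/=; case: eqP => _;
    [exact: (mean_cos_shift _ _ c h _ _ _ xi rX0)
    |exact: (mean_cos_shift _ _ c h _ _ _ xi rX1)].
have ms b c : mean N.+1 (fun w => sinsin X' xi [:: b, c & w]) =
    (-1) ^+ c * (sin (th h xi) * (if b == c then v0 xi else v1 xi)).
  by rewrite /X' /sinsin /phase/=; case: eqP => _;
    [exact: (mean_sin_shift _ _ c h _ _ _ xi rX0)
    |exact: (mean_sin_shift _ _ c h _ _ _ xi rX1)].
have md b c : dform (fun k => A k.+2) N.+1 (fun w => coscos X' xi [:: b, c & w])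
      (fun w => sinsin X' xi [:: b, c & w]) = (if b == c then m0 xi else m1 xi) / 2.
  have [_ _ <-] := rX0 xi; have [_ _ <-] := rX1 xi.
  rewrite /X' /sinsin /coscos /phase/=; case: eqP => _.
    by rewrite [LHS](dform_shift _ _ c h (X0 \o behead) xi); field.
  by rewrite [LHS](dform_shift _ _ c h (X1 \o behead) xi); field.
(* What remains is generation 0. On the half [b] the leading means of the cosine and the sine are
   [(-1) ^+ b * cos * (v0 - v1) / 2] and [sin * (v0 + v1) / 2], whence the difference of squares. *)
rewrite !(meanS N.+2) !(meanS N.+1) dformS !(dformS _ N.+1) !(lead_meanS N.+1).
by rewrite !md !mc !ms !lc !ls A0 /= expr0 expr1 /th; split; field.
Qed.

End symbol.

(** * The walk on the half-line and its limit in time *)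

Section half_line_walk.
Context {R : realType}.
Implicit Types (a b c s : R).

(* Characteristic function and symbol of the horizontal displacement of a walk
   started at height [y], when it reaches height [0] or after [n] steps; [c] is
   the characteristic function of a horizontal step. *)
Fixpoint walk_char c (n y : nat) : R :=
  if n is k.+1 then
    if y is z.+1 then c * ((walk_char c k z + walk_char c k z.+2) / 2) else 1
  else 1.

Fixpoint walk_symb c s (n y : nat) : R :=
  if n is k.+1 then
    if y is z.+1 then (walk_symb c s k z + walk_symb c s k z.+2) / 2
      + s * (walk_char c k z ^+ 2 - walk_char c k z.+2 ^+ 2) / 2
    else 0
  else 0.

Lemma walk_char_le1 c n y : `|c| <= 1 -> `|walk_char c n y| <= 1.
Proof.
move=> c1; elim: n y => [|n IH] [|z] /=; rewrite ?normr1//.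
have := IH z; have := IH z.+2; move: c1; rewrite normrM !ler_norml => c1 h1 h2.
rewrite -[leRHS]mulr1 ler_pM//; first by rewrite ler_norml.
by rewrite ler_norml; lra.
Qed.

(** The drift term is at most [(b ^+ 2 * (v + w) ^+ 2 + a ^+ 2 * (v - w) ^+ 2) / 4] in absolute
    value, by the inequality between arithmetic and geometric means. As [a ^+ 2 + b ^+ 2 = 1] and
    [c ^+ 2 <= a ^+ 2], this is at most the mean of [v ^+ 2] and [w ^+ 2] minus the square of the
    new characteristic function. In the application [a] and [b] are the cosine and the sine of the
    i-th angle. *)
Lemma walk_symb_le c s a b n y : a ^+ 2 + b ^+ 2 = 1 -> s = a * b ->
  `|c| <= `|a| -> `|walk_symb c s n y| <= 1 - walk_char c n y ^+ 2.
Proof.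
move=> ab -> ca; elim: n y => [|n IH] [|z] /=; rewrite ?expr1n ?subrr ?normr0//.
have := IH z; have := IH z.+2.
move: (walk_char c n z) (walk_char c n z.+2) => v w.
move: (walk_symb _ _ n z) (walk_symb _ _ n z.+2) => m k hk hm.
have c2 : c ^+ 2 <= a ^+ 2.
  by rewrite -[c ^+ 2]real_normK ?num_real// -[a ^+ 2]real_normK ?num_real// lerXn2r ?nnegrE.
have a2 : a ^+ 2 <= 1 by nra.
have hc : c ^+ 2 * (v + w) ^+ 2 <= a ^+ 2 * (v + w) ^+ 2.
  by rewrite ler_wpM2r// sqr_ge0.
have ha : a ^+ 2 * (v - w) ^+ 2 <= (v - w) ^+ 2.
  by rewrite -[leRHS]mul1r ler_wpM2r// sqr_ge0.
have h1 : 0 <= (b * (v + w) - a * (v - w)) ^+ 2 by exact: sqr_ge0.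
have h2 : 0 <= (b * (v + w) + a * (v - w)) ^+ 2 by exact: sqr_ge0.
have hb : b ^+ 2 * (v + w) ^+ 2 = (v + w) ^+ 2 - a ^+ 2 * (v + w) ^+ 2.
  by rewrite -(_ : 1 - a ^+ 2 = b ^+ 2); [ring|rewrite -ab; ring].
have e1 : (b * (v + w) - a * (v - w)) ^+ 2 = b ^+ 2 * (v + w) ^+ 2 +
    a ^+ 2 * (v - w) ^+ 2 - 2 * (a * b * (v ^+ 2 - w ^+ 2)) by ring.
have e2 : (b * (v + w) + a * (v - w)) ^+ 2 = b ^+ 2 * (v + w) ^+ 2 +
    a ^+ 2 * (v - w) ^+ 2 + 2 * (a * b * (v ^+ 2 - w ^+ 2)) by ring.
have e3 : (v + w) ^+ 2 + (v - w) ^+ 2 = 2 * (v ^+ 2 + w ^+ 2) by ring.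
move: hm hk; rewrite !ler_norml => /andP[m1 m2] /andP[k1 k2].
have -> : (c * ((v + w) / 2)) ^+ 2 = c ^+ 2 * (v + w) ^+ 2 / 4 by field.
by apply/andP; split; lra.
Qed.

Section limit.
Variables (c s : R).
Hypothesis c1 : `|c| < 1.
Hypothesis s1 : `|s| <= 1.

Let r := Num.sqrt (1 - c ^+ 2).

Let c2 : c ^+ 2 < 1.
Proof. by rewrite -[c ^+ 2]real_normK ?num_real// expr_lt1. Qed.

Let r_gt0 : 0 < r. Proof. by rewrite sqrtr_gt0 subr_gt0. Qed.

Let r2 : r ^+ 2 = 1 - c ^+ 2.
Proof. by rewrite sqr_sqrtr// subr_ge0 ltW. Qed.

(* The bounded solution of [v y.+1 = c (v y + v y.+2) / 2] is [walk_root ^+ y]. *)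
Definition walk_root := c / (1 + Num.sqrt (1 - c ^+ 2)).
Let lam := walk_root.

Lemma walk_root_lt1 : `|walk_root| < 1.
Proof.
have r0 := r_gt0.
rewrite /walk_root -/r normrM normfV (gtr0_norm (_ : 0 < 1 + r)); last lra.
by rewrite ltr_pdivrMr; have := c1; lra.
Qed.

Let lam_rec : c * (lam ^+ 2 + 1) = 2 * lam.
Proof.
have r0 : 1 + r != 0 by have := r_gt0; lra.
rewrite /lam /walk_root -/r.
have -> : c * ((c / (1 + r)) ^+ 2 + 1) = c * (c ^+ 2 + (1 + r) ^+ 2) / (1 + r) ^+ 2 by field.
have -> : c ^+ 2 = 1 - r ^+ 2 by rewrite r2; ring.
by field.
Qed.

Let K := s / r.

Let K_rec : K * (1 - lam ^+ 2) = s * (1 + lam ^+ 2).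
Proof.
have r0 : 1 + r != 0 by have := r_gt0; lra.
have r0' : r != 0 by have := r_gt0; lra.
have -> : lam ^+ 2 = (1 - r) / (1 + r).
  rewrite /lam /walk_root -/r expr_div_n.
  have -> : c ^+ 2 = 1 - r ^+ 2 by rewrite r2; ring.
  by field.
by rewrite /K; field; rewrite r0.
Qed.

Let lam_le1 y : `|lam ^+ y| <= 1.
Proof. by rewrite normrX exprn_ile1// ltW// walk_root_lt1. Qed.

(** A step multiplies the mean of the errors by [c]; the initial error is at most 2, and at height 0
    there is none. *)
Let walk_char_err n y : `|walk_char c n y - lam ^+ y| <= 2 * `|c| ^+ n.
Proof.
elim: n y => [|n IH] [|z]; rewrite ?expr0 /= ?subrr ?normr0 ?mulr_ge0 ?exprn_ge0//.
  by have := lam_le1 z.+1; rewrite !ler_norml; lra.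
have -> : lam ^+ z.+1 = c * ((lam ^+ z + lam ^+ z.+2) / 2).
  by have : lam ^+ z * (c * (lam ^+ 2 + 1)) = lam ^+ z * (2 * lam);
    [rewrite lam_rec|rewrite !exprS; lra].
rewrite -mulrBr normrM [in leRHS]exprS mulrCA ler_wpM2l//.
by have := IH z; have := IH z.+2; rewrite !ler_norml; lra.
Qed.

(** The time-independent solution of the recursion of [walk_symb], with [walk_char] replaced by its
    limit, that is bounded and vanishes at height 0; [K_rec] is the equation that fixes [K]. *)
Let lim y := K * (1 - lam ^+ y ^+ 2).
Let B := 1 + `|K|.

(** The last term is the price of replacing [walk_char] by its limit: each of the two squares is off
    by at most [4 * |c| ^+ n], and [|s| <= 1]. *)
Let err_rec n z : `|walk_symb c s n.+1 z.+1 - lim z.+1| <=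
  (`|walk_symb c s n z - lim z| + `|walk_symb c s n z.+2 - lim z.+2|) / 2
  + 4 * `|c| ^+ n.
Proof.
have -> : lim z.+1 = (lim z + lim z.+2) / 2 +
    s * (lam ^+ z ^+ 2 - lam ^+ z.+2 ^+ 2) / 2.
  have : lam ^+ z ^+ 2 * (1 - lam ^+ 2) * (K * (1 - lam ^+ 2)) =
         lam ^+ z ^+ 2 * (1 - lam ^+ 2) * (s * (1 + lam ^+ 2)) by rewrite K_rec.
  by rewrite /lim !exprS; lra.
have sq y : `|walk_char c n y ^+ 2 - lam ^+ y ^+ 2| <= 4 * `|c| ^+ n.
  rewrite subr_sqr normrM [leRHS](_ : _ = 2 * `|c| ^+ n * 2); last by ring.
  rewrite ler_pM ?walk_char_err// (le_trans (ler_normD _ _))// (_ : 2 = 1 + 1 :> R)// lerD//.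
  by apply: walk_char_le1; exact: ltW.
rewrite /=; set v := walk_char c n z ^+ 2; set w := walk_char c n z.+2 ^+ 2.
have := sq z; have := sq z.+2; rewrite -/v -/w.
move: (lam ^+ z ^+ 2) (lam ^+ z.+2 ^+ 2) (walk_symb c s n z) (walk_symb c s n z.+2).
move=> p q m k hw hv.
have -> : (m + k) / 2 + s * (v - w) / 2 - ((lim z + lim z.+2) / 2 + s * (p - q) / 2) =
  ((m - lim z) + (k - lim z.+2)) / 2 + s * ((v - p) - (w - q)) / 2 by field.
rewrite (le_trans (ler_normD _ _))// lerD//.
  by rewrite normrM (@ger0_norm _ 2^-1)// ler_wpM2r// ler_normD.
rewrite normrM (@ger0_norm _ 2^-1)// normrM.
have := ler_normB (v - p) (w - q).
have := normr_ge0 (v - p - (w - q)); move: s1 (normr_ge0 s).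
by move=> *; nra.
Qed.

Hypothesis symb_le1 : forall n y, `|walk_symb c s n y| <= 1.

Let err_bound n y : `|walk_symb c s n y - lim y| <= B.
Proof.
rewrite (le_trans (ler_normB _ _))// lerD// normrM -[leRHS]mulr1 ler_wpM2l//.
have := lam_le1 y; rewrite -[_ ^+ y ^+ 2]real_normK ?num_real// => l1.
have : 0 <= `|lam ^+ y| ^+ 2 <= 1 by rewrite sqr_ge0 expr_le1.
by rewrite ler_norml; lra.
Qed.

(* The bound is a supersolution of [err_rec] below height [H]: its first term is
   affine in [y], and its second one is strictly concave in [y]. *)
Let err_decay (H : nat) (rho : R) : (0 < H)%N -> `|c| <= rho -> rho <= 1 ->
  1 - (2 * H%:R ^+ 2)^-1 <= rho ->
  forall n y, (y <= H)%N -> `|walk_symb c s n y - lim y| <=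
    B * y%:R / H%:R + (B + 8) * rho ^+ n * (y%:R * (2 * H%:R - y%:R)).
Proof.
move=> H0 crho rho1 Hrho.
have h0 : 0 < H%:R :> R by rewrite ltr0n.
have rho0 : 0 <= rho by exact: le_trans crho.
have B0 : 1 <= B by rewrite lerDl.
elim=> [|n IH] [|z] zH.
- by rewrite /= /lim expr0 expr1n subrr mulr0 subrr normr0 !(mulr0, mul0r, addr0).
- rewrite expr0 mulr1 (le_trans (err_bound _ _))//.
  have zH' : z.+1%:R <= H%:R :> R by rewrite ler_nat.
  have z1 : 1 <= z.+1%:R :> R by rewrite ler1n.
  have : 0 <= B * z.+1%:R / H%:R by rewrite !mulr_ge0// ?invr_ge0; lra.
  have : 1 <= z.+1%:R * (2 * H%:R - z.+1%:R) :> R by nra.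
  by nra.
- by rewrite /= /lim expr0 expr1n subrr mulr0 subrr normr0 !(mulr0, mul0r, addr0).
have rn : 0 <= rho ^+ n by exact: exprn_ge0.
have z0 : 0 <= z%:R :> R by [].
move: zH; rewrite leq_eqVlt => /predU1P[zH|zH].
  (* At height [H] the recursion would leave the range [y <= H], but there the affine term alone
     equals the trivial bound [B]. *)
  rewrite (le_trans (err_bound _ _))// zH mulfK ?lt0r_neq0// lerDl.
  by rewrite !mulr_ge0 ?exprn_ge0//; lra.
have IHz := IH z (ltnW (ltnW zH)); have IHz2 := IH z.+2 zH.
rewrite (le_trans (err_rec _ _))//.
have cn : `|c| ^+ n <= rho ^+ n by rewrite lerXn2r ?nnegrE.
have E : H%:R * H%:R^-1 = 1 :> R by rewrite divff ?lt0r_neq0.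
have zH' : z.+1%:R <= H%:R :> R by rewrite ler_nat ltnW.
move: zH' IHz IHz2; rewrite -[z.+2]addn2 -[z.+1]addn1 !natrD.
move: z0 h0 E Hrho; move: (z%:R : R) (H%:R : R) => x h x0 h0 E Hrho xh IHz IHz2.
set S := (x + 1) * (2 * h - (x + 1)).
have S0 : 0 <= S by rewrite /S mulr_ge0; lra.
have Sh : S <= h ^+ 2 by rewrite /S; nra.
have Srho : (1 - rho) * S <= 2^-1.
  have h2 : 0 < h ^+ 2 by exact: exprn_gt0.
  apply: (@le_trans _ _ ((2 * h ^+ 2)^-1 * h ^+ 2)); first by apply: ler_pM => //; lra.
  by rewrite invfM -mulrA mulVf ?lt0r_neq0// mulr1.
(* Averaging over the two neighbours lowers [S] by 1. Keeping the factor [rho] costs at most 1/2 of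
   this, and the other half, multiplied by [B + 8], is at least the 4 needed for the source term. *)
have key : (B + 8) * (S - 1) + 4 <= (B + 8) * (rho * S) by nra.
have := ler_wpM2l rn key.
have E1 : B * (x + 1) / h = (B * x / h + B * (x + 2) / h) / 2 by field; rewrite lt0r_neq0.
rewrite E1 exprS.
have : (x * (2 * h - x) + (x + 2) * (2 * h - (x + 2))) / 2 = S - 1 by rewrite /S; field.
by move: IHz IHz2 cn; move: (B * x / h) (B * (x + 2) / h) => ? ? ? ? ? SE; nra.
Qed.

Lemma walk_symb_cvg y :
  walk_symb c s n y @[n --> \oo] --> s / Num.sqrt (1 - c ^+ 2) * (1 - walk_root ^+ y ^+ 2).
Proof.
rewrite -/r -/K -/lam -/(lim y); apply/cvgrPdist_lt => e e0.
(* [H] makes the affine term of [err_decay], which does not depend on [n], smaller than [e / 2]. *)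
pose H := (y + (Num.truncn (2 * B * y%:R / e)).+1)%N.
have H0 : (0 < H)%N by rewrite /H addnS.
have h0 : 0 < H%:R :> R by rewrite ltr0n.
have B0 : 0 < B by rewrite /B ltr_pwDl.
have HB : B * y%:R / H%:R < e / 2.
  rewrite ltr_pdivrMr// -ltr_pdivrMl ?divr_gt0//.
  rewrite [ltLHS](_ : _ = 2 * B * y%:R / e); last by field; rewrite lt0r_neq0.
  by rewrite (lt_le_trans (truncnS_gt _))// ler_nat leq_addl.
(* The smallest rate that [err_decay] admits for this [H]; it is below 1, so the second term dies
   out in [n]. *)
pose rho := Num.max `|c| (1 - (2 * H%:R ^+ 2)^-1).
have H2 : 0 < (2 * H%:R ^+ 2)^-1 :> R by rewrite invr_gt0 mulr_gt0// exprn_gt0.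
have rho1 : rho < 1 by rewrite gt_max c1 ltrBlDr ltrDl.
have rho0 : 0 <= rho by rewrite le_max normr_ge0.
have rho_cvg : (B + 8) * rho ^+ n * (y%:R * (2 * H%:R - y%:R)) @[n --> \oo] --> 0.
  rewrite -[X in _ --> X](mul0r (y%:R * (2 * H%:R - y%:R))).
  apply: cvgMl; rewrite -[X in _ --> X](mulr0 (B + 8)).
  by apply: cvgMr; apply: cvg_expr; rewrite ger0_norm.
have e2 : 0 < e / 2 by rewrite divr_gt0.
near=> n.
rewrite distrC (le_lt_trans (err_decay H rho H0 _ _ _ n y _))//.
- by rewrite le_max lexx.
- exact: ltW.
- by rewrite le_max lexx orbT.
- by rewrite /H leq_addr.
rewrite [ltRHS](_ : _ = e / 2 + e / 2); last by field.
apply: ltrD => //; apply: (le_lt_trans (ler_norm _)).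
by near: n; move/cvgr0Pnorm_lt : rho_cvg; exact.
Unshelve. all: by end_near. Qed.

End limit.

End half_line_walk.

Lemma is_derive_harmonic_cvg {R : realType} (f : R -> R) (l : R) :
  is_derive (0 : R) (1 : R) f l ->
  (f k.+1%:R^-1 - f 0) / k.+1%:R^-1 @[k --> \oo] --> l.
Proof.
move=> [df dE].
have h : h^-1 *: (f (h *: 1 + 0) - f 0) @[h --> 0^'] --> l.
  by rewrite -[X in _ --> X]dE; exact: df.
have eps_dnbhs : (k.+1%:R^-1 : R) @[k --> \oo] --> 0^'.
  move=> P nP.
  have : \forall k \near \oo, (k.+1%:R^-1 != 0 -> P (k.+1%:R^-1 : R)) := cvg_harmonic nP.
  by apply: filterS => k; apply; rewrite invr_eq0.
have := cvg_comp _ _ eps_dnbhs h; apply: cvg_trans.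
apply: near_eq_cvg; near=> k => /=.
by rewrite addr0 /GRing.scale/= mulr1 mulrC.
Unshelve. all: by end_near. Qed.

(** * The walk in the half-space and the limit of its symbols *)

Section half_space_walk.
Context {R : realType} {d : nat} (i : 'I_d).
Implicit Types (A : pred nat) (v m : 'rV[R]_d -> R).

Let d0 : (0 < d)%N. Proof. by case: d i => // -[]. Qed.

Definition axis (t : R) (j : 'I_d) : 'rV[R]_d := t *: delta_mx ord0 j.

Lemma dotv_axis t j (xi : 'rV[R]_d) : dotv (axis t j) xi = t * xi ord0 j.
Proof.
rewrite /dotv (bigD1 j)//= !mxE !eqxx mulr1 big1 ?addr0// => k kj.
by rewrite !mxE (negbTE kj) andbF mulr0 mul0r.
Qed.

Let A k := (k %% d == 0)%N.

Let A_period n : (fun k => A (n * d + k)%N) = A.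
Proof. by apply/funext => k; rewrite /A modnMDl. Qed.

(** A block of [3 * d] digits preserves generations modulo [d], and it has room for the two or three
    digits of a step even if [d] is 1. *)
Lemma realizable_move_block N h v m : realizable A N v m ->
  realizable A (3 * d + N) (fun xi => cos (2 * pi * dotv h xi) * v xi) m.
Proof.
move=> rA; have dE : (3 * d = (3 * d).-2.+2)%N by case: d d0 => // -[].
rewrite dE !addSn; apply: realizable_move; apply: realizable_pad.
rewrite (_ : (fun k => _) = A)// -[RHS](A_period 3).
by apply/funext => k; rewrite -!addSn -dE.
Qed.

Lemma realizable_moves_block (s : seq 'I_d) t N v m : realizable A N v m ->
  realizable A (size s * (3 * d) + N)
    (fun xi => (\prod_(j <- s) cos (2 * pi * dotv (axis t j) xi)) * v xi) m.
Proof.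
move=> rA; elim: s => [|j s IH] /=.
  by under [X in realizable _ _ X]eq_fun do rewrite big_nil mul1r.
under [X in realizable _ _ X]eq_fun do rewrite big_cons -mulrA.
by rewrite mulSn -addnA; exact: realizable_move_block.
Qed.

Lemma realizable_split_block N h v0 m0 v1 m1 :
  realizable A N v0 m0 -> realizable A N v1 m1 ->
  realizable A (3 * d + N)
    (fun xi => cos (2 * pi * dotv h xi) * ((v0 xi + v1 xi) / 2))
    (fun xi => (m0 xi + m1 xi) / 2 + cos (2 * pi * dotv h xi) *
       sin (2 * pi * dotv h xi) * (v0 xi ^+ 2 - v1 xi ^+ 2) / 2).
Proof.
move=> r0 r1; have dE : (3 * d = (3 * d - 3).+3)%N.
  by rewrite -[(_ - 3).+3]addn3 subnK// -[leqLHS]muln1 leq_mul2l.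
have AE : (fun k => A (3 * d - 3 + k).+3) = A.
  by rewrite -[RHS](A_period 3); apply/funext => k; rewrite -!addSn -dE.
rewrite dE !addSn; apply: realizable_split; first by rewrite /A mod0n.
  by apply: realizable_pad; rewrite AE.
by apply: realizable_pad; rewrite AE.
Qed.

Let others : seq 'I_d := rem i (enum 'I_d).

Definition step_char (t : R) (xi : 'rV[R]_d) : R :=
  \prod_j cos (2 * pi * (t * xi ord0 j)).

Definition step_drift (t : R) (xi : 'rV[R]_d) : R :=
  cos (2 * pi * (t * xi ord0 i)) * sin (2 * pi * (t * xi ord0 i)).

Let step_charE t xi : step_char t xi =
  cos (2 * pi * dotv (axis t i) xi) *
  \prod_(j <- others) cos (2 * pi * dotv (axis t j) xi).
Proof.
rewrite /step_char -(big_enum _ _ (fun=> true))/= (perm_big (i :: others))/=.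
  by rewrite big_cons dotv_axis; congr (_ * _); apply: eq_bigr => j _; rewrite dotv_axis.
by rewrite perm_to_rem// mem_enum.
Qed.

Lemma realizable_walk t n y :
  realizable A (n * (size others * (3 * d) + 3 * d))
    (fun xi => walk_char (step_char t xi) n y)
    (fun xi => walk_symb (step_char t xi) (step_drift t xi) n y).
Proof.
(* A stopped walk leaves its remaining digits unread, so that both continuations of a step use words
   of the same length. *)
have stopped N : realizable A N (fun=> 1 : R) (fun=> 0).
  by rewrite -[N]addn0; apply: realizable_pad; exact: realizable0.
elim: n y => [|n IH] [|z] /=; [exact: stopped..|].
rewrite mulSn -addnA.
have r := realizable_split_block _ (axis t i) _ _ _ _ (IH z) (IH z.+2).
have := realizable_moves_block others t _ _ _ r.
congr realizable.
  by apply/funext => xi; rewrite step_charE; ring.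
by apply/funext => xi; rewrite /step_drift dotv_axis.
Qed.

(** [i] unread digits in front turn the generations divisible by [d] into those congruent to [i]. *)
Lemma realizable_walk_shift t n y : exists N,
  realizable (fun k => k %% d == i)%N N
    (fun xi => walk_char (step_char t xi) n y)
    (fun xi => walk_symb (step_char t xi) (step_drift t xi) n y).
Proof.
exists (i + n * (size others * (3 * d) + 3 * d))%N; apply: realizable_pad.
rewrite (_ : (fun k => _) = A); first exact: realizable_walk.
apply/funext => k; rewrite /A -{2}(modn_small (ltn_ord i)) -[X in _ == X %[mod _]]addn0.
by rewrite eqn_modDl mod0n.
Qed.

Lemma step_char_le t xi : `|step_char t xi| <= `|cos (2 * pi * (t * xi ord0 i))|.
Proof.
rewrite step_charE normrM dotv_axis ler_piMr//.
rewrite normr_prod; apply: prodr_ile1 => j _.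
by rewrite normr_ge0/= ler_norml cos_geN1 cos_le1.
Qed.

Lemma walk_symb_step_le1 t xi n y :
  `|walk_symb (step_char t xi) (step_drift t xi) n y| <= 1.
Proof.
apply: le_trans (walk_symb_le _ _ _ _ n y (cos2Dsin2 _) erefl (step_char_le t xi)) _.
by rewrite lerBlDr lerDl sqr_ge0.
Qed.

Definition limit_symb (t : R) (xi : 'rV[R]_d) : R :=
  step_drift t xi / Num.sqrt (1 - step_char t xi ^+ 2).

Let step_drift_le1 t xi : `|step_drift t xi| <= 1.
Proof.
rewrite normrM mulr_ile1// ler_norml.
  by rewrite cos_geN1 cos_le1.
by rewrite sin_geN1 sin_le1.
Qed.

Let step_char_le1 t xi : `|step_char t xi| <= 1.
Proof. by rewrite (le_trans (step_char_le _ _))// ler_norml cos_geN1 cos_le1. Qed.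

Let step_char_eq1 t xi : `|step_char t xi| = 1 -> step_drift t xi = 0.
Proof.
move=> c1; have := step_char_le t xi; rewrite c1 => cos1.
have : cos (2 * pi * (t * xi ord0 i)) ^+ 2 >= 1.
  by rewrite -[leRHS]real_normK ?num_real// expr_ge1.
move=> c2; have s0 : sin (2 * pi * (t * xi ord0 i)) ^+ 2 <= 0.
  by rewrite -(lerD2l (cos (2 * pi * (t * xi ord0 i)) ^+ 2)) addr0 cos2Dsin2.
have /eqP : sin (2 * pi * (t * xi ord0 i)) ^+ 2 = 0 by apply/le_anti; rewrite s0 sqr_ge0.
by rewrite expf_eq0/= /step_drift => /eqP ->; rewrite mulr0.
Qed.

Lemma walk_symb0 c n y : walk_symb c 0 n y = 0 :> R.
Proof. by elim: n y => [|n IH] [|z] //=; rewrite !IH !mul0r !addr0 mul0r. Qed.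

Lemma walk_symb_cvg_time t xi y :
  walk_symb (step_char t xi) (step_drift t xi) n y @[n --> \oo] -->
  limit_symb t xi * (1 - walk_root (step_char t xi) ^+ y ^+ 2).
Proof.
(* If [|step_char| = 1], the limit formula has denominator 0. But [|step_char|] is at most the
   absolute value of the i-th cosine, so the i-th sine is 0 and all the symbols vanish. *)
have := step_char_le1 t xi; rewrite le_eqVlt => /predU1P[c1|c1].
  rewrite /limit_symb step_char_eq1// !mul0r.
  by under eq_fun do rewrite walk_symb0; exact: cvg_cst.
apply: walk_symb_cvg => //.
by move=> n z; exact: walk_symb_step_le1.
Qed.

Lemma walk_symb_cvg_height t xi :
  limit_symb t xi * (1 - walk_root (step_char t xi) ^+ y ^+ 2) @[y --> \oo] -->
  limit_symb t xi.
Proof.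
have := step_char_le1 t xi; rewrite le_eqVlt => /predU1P[c1|c1].
  rewrite /limit_symb step_char_eq1// !mul0r.
  by under eq_fun do rewrite mul0r; exact: cvg_cst.
have -> : limit_symb t xi = limit_symb t xi * (1 - 0 ^+ 2).
  by rewrite expr0n subr0 mulr1.
under eq_fun do rewrite expr0n subr0 mulr1.
apply: cvgMr; apply: cvgB; first exact: cvg_cst.
apply: (@cvg_comp _ _ _ (fun y => walk_root (step_char t xi) ^+ y) (fun x => x ^+ 2)).
  by apply: cvg_expr; exact: walk_root_lt1.
exact: exprn_continuous.
Qed.

Let eps (k : nat) : R := k.+1%:R^-1.

Let eps0 k : eps k != 0. Proof. by rewrite /eps invr_eq0. Qed.

Let eps_cvg : eps k @[k --> \oo] --> 0. Proof. exact: cvg_harmonic. Qed.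

Let sin_cvg (a : R) : sin (a * eps k) / eps k @[k --> \oo] --> a.
Proof.
have dsin : is_derive (0 : R) (1 : R) (fun t : R => sin (a * t)) a.
  apply: is_derive_eq.
  by rewrite mulr0 cos0 /GRing.scale/= !(mulr1, mulr0, mul1r, addr0, add0r).
have := is_derive_harmonic_cvg _ _ dsin.
by under eq_fun do rewrite mulr0 sin0 subr0.
Qed.

(** By telescoping: [1 - u P = (1 - u) + u (1 - P)], where [u] tends to 1. *)
Let one_minus_prod_cvg (u : nat -> 'I_d -> R) (l : 'I_d -> R) (s : seq 'I_d) :
  (forall j, u k j @[k --> \oo] --> (1 : R)) ->
  (forall j, (1 - u k j) / eps k ^+ 2 @[k --> \oo] --> l j) ->
  (1 - \prod_(j <- s) u k j) / eps k ^+ 2 @[k --> \oo] --> \sum_(j <- s) l j.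
Proof.
move=> u1 ul; elim: s => [|j s IH].
  rewrite big_nil; under eq_fun do rewrite big_nil subrr mul0r.
  exact: cvg_cst.
rewrite big_cons (_ : (fun k => _) = fun k => (1 - u k j) / eps k ^+ 2 +
  u k j * ((1 - \prod_(j <- s) u k j) / eps k ^+ 2)); last first.
  by apply/funext => k; rewrite big_cons; field; exact: eps0.
apply: cvgD; first exact: ul.
have h := cvgM (u1 j) IH; rewrite mul1r in h; exact: h.
Qed.

(** With [a = 2 pi xi], the drift is [a_i t] to first order and [1 - step_char ^+ 2], that is one
    minus a product of squared cosines, is [t ^+ 2 * |a| ^+ 2] to second order; the quotient by the
    square root tends to [a_i / |a|]. *)
Lemma limit_symb_cvg (xi : 'rV[R]_d) :
  limit_symb (eps k) xi @[k --> \oo] --> xi ord0 i / norm2 xi.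
Proof.
pose a j : R := 2 * pi * xi ord0 j.
have aE t j : 2 * pi * (t * xi ord0 j) = a j * t by rewrite /a; ring.
have cos_cvg j : cos (a j * eps k) @[k --> \oo] --> (1 : R).
  have h : cos (a j * eps k) @[k --> \oo] --> cos (a j * 0).
    by apply: (cvg_comp (fun k => a j * eps k) cos _ (@continuous_cos R (a j * 0)));
       apply: cvgMr; exact: eps_cvg.
  by rewrite mulr0 cos0 in h; exact: h.
have sum2 : \sum_j a j ^+ 2 = (2 * pi) ^+ 2 * dotv xi xi.
  by rewrite mulr_sumr; apply: eq_bigr => j _; rewrite /a; ring.
have dot0 : 0 <= dotv xi xi by apply: sumr_ge0 => j _; rewrite -expr2 sqr_ge0.
have pi2 : 0 < 2 * pi :> R by rewrite mulr_gt0// pi_gt0.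
have char_cvg : (1 - step_char (eps k) xi ^+ 2) / eps k ^+ 2 @[k --> \oo] -->
    (2 * pi) ^+ 2 * dotv xi xi.
  rewrite -sum2.
  under eq_fun => k.
    rewrite /step_char -prodrXl; under eq_bigr do rewrite aE.
    over.
  apply: (one_minus_prod_cvg (fun k j => cos (a j * eps k) ^+ 2)).
    move=> j; rewrite -[X in _ --> X](expr1n _ 2).
    exact: (cvg_comp (fun k => cos (a j * eps k)) (fun x => x ^+ 2) (cos_cvg j) (@exprn_continuous R 2 1)).
  move=> j.
  under eq_fun do rewrite -sin2cos2 -expr_div_n.
  exact: (cvg_comp _ (fun x => x ^+ 2) (sin_cvg (a j)) (@exprn_continuous R 2 (a j))).
(* At the origin the target symbol is 0 by the convention on division, and so are all the
   approximations. *)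
have [d0' | dn0] := eqVneq (dotv xi xi) 0.
  have x0 : xi ord0 i = 0.
    have /(_ i isT)/eqP := psumr_eq0P (fun j _ => sqr_ge0 (xi ord0 j)) d0'.
    by rewrite sqrf_eq0 => /eqP.
  rewrite x0 mul0r; under eq_fun do rewrite /limit_symb /step_drift x0 mulr0 mulr0 sin0 mulr0 mul0r.
  exact: cvg_cst.
have -> : xi ord0 i / norm2 xi = 1 * (a i) / Num.sqrt ((2 * pi) ^+ 2 * dotv xi xi).
  rewrite sqrtrM ?sqr_ge0// sqrtr_sqr gtr0_norm// /a /norm2 mul1r.
  by rewrite -mulf_div divff ?mul1r// lt0r_neq0.
have E k : limit_symb (eps k) xi = cos (a i * eps k) * (sin (a i * eps k) / eps k) /
    Num.sqrt ((1 - step_char (eps k) xi ^+ 2) / eps k ^+ 2).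
  rewrite /limit_symb /step_drift aE sqrtrM; last first.
    by rewrite subr_ge0 -[leLHS]real_normK ?num_real// expr_le1.
  rewrite sqrtrV ?sqr_ge0// sqrtr_sqr gtr0_norm ?invr_gt0//.
  have e0 := eps0 k; move: (eps k) e0 => e e0; move: (Num.sqrt _) => S.
  by rewrite invfM invrK; move: S^-1 => q; field.
under eq_fun do rewrite E.
apply: cvgM; first by apply: cvgM; [exact: cos_cvg|exact: sin_cvg].
apply: cvgV; first by rewrite sqrtr_eq0 -ltNge mulr_gt0 ?exprn_gt0// lt0r dn0.
exact: (cvg_comp _ _ char_cvg (@sqrt_continuous R _)).
Qed.

End half_space_walk.

(** * Integration on R^d *)

Section rV_integral.
Context {R : realType}.

Lemma measurable_fun_countable_image d d' (T : measurableType d) (T' : measurableType d')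
    (Z : countType) (g : T -> Z) (h : Z -> T') :
  (forall z, measurable (g @^-1` [set z])) -> measurable_fun setT (h \o g).
Proof.
move=> mg _ Y _; rewrite setTI.
rewrite (_ : _ @^-1` _ = \bigcup_(z : Z) [set x | g x = z /\ Y (h z)]).
  apply: countable_bigcupT_measurable; first exact: countableP.
  move=> z; have [Yz|nYz] := pselect (Y (h z)).
    rewrite (_ : [set _ | _] = g @^-1` [set z])//.
    by apply/seteqP; split => x /= => [[]|].
  rewrite (_ : [set _ | _] = set0); first exact: measurable0.
  by apply/seteqP; split => x //= [].
by apply/seteqP; split => x /= => [Yx|[z _ [<-]]//]; exists (g x).
Qed.

(** The sigma-algebra is generated by the coordinates and not by the open sets. So [f] is obtained
    as the pointwise limit of its values at the nearest lower points of the grids of mesh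
    [1 / k.+1]; these approximations factor through a countable set. *)
Lemma continuous_measurable_rV n (f : 'rV[R]_n -> R) :
  continuous f -> measurable_fun setT f.
Proof.
move=> cf.
pose Z k (x : 'rV[R]_n) : 'rV[int]_n := \row_j Num.floor (k.+1%:R * x ord0 j).
pose D k (z : 'rV[int]_n) : 'rV[R]_n := \row_j ((z ord0 j)%:~R / k.+1%:R).
apply: (@measurable_fun_cvg _ _ _ _ (fun k => f \o (D k \o Z k))).
  move=> k; apply: (measurable_fun_countable_image _ _ _ _ _ (Z k) (f \o D k)) => z.
  rewrite (_ : _ @^-1` _ = \bigcap_(j in [set: 'I_n])
     ((fun x : 'rV[R]_n => k.+1%:R * x ord0 j) @^-1`
        `[(z ord0 j)%:~R, (z ord0 j + 1)%:~R[)).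
    apply: fin_bigcap_measurable => // j _.
    rewrite -[X in measurable X]setTI.
    have : measurable_fun setT (fun x : 'rV[R]_n => k.+1%:R * x ord0 j).
      by apply: measurable_funM => //; exact: measurable_coord.
    by apply => //; exact: measurable_itv.
  apply/seteqP; split => x /=.
    by move=> <- j _ /=; rewrite mxE in_itv/= floor_itv// num_real.
  move=> xz; apply/rowP => j; rewrite mxE; apply/floor_def.
  by have := xz j I; rewrite /= in_itv.
move=> x _; apply: (cvg_comp (fun k => D k (Z k x)) f _ (cf x)).
apply/cvg_ballP => e e0; near=> k; split => // a j.
rewrite /ball/= !mxE (ord1 a).
have k0 : 0 < k.+1%:R :> R by rewrite ltr0n.
have /andP[h1 h2] : (Num.floor (k.+1%:R * x ord0 j))%:~R <= k.+1%:R * x ord0 j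
    < (Num.floor (k.+1%:R * x ord0 j) + 1)%:~R.
  by rewrite floor_itv// num_real.
rewrite [X in `|X|](_ : _ = (k.+1%:R * x ord0 j -
   (Num.floor (k.+1%:R * x ord0 j))%:~R) / k.+1%:R); last first.
  by field; rewrite lt0r_neq0.
rewrite normrM ger0_norm ?subr_ge0// gtr0_norm ?invr_gt0//.
apply: (@le_lt_trans _ _ k.+1%:R^-1).
  rewrite ler_piMl ?invr_ge0//.
  by move: h2; rewrite intrD; lra.
by near: k; exact: near_infty_natSinv_lt (PosNum e0).
Unshelve. all: by end_near. Qed.

Local Open Scope ereal_scope.
Local Notation leb := (@lebesgue_measure R).

Lemma measurable_fun_rV_consl n t : measurable_fun setT (fun x : 'rV[R]_n => rV_cons (t, x)).
Proof. by apply: (measurableT_comp (@measurable_rV_cons R n)); exact: measurable_pair1. Qed.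

(* The domain is stated with [measurableTypeR R], the type of [lebesgue_measure]. *)
Let mrV_cons n :
  measurable_fun setT (@rV_cons R n : measurableTypeR R * 'rV[R]_n -> _).
Proof. exact: (@measurable_rV_cons R n). Qed.

Let ge0_rVSE n (f : 'rV[R]_n.+1 -> \bar R) :
  measurable_fun setT f -> (forall x, 0 <= f x) ->
  \int[lebesgue_rV R n.+1]_x f x =
  \int[(leb \x lebesgue_rV R n)]_z (f \o @rV_cons R n) z.
Proof.
move=> mf f0; have f0' : {in setT, forall y, 0 <= f y} by [].
exact: (ge0_integral_pushforward (mrV_cons n) (leb \x lebesgue_rV R n) measurableT mf f0').
Qed.

Lemma ge0_integral_rVS n (f : 'rV[R]_n.+1 -> \bar R) :
  measurable_fun setT f -> (forall x, 0 <= f x) ->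
  \int[lebesgue_rV R n.+1]_x f x =
  \int[leb]_t \int[lebesgue_rV R n]_x f (rV_cons (t, x)).
Proof.
move=> mf f0; rewrite ge0_rVSE//.
have mf' : measurable_fun setT (f \o @rV_cons R n : measurableTypeR R * 'rV[R]_n -> _).
  by apply: measurableT_comp => //; exact: mrV_cons.
exact: (fubini_tonelli1 _ mf' (fun x => f0 _)).
Qed.

Lemma integrable_rVS n (f : 'rV[R]_n.+1 -> \bar R) :
  (lebesgue_rV R n.+1).-integrable setT f ->
  (leb \x lebesgue_rV R n).-integrable setT (f \o @rV_cons R n).
Proof.
move=> /integrableP[mf foo]; apply/integrableP; split.
  by apply: measurableT_comp => //; exact: mrV_cons.
by move: foo; rewrite ge0_rVSE//; exact: measurableT_comp.
Qed.

Lemma integral_rVS n (f : 'rV[R]_n.+1 -> \bar R) :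
  (lebesgue_rV R n.+1).-integrable setT f ->
  \int[lebesgue_rV R n.+1]_x f x =
  \int[leb]_t \int[lebesgue_rV R n]_x f (rV_cons (t, x)).
Proof.
move=> intf; have intf' := integrable_rVS _ _ intf.
rewrite (integral12_prod_meas1 intf').
exact: (integral_pushforward (mrV_cons n) (measurable_int _ intf) intf' measurableT).
Qed.

Lemma integral_rV0 (f : 'rV[R]_0 -> \bar R) : \int[lebesgue_rV R 0]_x f x = f 0%R.
Proof.
rewrite (_ : f = cst (f 0%R)); last first.
  by apply/funext => x /=; congr f; apply/rowP => -[].
rewrite integral_cst// /= diracE mem_set// mule1//.
Qed.

Lemma lebesgue_measure_shift (a : R) A : measurable A ->
  leb ((fun x => (x + a)%R) @^-1` A) = leb A.
Proof.
move=> mA.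
have ms : measurable_fun setT (fun x : measurableTypeR R => (x + a)%R : measurableTypeR R).
  exact: measurable_funD.
pose m : {measure set (measurableTypeR R) -> \bar R} :=
  measure_function_pushforward__canonical__measure_function_Measure leb ms.
apply/esym; apply: (@lebesgue_measure_unique R m _ A mA).
move=> _ [[x y] _ <-] /=; rewrite /pushforward.
rewrite (_ : _ @^-1` _ = `](x - a)%R, (y - a)%R]%classic); last first.
  by apply/seteqP; split => z /=; rewrite !in_itv/= ltrBlDr lerBrDr.
rewrite !lebesgue_measure_itv/= !lte_fin ltrD2r; case: ifP => // _.
by rewrite -!EFinB; congr EFin; ring.
Qed.

Lemma ge0_integral_shift (a : R) (f : R -> \bar R) :
  measurable_fun setT f -> (forall x, 0 <= f x) ->
  \int[leb]_x f (x + a)%R = \int[leb]_x f x.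
Proof.
move=> mf f0.
have ms : measurable_fun setT (fun x : measurableTypeR R => (x + a)%R : measurableTypeR R).
  exact: measurable_funD.
have f0' : {in [set: measurableTypeR R], forall y, 0 <= f y} by [].
have mf' : measurable_fun setT (f : measurableTypeR R -> \bar R) := mf.
rewrite -[LHS](ge0_integral_pushforward ms leb measurableT mf' f0').
by apply: eq_measure_integral => A mA _; exact: lebesgue_measure_shift.
Qed.

Lemma measurable_rV_shift n (a : 'rV[R]_n) : measurable_fun setT (fun x : 'rV[R]_n => (x + a)%R).
Proof.
apply: measurable_fun_rV => j; under eq_fun do rewrite mxE.
by apply: measurable_funD => //; exact: measurable_coord.
Qed.

Lemma ge0_integral_rV_shift n (a : 'rV[R]_n) (f : 'rV[R]_n -> \bar R) :
  measurable_fun setT f -> (forall x, 0 <= f x) ->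
  \int[lebesgue_rV R n]_x f (x + a)%R = \int[lebesgue_rV R n]_x f x.
Proof.
elim: n => [|n IH] in a f *; move=> mf f0.
  by rewrite !integral_rV0; congr f; apply/rowP => -[].
have mfa : measurable_fun setT (fun x : 'rV[R]_n.+1 => f (x + a)%R).
  by apply: measurableT_comp => //; exact: measurable_rV_shift.
rewrite (ge0_integral_rVS _ _ mfa (fun x => f0 _)) (ge0_integral_rVS _ _ mf f0).
pose F t := \int[lebesgue_rV R n]_x f (rV_cons (t, x)).
have mF : measurable_fun setT F.
  apply: (measurable_fun_fubini_tonelli_F (f \o @rV_cons R n)) => //=.
  by apply: measurableT_comp => //; exact: mrV_cons.
have F0 t : 0 <= F t by apply: integral_ge0 => x _; exact: f0.
rewrite -[RHS](ge0_integral_shift (a ord0 ord0) F mF F0).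
apply: eq_integral => t _.
have mft : measurable_fun setT (fun x : 'rV[R]_n => f (rV_cons ((t + a ord0 ord0)%R, x))).
  by apply: measurableT_comp => //; exact: measurable_fun_rV_consl.
rewrite /F -[RHS](IH (\row_k a ord0 (lift ord0 k)) _ mft (fun x => f0 _)).
apply: eq_integral => x _; congr f; apply/rowP => j; rewrite !mxE.
by case: unliftP => [k jk|j0] /=; rewrite ?mxE ?jk ?j0.
Qed.

Lemma integral_rV_shift n (a : 'rV[R]_n) (f : 'rV[R]_n -> \bar R) :
  measurable_fun setT f ->
  \int[lebesgue_rV R n]_x f (x + a)%R = \int[lebesgue_rV R n]_x f x.
Proof.
move=> mf; rewrite integralE [RHS]integralE; congr (_ - _).
  rewrite -[RHS](ge0_integral_rV_shift _ a)//; last exact: measurable_funepos.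
  by apply: eq_integral => x _; rewrite /= (funepos_comp f).
rewrite -[RHS](ge0_integral_rV_shift _ a)//; last exact: measurable_funeneg.
by apply: eq_integral => x _; rewrite /= (funeneg_comp f).
Qed.

Lemma integrable_rV_shift n (a : 'rV[R]_n) (f : 'rV[R]_n -> \bar R) :
  (lebesgue_rV R n).-integrable setT f ->
  (lebesgue_rV R n).-integrable setT (fun x : 'rV[R]_n => f (x + a)%R).
Proof.
move=> /integrableP[mf foo]; apply/integrableP; split.
  by apply: measurableT_comp => //; exact: measurable_rV_shift.
rewrite (ge0_integral_rV_shift _ a (abse \o f)) => [//||x]; last exact: abse_ge0.
exact: measurableT_comp.
Qed.

Lemma prod_rV_cons n (g : 'I_n.+1 -> R -> R) t (x : 'rV[R]_n) :
  (\prod_j g j (rV_cons (t, x) ord0 j) =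
   g ord0 t * \prod_j g (lift ord0 j) (x ord0 j))%R.
Proof.
rewrite big_ord_recl mxE unlift_none/=; congr (_ * _)%R.
by apply: eq_bigr => j _; rewrite mxE liftK.
Qed.

Lemma measurable_rV_prod n (g : 'I_n -> R -> R) :
  (forall j, measurable_fun setT (g j)) ->
  measurable_fun setT (fun x : 'rV[R]_n => (\prod_j g j (x ord0 j))%R).
Proof.
move=> mg; apply: measurable_prod => j _.
by apply: (measurableT_comp (mg j)); exact: measurable_coord.
Qed.

Lemma ge0_integral_rV_prod n (g : 'I_n -> R -> R) (c : 'I_n -> R) :
  (forall j, measurable_fun setT (g j)) -> (forall j t, (0 <= g j t)%R) ->
  (forall j, \int[leb]_t (g j t)%:E = (c j)%:E) ->
  \int[lebesgue_rV R n]_x (\prod_j g j (x ord0 j))%:E = (\prod_j c j)%:E.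
Proof.
elim: n => [|n IH] in g c *; move=> mg g0 gc.
  by rewrite integral_rV0 !big_ord0.
have mP m (h : 'I_m -> R -> R) : (forall j, measurable_fun setT (h j)) ->
  measurable_fun setT (fun x : 'rV[R]_m => (\prod_j h j (x ord0 j))%:E).
  by move=> mh; apply/measurable_EFinP; exact: measurable_rV_prod.
have P0 m (h : 'I_m -> R -> R) (x : 'rV[R]_m) : (forall j t, (0 <= h j t)%R) ->
    0 <= (\prod_j h j (x ord0 j))%:E by move=> h0; rewrite lee_fin prodr_ge0.
have c0 j : (0 <= c j)%R.
  by rewrite -lee_fin -gc; apply: integral_ge0 => t _; rewrite lee_fin.
rewrite ge0_integral_rVS; [|exact: mP|by move=> x; exact: (P0 _ g x g0)].
under eq_integral => t _.
  under eq_integral do rewrite prod_rV_cons EFinM.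
  rewrite ge0_integralZl_EFin; [|exact: measurableT
    |by move=> x _; exact: (P0 _ (fun j => g (lift ord0 j)) x (fun j => g0 _))
    |exact: (mP _ (fun j => g (lift ord0 j)) (fun j => mg _))|exact: g0].
  rewrite (IH (fun j => g (lift ord0 j)) (fun j => c (lift ord0 j))) => [|//|//|j]; last exact: gc.
  over.
rewrite ge0_integralZr; last 4 first.
- exact: measurableT.
- by apply/measurable_EFinP; exact: (mg ord0).
- by move=> t _; rewrite lee_fin.
- by rewrite lee_fin prodr_ge0.
by rewrite gc -EFinM big_ord_recl.
Qed.

Lemma lebesgue_measure_opp (A : set R) :
  measurable A -> leb ((fun x : R => (- x)%R) @^-1` A) = leb A.
Proof.
move=> mA.
have ms : measurable_fun setT (fun x : measurableTypeR R => (- x)%R : measurableTypeR R).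
  exact: measurable_funN.
pose m : {measure set (measurableTypeR R) -> \bar R} :=
  measure_function_pushforward__canonical__measure_function_Measure leb ms.
apply/esym; apply: (@lebesgue_measure_unique R m _ A mA).
move=> _ [[x y] _ <-] /=; rewrite /pushforward.
rewrite (_ : _ @^-1` _ = `[(- y)%R, (- x)%R[%classic); last first.
  by apply/seteqP; split => z /=; rewrite !in_itv/= lerNl ltrNr andbC.
rewrite !lebesgue_measure_itv/= !lte_fin ltrN2; case: ifP => // _.
by rewrite -!EFinB; congr EFin; ring.
Qed.

Lemma integral_reflect (f : R -> \bar R) : leb.-integrable setT f ->
  \int[leb]_x f (- x)%R = \int[leb]_x f x.
Proof.
move=> intf.
have ms : measurable_fun setT (fun x : measurableTypeR R => (- x)%R : measurableTypeR R).
  exact: measurable_funN.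
have oppE g : measurable_fun setT g -> (forall x, 0 <= g x) ->
    \int[leb]_x g (- x)%R = \int[leb]_x g x.
  move=> mg g0; have g0' : {in [set: measurableTypeR R], forall y, 0 <= g y} by [].
  have mg' : measurable_fun setT (g : measurableTypeR R -> \bar R) := mg.
  rewrite -[LHS](ge0_integral_pushforward ms leb measurableT mg' g0').
  by apply: eq_measure_integral => A mA _; exact: lebesgue_measure_opp.
have mf := measurable_int _ intf.
rewrite integralE [RHS]integralE; congr (_ - _).
  rewrite -[RHS]oppE//; last exact: measurable_funepos.
  by apply: eq_integral => x _; rewrite /= (funepos_comp f).
rewrite -[RHS]oppE//; last exact: measurable_funeneg.
by apply: eq_integral => x _; rewrite /= (funeneg_comp f).
Qed.

End rV_integral.

Section real_convergence.
Context {R : realType} {d : measure_display} {T : measurableType d}.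
Variable mu : {measure set T -> \bar R}.
Local Open Scope ereal_scope.

Lemma dct_real (f_ : nat -> T -> R) (f g : T -> R) :
  (forall n, measurable_fun setT (f_ n)) ->
  (forall x, (f_ n x @[n --> \oo] --> f x)%R) ->
  mu.-integrable setT (fun x => (g x)%:E) ->
  (forall n x, (`|f_ n x| <= g x)%R) ->
  \int[mu]_x (f_ n x)%:E @[n --> \oo] --> \int[mu]_x (f x)%:E.
Proof.
move=> mf_ f_f ig fg.
have mf : measurable_fun setT f by apply: (measurable_fun_cvg mf_) => x _; exact: f_f.
have mf_' n : measurable_fun setT (fun x => (f_ n x)%:E) by exact/measurable_EFinP.
have mf' : measurable_fun setT (fun x => (f x)%:E) by exact/measurable_EFinP.
have f_f' : {ae mu, forall x, setT x -> (f_ n x)%:E @[n --> \oo] --> (f x)%:E}.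
  by apply: aeW => x _; apply: cvg_EFin; [exact: nearW|exact: f_f].
have fg' : {ae mu, forall x n, setT x -> `|(f_ n x)%:E| <= (g x)%:E}.
  by apply: aeW => x n _; rewrite abse_EFin lee_fin.
by have [] := dominated_convergence measurableT mf_' mf' f_f' ig fg'.
Qed.

End real_convergence.

(** * One-dimensional integrals and the Cauchy kernel *)

Section one_dimensional_integrals.
Context {R : realType}.
Local Notation leb := (@lebesgue_measure R).

(** In the applications [g] is [f] with [|x|] replaced by [x]: it agrees with [f] on the right
    half-line and has an explicit antiderivative that is differentiable also at 0. *)
Lemma even_integral (f g F : R -> R) (l : R) :
  (forall x, 0 <= f x) -> continuous f -> f =1 f \o -%R ->
  (forall x, 0 <= x -> f x = g x) -> (forall x : R, is_derive x (1 : R) F (g x)) ->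
  F x @[x --> +oo] --> l ->
  (\int[leb]_x (f x)%:E)%E = (2 * (l - F 0))%:E.
Proof.
move=> f0 cf ef fg dF Fl.
have cF x : {for x, continuous F}.
  by apply/differentiable_continuous/derivable1_diffP; have [] := dF x.
rewrite ge0_symfun_integralT// -set_itvcy (@ge0_continuous_FTC2y R f F 0 l)//.
- exact: continuous_subspaceT.
- by apply: cvg_at_right_filter; exact: cF.
- move=> x; rewrite in_itv/= andbT => x0; rewrite derive1E fg ?ltW//.
  by have [_ ->] := dF x.
Qed.

Lemma integral_oneDsqrV : (\int[leb]_x ((1 + x ^+ 2)^-1)%:E)%E = pi%:E.
Proof.
rewrite (even_integral _ (fun x => (1 + x ^+ 2)^-1) atan (pi / 2)).
- by rewrite atan0 subr0; congr EFin; field.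
- by move=> x; rewrite invr_ge0 addr_ge0// sqr_ge0.
- by move=> x; exact: continuous_oneDsqrV.
- by move=> x /=; rewrite sqrrN.
- by [].
- exact: cvgy_atan.
Qed.

(** The Fourier transform of [exp (- s |x|)] at the frequency [u]. *)
Definition cauchy_kernel (s u : R) : R := 2 * s / (s ^+ 2 + (2 * pi * u) ^+ 2).

Lemma cauchy_kernel_ge0 s u : 0 < s -> 0 <= cauchy_kernel s u.
Proof.
by move=> s0; rewrite divr_ge0 ?mulr_ge0 ?addr_ge0 ?sqr_ge0// ltW.
Qed.

Lemma continuous_cauchy_kernel s : 0 < s -> continuous (cauchy_kernel s).
Proof.
move=> s0 x; apply: cvgM; first exact: cvg_cst.
apply: cvgV; first by rewrite lt0r_neq0// ltr_pwDl ?sqr_ge0// exprn_gt0.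
apply: cvgD; first exact: cvg_cst.
apply: (@cvg_comp _ _ _ (fun x => 2 * pi * x) (fun x => x ^+ 2)); last exact: exprn_continuous.
by apply: cvgMr; exact: cvg_id.
Qed.

Lemma integral_cauchy_kernel s : 0 < s ->
  (\int[leb]_u (cauchy_kernel s u)%:E)%E = 1%:E.
Proof.
move=> s0; have p0 : 0 < pi :> R := pi_gt0 R.
have dF (u : R) : is_derive u (1 : R) (fun u => pi^-1 * atan (2 * pi / s * u)) (cauchy_kernel s u).
  apply: is_derive_eq; rewrite /GRing.scale/=.
  rewrite mulr1 /cauchy_kernel; move: p0; move: (pi : R) => q q0.
  have e : s ^+ 2 + (2 * q * u) ^+ 2 != 0.
    by rewrite lt0r_neq0// ltr_pwDl ?sqr_ge0// exprn_gt0.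
  by field; rewrite e !lt0r_neq0.
rewrite (even_integral _ _ _ (pi^-1 * (pi / 2)) _ _ _ _ dF)//.
- rewrite mulr0 atan0 mulr0 subr0; congr EFin.
  by rewrite mulKf ?lt0r_neq0// divff.
- by move=> u; exact: cauchy_kernel_ge0.
- exact: continuous_cauchy_kernel.
- by move=> u /=; rewrite /cauchy_kernel mulrN sqrrN.
- apply: cvgMr; apply: (@cvg_comp _ _ _ (fun u => 2 * pi / s * u) atan); last exact: cvgy_atan.
  by apply: gt0_cvgMry; rewrite ?divr_gt0 ?mulr_gt0.
Qed.

Lemma continuous_expR_abs (s : R) : continuous (fun x : R => expR (- (s * `|x|))).
Proof.
move=> x; apply: (@cvg_comp _ _ _ (fun x : R => - (s * `|x|)) expR); last exact: continuous_expR.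
by apply: cvgN; apply: cvgMr; apply: cvg_norm; exact: cvg_id.
Qed.

Lemma cvgy_expRN (s : R) : 0 < s -> expR (- (s * x)) @[x --> +oo] --> 0.
Proof.
move=> s0; apply: (@cvg_comp _ _ _ (fun x : R => s * x) (fun x => expR (- x))); last exact: cvgr_expR.
exact: gt0_cvgMry.
Qed.

Lemma integral_expR_abs s : 0 < s ->
  (\int[leb]_x (expR (- (s * `|x|)))%:E)%E = (2 / s)%:E.
Proof.
move=> s0.
have dF (x : R) : is_derive x (1 : R) (fun x => - s^-1 * expR (- (s * x))) (expR (- (s * x))).
  apply: is_derive_eq; rewrite /GRing.scale/=.
  by move: (expR _) => E; field; rewrite lt0r_neq0.
rewrite (even_integral _ _ _ 0 _ _ _ _ dF)//.
- by rewrite mulr0 oppr0 expR0; congr EFin; ring.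
- exact: continuous_expR_abs.
- by move=> x /=; rewrite normrN.
- by move=> x x0; rewrite ger0_norm.
- rewrite -(mulr0 (- s^-1)); apply: cvgMr; exact: cvgy_expRN.
Qed.

Lemma measurable_expR_abs (s : R) : measurable_fun setT (fun x : R => expR (- (s * `|x|))).
Proof. by apply: continuous_measurable_fun; exact: continuous_expR_abs. Qed.

Lemma integrable_expR_abs s : 0 < s ->
  leb.-integrable setT (fun x => (expR (- (s * `|x|)))%:E).
Proof.
move=> s0; apply/integrableP; split; first by apply/measurable_EFinP; exact: measurable_expR_abs.
under eq_integral do rewrite abse_EFin ger0_norm ?expR_ge0//.
by rewrite integral_expR_abs ?ltry.
Qed.

(** The summand 1 makes the integrand nonnegative, as [even_integral] requires; it is subtracted
    again in [integral_expR_abs_cosM]. *)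
Lemma integral_expR_abs_cos s a : 0 < s ->
  (\int[leb]_x (expR (- (s * `|x|)) * (1 + cos (a * x)))%:E)%E =
  (2 / s + 2 * s / (s ^+ 2 + a ^+ 2))%:E.
Proof.
move=> s0.
have sa : s ^+ 2 + a ^+ 2 != 0 by rewrite lt0r_neq0// ltr_pwDl ?sqr_ge0// exprn_gt0.
have dF (x : R) : is_derive x (1 : R)
  (fun x => expR (- (s * x)) * ((a * sin (a * x) - s * cos (a * x)) / (s ^+ 2 + a ^+ 2) - s^-1))
  (expR (- (s * x)) * (1 + cos (a * x))).
  apply: is_derive_eq; rewrite /GRing.scale/=.
  by move: (expR _) (sin _) (cos _) => E S C; field; rewrite sa lt0r_neq0.
rewrite (even_integral _ _ _ 0 _ _ _ _ dF)//.
- rewrite !mulr0 oppr0 expR0 sin0 cos0; congr EFin; field.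
  by rewrite sa lt0r_neq0.
- move=> x; apply: cvgM; first exact: continuous_expR_abs.
  apply: cvgD; first exact: cvg_cst.
  apply: (@cvg_comp _ _ _ (fun x => a * x) cos); last exact: continuous_cos.
  by apply: cvgMr; exact: cvg_id.
- by move=> x /=; rewrite normrN mulrN cosN.
- by move=> x x0; rewrite ger0_norm.
- pose M := ((`|a| + s) / (s ^+ 2 + a ^+ 2) + s^-1).
  have bd (x : R) : `|expR (- (s * x)) * ((a * sin (a * x) - s * cos (a * x)) /
      (s ^+ 2 + a ^+ 2) - s^-1)| <= expR (- (s * x)) * M.
    rewrite normrM gtr0_norm ?expR_gt0// ler_wpM2l// (le_trans (ler_normB _ _))//.
    rewrite lerD//; last by rewrite gtr0_norm ?invr_gt0.
    rewrite normrM (@gtr0_norm _ _^-1) ?invr_gt0 ?ltr_pwDl ?sqr_ge0 ?exprn_gt0//.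
    rewrite ler_wpM2r ?invr_ge0 ?addr_ge0 ?sqr_ge0// (le_trans (ler_normB _ _))// lerD//.
      by rewrite normrM ler_piMr// ler_norml sin_geN1 sin_le1.
    by rewrite normrM gtr0_norm// ler_piMr ?(ltW s0)// ler_norml cos_geN1 cos_le1.
  have M0 : expR (- (s * x)) * M @[x --> +oo] --> 0.
    by rewrite -(mul0r M); apply: cvgMl; exact: cvgy_expRN.
  apply: (@squeeze_cvgr _ _ _ _ (fun x => - (expR (- (s * x)) * M))
      (fun x => expR (- (s * x)) * M)) => //.
    by near=> x; rewrite -ler_norml.
  by rewrite -oppr0; apply: cvgN.
Unshelve. all: by end_near. Qed.

Lemma integral_expR_abs_cosM s a : 0 < s ->
  (\int[leb]_x (expR (- (s * `|x|)) * cos (a * x))%:E)%E =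
  (2 * s / (s ^+ 2 + a ^+ 2))%:E.
Proof.
move=> s0; have I1 := integral_expR_abs s s0; have I2 := integral_expR_abs_cos s a s0.
have iE := integrable_expR_abs s s0; have mE := measurable_expR_abs s.
have mC : measurable_fun setT (fun x : R => cos (a * x)).
  apply: continuous_measurable_fun => x.
  apply: (@cvg_comp _ _ _ (fun x => a * x) cos); last exact: continuous_cos.
  by apply: cvgMr; exact: cvg_id.
have iC : leb.-integrable setT (fun x => (expR (- (s * `|x|)) * (1 + cos (a * x)))%:E).
  apply/integrableP; split.
    by apply/measurable_EFinP/measurable_funM => //; exact: measurable_funD.
  under eq_integral => x _.
    rewrite gee0_abs; last first.
      by rewrite lee_fin; apply: mulr_ge0 => //; have := cos_geN1 (a * x); lra.
    over.
  by rewrite I2 ltry.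
transitivity (\int[leb]_x ((expR (- (s * `|x|)) * (1 + cos (a * x)))%:E -
    (expR (- (s * `|x|)))%:E))%E.
  by apply: eq_integral => x _; rewrite -EFinB; congr EFin; ring.
by rewrite integralB// I1 I2 -EFinB; congr EFin; ring.
Qed.

Lemma integral_expR_abs_sin s a : 0 < s ->
  (\int[leb]_x (expR (- (s * `|x|)) * sin (a * x))%:E)%E = 0%:E.
Proof.
move=> s0.
have mS : measurable_fun setT (fun x : R => sin (a * x)).
  apply: continuous_measurable_fun => x.
  apply: (@cvg_comp _ _ _ (fun x => a * x) sin); last exact: continuous_sin.
  by apply: cvgMr; exact: cvg_id.
have iS : leb.-integrable setT (fun x => (expR (- (s * `|x|)) * sin (a * x))%:E).
  apply: (le_integrable _ _ _ (integrable_expR_abs s s0)) => //.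
    by apply/measurable_EFinP/measurable_funM => //; exact: measurable_expR_abs.
  move=> x _; rewrite !abse_EFin lee_fin normrM ler_piMr//.
  by rewrite ler_norml sin_geN1 sin_le1.
have := integral_reflect _ iS.
under eq_integral do rewrite normrN mulrN sinN mulrN EFinN.
rewrite integralN//; last by apply: integrable_add_def.
have := integrable_fin_num measurableT iS.
by case: (integral _ _ _) => // r _ [h]; congr EFin; lra.
Qed.

(** A dominating function that does not depend on [s]. For [|u| >= 1] it is the decay of the kernel;
    for [|u| < 1] the factor [|u|] is used through [2 s |u| <= s ^+ 2 + u ^+ 2]. *)
Lemma cauchy_kernel_min_le s u : 0 < s -> s <= 1 ->
  Num.min 1 `|u| * cauchy_kernel s u <= 2 * (1 + u ^+ 2)^-1.
Proof.
move=> s0 s1; have p1 : 1 <= pi :> R by apply: le_trans (pi_ge2 R); lra.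
have D0 : 0 < s ^+ 2 + (2 * pi * u) ^+ 2 by rewrite ltr_pwDl ?sqr_ge0// exprn_gt0.
have E0 : 0 < 1 + u ^+ 2 by rewrite ltr_pwDl ?sqr_ge0.
rewrite /cauchy_kernel mulrA ler_pdivrMr// mulrAC ler_pdivlMr//.
have D1 : s ^+ 2 + u ^+ 2 <= s ^+ 2 + (2 * pi * u) ^+ 2.
  rewrite lerD2l exprMn ler_peMl ?sqr_ge0//.
  by move: p1; move: (pi : R) => q q1; nra.
have D4 : 4 * u ^+ 2 <= (2 * pi * u) ^+ 2.
  by rewrite exprMn ler_wpM2r ?sqr_ge0// exprMn; move: p1; move: (pi : R) => q q1; nra.
have D2 : (2 * pi * u) ^+ 2 <= s ^+ 2 + (2 * pi * u) ^+ 2 by rewrite lerDr sqr_ge0.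
move: D1 D4 D2 {D0}; set D := s ^+ 2 + (2 * pi * u) ^+ 2; move: D => D.
move: ((2 * pi * u) ^+ 2) => q.
have [u1|u1] := leP 1 `|u|; rewrite -(real_normK (num_real u)); move: `|u| (normr_ge0 u) u1.
  by move=> a a0 a1 D1 D4 D2; nra.
move=> a a0 a1 D1 D4 D2.
have : 0 <= (s - a) ^+ 2 by exact: sqr_ge0.
have : a ^+ 2 <= 1 by nra.
have : 0 <= a * s by exact: mulr_ge0 (ltW s0).
by nra.
Qed.

(** [Num.min 1 |u|] is bounded below away from 0, so this expresses that the mass, which is 1 by
    [integral_cauchy_kernel], concentrates at 0. *)
Lemma cauchy_kernel_concentrates :
  (\int[leb]_u (Num.min 1 `|u| * cauchy_kernel k.+1%:R^-1 u)%:E)%E @[k --> \oo] --> 0%E.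
Proof.
pose s k : R := k.+1%:R^-1.
have s0 k : 0 < s k by rewrite invr_gt0.
have s1 k : s k <= 1 by rewrite invf_le1 ?ler1n.
have mm : measurable_fun setT (fun u : R => Num.min 1 `|u|).
  by apply: measurable_minr => //; exact: measurable_normr.
have mk k : measurable_fun setT (cauchy_kernel (s k)).
  by apply: continuous_measurable_fun; exact: continuous_cauchy_kernel.
have m0 (u : R) : 0 <= Num.min 1 `|u| by rewrite le_min ler01 normr_ge0.
have mD : measurable_fun setT (fun u : R => (1 + u ^+ 2)^-1).
  by apply: continuous_measurable_fun => u; exact: continuous_oneDsqrV.
have k_cvg u : Num.min 1 `|u| * cauchy_kernel (s k) u @[k --> \oo] --> (0 : R).
  have [->|u0] := eqVneq u 0.
    under eq_fun do rewrite normr0 min_r ?ler01// mul0r.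
    exact: cvg_cst.
  have q0 : (2 * pi * u) ^+ 2 != 0 :> R.
    by rewrite sqrf_eq0 !mulf_neq0// lt0r_neq0// pi_gt0.
  have s_cvg : s k @[k --> \oo] --> (0 : R) by exact: cvg_harmonic.
  have h : Num.min 1 `|u| * (2 * s k / (s k ^+ 2 + (2 * pi * u) ^+ 2)) @[k --> \oo] -->
      Num.min 1 `|u| * (2 * 0 / (0 ^+ 2 + (2 * pi * u) ^+ 2)).
    apply: cvgMr; apply: cvgM; first exact: cvgMr.
    apply: cvgV; first by rewrite expr0n add0r.
    apply: cvgD; last exact: cvg_cst.
    exact: (cvg_comp _ (fun x => x ^+ 2) s_cvg (@exprn_continuous R 2 0)).
  by rewrite mulr0 mul0r mulr0 in h; exact: h.
have ig : leb.-integrable setT (fun u => (2 * (1 + u ^+ 2)^-1)%:E).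
  apply/integrableP; split; first by apply/measurable_EFinP/measurable_funM.
  under eq_integral do rewrite abse_EFin ger0_norm ?mulr_ge0 ?invr_ge0 ?addr_ge0 ?sqr_ge0// EFinM.
  rewrite ge0_integralZl_EFin//.
  - by rewrite integral_oneDsqrV -EFinM ltry.
  - by move=> u _; rewrite lee_fin invr_ge0 addr_ge0// sqr_ge0.
  - exact/measurable_EFinP.
rewrite -[X in _ --> X](integral0 leb setT).
apply: (dct_real leb _ _ _ _ k_cvg ig) => [k|k u]; first by apply: measurable_funM; [exact: mm|exact: mk].
rewrite ger0_norm; last by apply: mulr_ge0; [exact: m0|exact: cauchy_kernel_ge0].
exact: (cauchy_kernel_min_le _ _ (s0 k) (s1 k)).
Qed.

End one_dimensional_integrals.

(** * Schwartz functions and Fourier inversion *)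

Section schwartz_functions.
Context {R : realType} {d : nat}.
Local Notation leb := (lebesgue_rV R d).
Implicit Types (phi psi : 'rV[R]_d -> R).

(** A product instead of a radial weight: it is integrated coordinate by coordinate, and the decay
    of Fourier coefficients is also proved one coordinate at a time. *)
Definition weight (x : 'rV[R]_d) : R := \prod_j (1 + x ord0 j ^+ 2)^-1.

Lemma weight_gt0 x : 0 < weight x.
Proof. by apply: prodr_gt0 => j _; rewrite invr_gt0 ltr_pwDl ?sqr_ge0. Qed.

Lemma measurable_weight : measurable_fun setT weight.
Proof.
apply: (measurable_rV_prod _ (fun _ t => (1 + t ^+ 2)^-1)) => j.
by apply: continuous_measurable_fun => t; exact: continuous_oneDsqrV.
Qed.

Lemma integrable_weight (C : R) : leb.-integrable setT (fun x => (C * weight x)%:E).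
Proof.
have -> : (fun x => (C * weight x)%:E) = (fun x => C%:E * (weight x)%:E)%E by [].
apply: integrableZl => //; apply/integrableP; split.
  by apply/measurable_EFinP; exact: measurable_weight.
under eq_integral do rewrite abse_EFin gtr0_norm ?weight_gt0//.
rewrite (ge0_integral_rV_prod _ (fun _ t => (1 + t ^+ 2)^-1) (fun=> pi)) ?ltry//.
- by move=> j; apply: continuous_measurable_fun => t; exact: continuous_oneDsqrV.
- by move=> j t; rewrite invr_ge0 addr_ge0// sqr_ge0.
- by move=> j; exact: integral_oneDsqrV.
Qed.

(** Lets one multiple of [weight] dominate all difference quotients with step at most 1. *)
Lemma weight_shift x j t : 0 <= t <= 1 -> weight (x + axis t j) <= 3 * weight x.
Proof.
move=> /andP[t0 t1].
rewrite /weight (bigD1 j)//= [in leRHS](bigD1 j)//= mulrA.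
have -> : \prod_(k < d | k != j) (1 + (x + axis t j) ord0 k ^+ 2)^-1 =
          \prod_(k < d | k != j) (1 + x ord0 k ^+ 2)^-1.
  by apply: eq_bigr => k kj; rewrite !mxE (negbTE kj) andbF mulr0 addr0.
rewrite ler_wpM2r//; first by apply: prodr_ge0 => k _; rewrite invr_ge0 addr_ge0 ?sqr_ge0.
rewrite !mxE !eqxx mulr1 -[leLHS]div1r ler_pdivrMr ?ltr_pwDl ?sqr_ge0// mulrAC ler_pdivlMr ?ltr_pwDl ?sqr_ge0//.
(* With [y = x_j], the difference [3 (1 + (y + t) ^+ 2) - (1 + y ^+ 2)] is half this square plus
   [2 - 3 t ^+ 2 / 2]. *)
have : 0 <= (2 * x ord0 j + 3 * t) ^+ 2 by exact: sqr_ge0.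
move=> h; have t2 : t ^+ 2 <= 1 by rewrite expr_le1.
by move: h t2; move: (x ord0 j) => y h t2; nra.
Qed.

Lemma schwartz_deriv phi j :
  schwartz phi -> schwartz ('D_(delta_mx ord0 j) phi).
Proof.
move=> sphi s; have := sphi (rcons s j).
suff -> : partial_derivs (rcons s j) phi =
          partial_derivs s ('D_(delta_mx ord0 j) phi) by [].
by elim: s => //= k s ->.
Qed.

Lemma schwartz_differentiable phi x : schwartz phi -> differentiable phi x.
Proof. by move=> /(_ [::])[]. Qed.

Lemma schwartz_measurable phi : schwartz phi -> measurable_fun setT phi.
Proof.
move=> sphi; apply: continuous_measurable_rV => x.
exact/differentiable_continuous/schwartz_differentiable.
Qed.

Lemma schwartz_bound phi : schwartz phi ->
  exists C : R, 0 <= C /\ forall x, `|phi x| <= C * weight x.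
Proof.
(* The exponent [2 * d] pays for [d] factors [1 + x_j ^+ 2], each at most [(1 + norm2 x) ^+ 2]. *)
move=> /(_ [::])[_ /(_ (2 * d)%N)[C hC]].
exists C; split.
  by apply: le_trans (hC 0); rewrite mulr_ge0// exprn_ge0// addr_ge0// sqrtr_ge0.
move=> x; have n0 : 0 <= norm2 x by exact: sqrtr_ge0.
have w0 : 0 < \prod_(j < d) (1 + x ord0 j ^+ 2).
  by apply: prodr_gt0 => j _; rewrite ltr_pwDl ?sqr_ge0.
rewrite /weight prodfV ler_pdivlMr// mulrC; apply: le_trans (hC x).
rewrite ler_wpM2r// exprM (_ : _ ^+ d = \prod_(j < d) (1 + norm2 x) ^+ 2); last first.
  by rewrite prodr_const card_ord.
apply: ler_prod => j _; rewrite addr_ge0 ?sqr_ge0//=.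
have n2 : norm2 x ^+ 2 = dotv x x.
  by rewrite sqr_sqrtr//; apply: sumr_ge0 => k _; rewrite -expr2 sqr_ge0.
have : x ord0 j ^+ 2 <= norm2 x ^+ 2.
  rewrite n2 /dotv (bigD1 j)//= -expr2 lerDl.
  by apply: sumr_ge0 => k _; rewrite -expr2 sqr_ge0.
by nra.
Qed.

Lemma schwartz_integrable phi : schwartz phi -> leb.-integrable setT (fun x => (phi x)%:E).
Proof.
move=> sphi; have [C [C0 hC]] := schwartz_bound _ sphi.
apply: (le_integrable _ _ _ (integrable_weight C)) => //.
  by apply/measurable_EFinP; exact: schwartz_measurable.
move=> x _; rewrite !abse_EFin lee_fin (le_trans (hC x))// ler_norm//.
Qed.

Lemma axis_derive phi x j t : schwartz phi ->
  is_derive (t : R) (1 : R) (fun t => phi (x + axis t j))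
    ('D_(delta_mx ord0 j) phi (x + axis t j)).
Proof.
move=> sphi.
have dphi : derivable phi (x + axis t j) (delta_mx ord0 j).
  exact/diff_derivable/schwartz_differentiable.
have E : (fun h : R => h^-1 *: (phi (x + axis (h *: 1 + t) j) - phi (x + axis t j))) =
         (fun h : R => h^-1 *: (phi (h *: delta_mx ord0 j + (x + axis t j)) - phi (x + axis t j))).
  apply/funext => h; congr (_ *: (phi _ - _)).
  by rewrite /axis [h *: 1]mulr1 scalerDl addrCA.
by split; rewrite /derivable /derive /= E.
Qed.

Lemma schwartz_MVT phi x j h : schwartz phi -> 0 < h ->
  exists2 t, 0 <= t <= h & phi (x + axis h j) - phi x =
    'D_(delta_mx ord0 j) phi (x + axis t j) * h.
Proof.
move=> sphi h0.
have df (t : R) : t \in `]0, h[ -> is_derive t (1 : R) (fun t => phi (x + axis t j))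
    ('D_(delta_mx ord0 j) phi (x + axis t j)) by move=> _; exact: axis_derive.
have cf : {within `[0, h], continuous (fun t => phi (x + axis t j))}.
  apply: continuous_subspaceT => t.
  apply/differentiable_continuous/derivable1_diffP.
  by have [] := axis_derive phi x j t sphi.
have [t + E] := MVT h0 df cf.
rewrite in_itv/= => /andP[t0 th]; exists t; first by rewrite !ltW.
by move: E; rewrite {2}/axis scale0r addr0 subr0.
Qed.

End schwartz_functions.

(** * Cosine and sine transforms of Schwartz functions *)

Section fourier_coefficients.
Context {R : realType} {d : nat}.
Local Notation leb := (lebesgue_rV R d).
Implicit Types (phi psi : 'rV[R]_d -> R) (x y xi : 'rV[R]_d).

Lemma dotvC (x y : 'rV[R]_d) : dotv x y = dotv y x.
Proof. by apply: eq_bigr => j _; rewrite mulrC. Qed.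

Lemma measurable_dotv : measurable_fun setT (fun z : 'rV[R]_d * 'rV[R]_d => dotv z.1 z.2).
Proof.
apply: measurable_sum => j; apply: measurable_funM.
  apply: (@measurableT_comp _ _ _ _ _ _ (fun x : 'rV[R]_d => x ord0 j) _ fst) => //.
  exact: measurable_coord.
apply: (@measurableT_comp _ _ _ _ _ _ (fun x : 'rV[R]_d => x ord0 j) _ snd) => //.
exact: measurable_coord.
Qed.

Lemma measurable_dotvr (xi : 'rV[R]_d) : measurable_fun setT (fun x : 'rV[R]_d => dotv x xi).
Proof.
apply: measurable_sum => j; apply: measurable_funM => //; exact: measurable_coord.
Qed.

Definition wave (f : R -> R) (xi x : 'rV[R]_d) : R := f (2 * pi * dotv x xi).

Lemma waveC f xi x : wave f xi x = wave f x xi.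
Proof. by rewrite /wave dotvC. Qed.

Lemma measurable_wave (f : R -> R) xi : continuous f -> measurable_fun setT (wave f xi).
Proof.
move=> cf; apply: (measurableT_comp (continuous_measurable_fun cf)).
by apply: measurable_funM => //; exact: measurable_dotvr.
Qed.

Lemma integrable_mul_le1 (f g : 'rV[R]_d -> R) :
  leb.-integrable setT (fun x => (f x)%:E) -> measurable_fun setT g ->
  (forall x, `|g x| <= 1) -> leb.-integrable setT (fun x => (f x * g x)%:E).
Proof.
move=> intf mg g1.
have mf : measurable_fun setT f by apply/measurable_EFinP; exact: measurable_int intf.
apply: (le_integrable _ _ _ intf) => //.
  by apply/measurable_EFinP; exact: measurable_funM.
by move=> x _; rewrite !abse_EFin lee_fin normrM ler_piMr.
Qed.

Lemma normr_cos_le1 (t : R) : `|cos t| <= 1.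
Proof. by rewrite ler_norml cos_geN1 cos_le1. Qed.

Lemma normr_sin_le1 (t : R) : `|sin t| <= 1.
Proof. by rewrite ler_norml sin_geN1 sin_le1. Qed.

Lemma integrable_mul_cos (f : 'rV[R]_d -> R) xi :
  leb.-integrable setT (fun x => (f x)%:E) ->
  leb.-integrable setT (fun x => (f x * wave cos xi x)%:E).
Proof.
move=> intf; apply: integrable_mul_le1 => //; last by move=> x; exact: normr_cos_le1.
by apply: measurable_wave; exact: continuous_cos.
Qed.

Lemma integrable_mul_sin (f : 'rV[R]_d -> R) xi :
  leb.-integrable setT (fun x => (f x)%:E) ->
  leb.-integrable setT (fun x => (f x * wave sin xi x)%:E).
Proof.
move=> intf; apply: integrable_mul_le1 => //; last by move=> x; exact: normr_sin_le1.
by apply: measurable_wave; exact: continuous_sin.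
Qed.

(** The Fourier transform of a real [phi] is [fcos - 'i fsin]; all that follows is done with these
    two real integrals. *)
Definition fcos phi xi : R := (\int[leb]_y (phi y * wave cos xi y))%R.
Definition fsin phi xi : R := (\int[leb]_y (phi y * wave sin xi y))%R.

Lemma Rintegral_rV_shift (a : 'rV[R]_d) (f : 'rV[R]_d -> R) : measurable_fun setT f ->
  (\int[leb]_x (f (x + a)) = \int[leb]_x (f x))%R.
Proof.
move=> mf; rewrite /Rintegral (integral_rV_shift _ a (EFin \o f))//.
exact/measurable_EFinP.
Qed.

Lemma wave_cosB xi x y :
  wave cos xi (x - y) = wave cos xi x * wave cos xi y + wave sin xi x * wave sin xi y.
Proof.
rewrite /wave dotvDl mulrDr cosD (_ : dotv (- y) xi = - dotv y xi); last first.
  by rewrite -scaleN1r dotvZl mulN1r.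
by rewrite mulrN cosN sinN mulrN opprK.
Qed.

Lemma wave_sinB xi x y :
  wave sin xi (x - y) = wave sin xi x * wave cos xi y - wave cos xi x * wave sin xi y.
Proof.
rewrite /wave dotvDl mulrDr sinD (_ : dotv (- y) xi = - dotv y xi); last first.
  by rewrite -scaleN1r dotvZl mulN1r.
by rewrite mulrN cosN sinN mulrN.
Qed.

Lemma fcos_shift phi a xi : leb.-integrable setT (fun x => (phi x)%:E) ->
  (\int[leb]_y (phi (y + a) * wave cos xi y))%R =
  wave cos xi a * fcos phi xi + wave sin xi a * fsin phi xi.
Proof.
move=> intf; have mf : measurable_fun setT phi by apply/measurable_EFinP; exact: measurable_int intf.
have ic := integrable_mul_cos _ xi intf; have is_ := integrable_mul_sin _ xi intf.
transitivity (\int[leb]_y (phi y * wave cos xi (y - a)))%R.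
  rewrite -[RHS](Rintegral_rV_shift a); last first.
    apply: measurable_funM => //.
    apply: (measurableT_comp (measurable_wave cos xi (@continuous_cos R))).
    exact: measurable_rV_shift.
  by apply: eq_Rintegral => y _; rewrite addrK.
under eq_Rintegral do rewrite wave_cosB mulrDr !mulrA [_ * _ * wave cos xi a]mulrC
  [_ * _ * wave sin xi a]mulrC.
rewrite RintegralD//; [|exact: (integrableZl _ (wave cos xi a) ic)|exact: (integrableZl _ (wave sin xi a) is_)].
by rewrite !RintegralZl.
Qed.

Lemma fsin_shift phi a xi : leb.-integrable setT (fun x => (phi x)%:E) ->
  (\int[leb]_y (phi (y + a) * wave sin xi y))%R =
  wave cos xi a * fsin phi xi - wave sin xi a * fcos phi xi.
Proof.
move=> intf; have mf : measurable_fun setT phi by apply/measurable_EFinP; exact: measurable_int intf.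
have ic := integrable_mul_cos _ xi intf; have is_ := integrable_mul_sin _ xi intf.
transitivity (\int[leb]_y (phi y * wave sin xi (y - a)))%R.
  rewrite -[RHS](Rintegral_rV_shift a); last first.
    apply: measurable_funM => //.
    apply: (measurableT_comp (measurable_wave sin xi (@continuous_sin R))).
    exact: measurable_rV_shift.
  by apply: eq_Rintegral => y _; rewrite addrK.
under eq_Rintegral do rewrite wave_sinB mulrBr !mulrA [_ * _ * wave cos xi a]mulrC
  [_ * _ * wave sin xi a]mulrC.
rewrite RintegralB//; [|exact: (integrableZl _ (wave cos xi a) is_)|exact: (integrableZl _ (wave sin xi a) ic)].
by rewrite !RintegralZl.
Qed.

(** By dominated convergence: the mean value theorem turns each difference quotient into a
    derivative at a nearby point, which [weight_shift] controls. *)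
Let derivative_coef phi j (g : 'rV[R]_d -> R) : schwartz phi ->
  measurable_fun setT g -> (forall y, `|g y| <= 1) ->
  (\int[leb]_y ((phi (y + axis k.+1%:R^-1 j) - phi y) / k.+1%:R^-1 * g y))%R
  @[k --> \oo] -->
  (\int[leb]_y ('D_(delta_mx ord0 j) phi y * g y))%R.
Proof.
move=> sphi mg g1; pose s k : R := k.+1%:R^-1.
have s0 k : 0 < s k by rewrite invr_gt0.
have s1 k : s k <= 1 by rewrite invf_le1 ?ler1n.
have sd := schwartz_deriv phi j sphi.
have [C [C0 hC]] := schwartz_bound _ sd.
have mphi := schwartz_measurable _ sphi.
have mf k : measurable_fun setT (fun y => (phi (y + axis (s k) j) - phi y) / s k * g y).
  apply: measurable_funM => //; apply: measurable_funM => //; apply: measurable_funB => //.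
  by apply: (measurableT_comp mphi); exact: measurable_rV_shift.
have f_cvg y : (phi (y + axis (s k) j) - phi y) / s k * g y @[k --> \oo] -->
    'D_(delta_mx ord0 j) phi y * g y.
  apply: cvgMl; have h := axis_derive phi y j 0 sphi.
  have := is_derive_harmonic_cvg _ _ h.
  by rewrite /axis scale0r addr0.
have fle k y : `|(phi (y + axis (s k) j) - phi y) / s k * g y| <= 3 * C * weight y.
  have [t /andP[t0 ts] ->] := schwartz_MVT phi y j (s k) sphi (s0 k).
  rewrite mulfK ?lt0r_neq0// normrM.
  apply: (@le_trans _ _ (C * weight (y + axis t j) * 1)).
    by apply: ler_pM => //; exact: hC.
  rewrite mulr1 (mulrC 3) -mulrA ler_wpM2l// weight_shift// t0/=.
  exact: le_trans ts (s1 k).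
have cv := dct_real leb _ _ _ mf f_cvg (integrable_weight (3 * C)) fle.
apply: fine_cvg; rewrite fineK//.
have iD := integrable_mul_le1 _ _ (schwartz_integrable _ sd) mg g1.
exact: (integrable_fin_num measurableT iD).
Qed.

Let quotient_coef phi a (g : 'rV[R]_d -> R) (s : R) : schwartz phi ->
  measurable_fun setT g -> (forall y, `|g y| <= 1) ->
  (\int[leb]_y ((phi (y + a) - phi y) / s * g y))%R =
  ((\int[leb]_y (phi (y + a) * g y))%R - (\int[leb]_y (phi y * g y))%R) / s.
Proof.
move=> sphi mg g1.
have ip := schwartz_integrable _ sphi.
have i1 := integrable_mul_le1 _ _ ip mg g1.
have i2 := integrable_mul_le1 _ _ (integrable_rV_shift _ a _ ip) mg g1.
under eq_Rintegral do rewrite mulrAC mulrBl mulrC.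
rewrite RintegralZl//; last exact: (integrableB measurableT i2 i1).
by rewrite RintegralB// mulrC.
Qed.

Let wave_cvg (a u v : R) : let s k : R := k.+1%:R^-1 in
  (cos (a * s k) * u + sin (a * s k) * v - u) / s k @[k --> \oo] --> a * v.
Proof.
move=> s.
have dcos : is_derive (0 : R) (1 : R) (fun t : R => cos (a * t)) 0.
  by apply: is_derive_eq; rewrite mulr0 sin0 /GRing.scale/= oppr0 mul0r.
have dsin : is_derive (0 : R) (1 : R) (fun t : R => sin (a * t)) a.
  apply: is_derive_eq.
  by rewrite mulr0 cos0 /GRing.scale/= !(mulr1, mulr0, mul1r, addr0, add0r).
have hc : (cos (a * s k) - cos (a * 0)) / s k * u @[k --> \oo] --> 0 * u.
  by apply: cvgMl; exact: is_derive_harmonic_cvg.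
have hs : (sin (a * s k) - sin (a * 0)) / s k * v @[k --> \oo] --> a * v.
  by apply: cvgMl; exact: is_derive_harmonic_cvg.
have h := cvgD hc hs; rewrite mul0r add0r in h.
have E : (fun k => (cos (a * s k) * u + sin (a * s k) * v - u) / s k) =
  (fun k => (cos (a * s k) - cos (a * 0)) / s k * u + (sin (a * s k) - sin (a * 0)) / s k * v).
  by apply/funext => k; rewrite mulr0 cos0 sin0; ring.
by rewrite E; exact: h.
Qed.

Let axis_wave (f : R -> R) xi j k :
  wave f xi (axis k.+1%:R^-1 j) = f (2 * pi * xi ord0 j * k.+1%:R^-1).
Proof. by rewrite /wave dotv_axis; congr f; ring. Qed.

(** In place of an integration by parts, the transform of a difference quotient is computed from
    translation invariance and the limit is taken. *)
Lemma fcos_deriv phi j xi : schwartz phi ->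
  fcos ('D_(delta_mx ord0 j) phi) xi = 2 * pi * xi ord0 j * fsin phi xi.
Proof.
move=> sphi; have ip := schwartz_integrable _ sphi.
have mw := measurable_wave cos xi (@continuous_cos R).
have mw1 y : `|wave cos xi y| <= 1 by exact: normr_cos_le1.
have h := derivative_coef phi j _ sphi mw mw1.
have h' := wave_cvg (2 * pi * xi ord0 j) (fcos phi xi) (fsin phi xi).
rewrite [LHS]/fcos -(cvg_lim (@Rhausdorff R) h); apply: (cvg_lim (@Rhausdorff R)).
rewrite (_ : (fun k => _) = fun k : nat => (cos (2 * pi * xi ord0 j * k.+1%:R^-1) * fcos phi xi +
  sin (2 * pi * xi ord0 j * k.+1%:R^-1) * fsin phi xi - fcos phi xi) / k.+1%:R^-1); first exact: h'.
by apply/funext => k; rewrite quotient_coef// fcos_shift// !axis_wave.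
Qed.

Lemma fsin_deriv phi j xi : schwartz phi ->
  fsin ('D_(delta_mx ord0 j) phi) xi = - (2 * pi * xi ord0 j * fcos phi xi).
Proof.
move=> sphi; have ip := schwartz_integrable _ sphi.
have mw := measurable_wave sin xi (@continuous_sin R).
have mw1 y : `|wave sin xi y| <= 1 by exact: normr_sin_le1.
have h := derivative_coef phi j _ sphi mw mw1.
have h' := wave_cvg (2 * pi * xi ord0 j) (fsin phi xi) (- fcos phi xi).
rewrite [LHS]/fsin -(cvg_lim (@Rhausdorff R) h); apply: (cvg_lim (@Rhausdorff R)).
rewrite -mulrN.
rewrite (_ : (fun k => _) = fun k : nat => (cos (2 * pi * xi ord0 j * k.+1%:R^-1) * fsin phi xi +
  sin (2 * pi * xi ord0 j * k.+1%:R^-1) * - fcos phi xi - fsin phi xi) / k.+1%:R^-1); first exact: h'.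
by apply/funext => k; rewrite quotient_coef// fsin_shift// !axis_wave mulrN.
Qed.

Lemma fcoef_bounded phi : schwartz phi ->
  exists C, forall xi, `|fcos phi xi| <= C /\ `|fsin phi xi| <= C.
Proof.
move=> sphi; have ip := schwartz_integrable _ sphi.
exists (\int[leb]_x `|phi x|)%R => xi.
have bound (f : R -> R) : continuous f -> (forall t, `|f t| <= 1) ->
    `|(\int[leb]_y (phi y * wave f xi y))%R| <= (\int[leb]_x `|phi x|)%R.
  move=> cf f1.
  have iw := integrable_mul_le1 _ _ ip (measurable_wave f xi cf) (fun x => f1 _).
  apply: le_trans (le_normr_Rintegral measurableT iw) _.
  apply: le_Rintegral => //; [exact: integrable_norm iw|exact: integrable_norm ip|].
  by move=> x _; rewrite normrM ler_piMr// f1.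
split; apply: bound; [exact: continuous_cos|exact: normr_cos_le1|exact: continuous_sin|exact: normr_sin_le1].
Qed.

(** Each factor [1 + xi_j ^+ 2] is paid for by the function itself and its second derivative in the
    direction [j], since [2 pi >= 1]. *)
Lemma fcoef_decay phi (s : seq 'I_d) : schwartz phi ->
  exists C, forall xi, `|fcos phi xi| * \prod_(j <- s) (1 + xi ord0 j ^+ 2) <= C /\
                       `|fsin phi xi| * \prod_(j <- s) (1 + xi ord0 j ^+ 2) <= C.
Proof.
elim: s phi => [|j s IH] phi sphi.
  have [C hC] := fcoef_bounded _ sphi; exists C => xi.
  by rewrite big_nil !mulr1; exact: hC.
have s1 := schwartz_deriv phi j sphi; have s2 := schwartz_deriv _ j s1.
have [C1 h1] := IH _ sphi; have [C2 h2] := IH _ s2.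
exists (C1 + C2) => xi; have [c1 c1'] := h1 xi; have [c2 c2'] := h2 xi.
rewrite big_cons; set P := \prod_(j <- s) _ in c1 c1' c2 c2' *.
have P0 : 0 <= P by apply: prodr_ge0 => k _; rewrite addr_ge0 ?sqr_ge0.
pose a := 2 * pi * xi ord0 j.
have a2 : xi ord0 j ^+ 2 <= a ^+ 2.
  rewrite /a exprMn ler_peMl ?sqr_ge0//.
  by have := pi_ge2 R; move: (pi : R) => q q1; nra.
have E u : `|2 * pi * xi ord0 j * - (2 * pi * xi ord0 j * u)| = a ^+ 2 * `|u|.
  rewrite -[a ^+ 2]ger0_norm ?sqr_ge0// -normrM -normrN; congr (`|_|); rewrite /a; ring.
have E' u : `|- (2 * pi * xi ord0 j * (2 * pi * xi ord0 j * u))| = a ^+ 2 * `|u|.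
  rewrite -[a ^+ 2]ger0_norm ?sqr_ge0// -normrM -normrN; congr (`|_|); rewrite /a; ring.
rewrite fcos_deriv// fsin_deriv// E in c2; rewrite fsin_deriv// fcos_deriv// E' in c2'.
have key u : 0 <= u -> u * P <= C1 -> a ^+ 2 * u * P <= C2 ->
    u * ((1 + xi ord0 j ^+ 2) * P) <= C1 + C2.
  move=> u0 k1; rewrite -mulrA => k2.
  have : xi ord0 j ^+ 2 * (u * P) <= a ^+ 2 * (u * P) by rewrite ler_wpM2r// mulr_ge0.
  by rewrite mulrDl mul1r mulrDr (mulrCA u); lra.
by split; apply: key.
Qed.

Lemma fcoef_weight phi : schwartz phi -> exists C,
  forall xi, `|fcos phi xi| <= C * weight xi /\ `|fsin phi xi| <= C * weight xi.
Proof.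
move=> sphi; have [C hC] := fcoef_decay _ (index_enum 'I_d) sphi.
exists C => xi; have [h1 h2] := hC xi.
have w0 : 0 < \prod_(j < d) (1 + xi ord0 j ^+ 2).
  by apply: prodr_gt0 => j _; rewrite ltr_pwDl ?sqr_ge0.
by rewrite /weight prodfV !ler_pdivlMr.
Qed.

Lemma measurable_Rintegral_param (f : 'rV[R]_d * 'rV[R]_d -> R) :
  measurable_fun setT f ->
  measurable_fun setT (fun x => (\int[leb]_y (f (x, y)))%R).
Proof.
move=> mf.
have mf' : measurable_fun setT (EFin \o f) by exact/measurable_EFinP.
have mF : measurable_fun setT (fun x => \int[leb]_y (f (x, y))%:E)%E.
  have -> : (fun x => \int[leb]_y (f (x, y))%:E)%E =
    (fun x => (fubini_F leb ((EFin \o f)^\+) x - fubini_F leb ((EFin \o f)^\-) x))%E.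
    apply/funext => x; rewrite integralE /fubini_F; congr (_ - _)%E.
      apply: eq_integral => y _.
      exact: (congr1 (@^~ y) (funepos_comp (EFin \o f) (pair x))).
    apply: eq_integral => y _.
    exact: (congr1 (@^~ y) (funeneg_comp (EFin \o f) (pair x))).
  apply: emeasurable_funB.
    by apply: measurable_fun_fubini_tonelli_F => //; exact: measurable_funepos.
  by apply: measurable_fun_fubini_tonelli_F => //; exact: measurable_funeneg.
exact: (measurableT_comp (fine_measurable measurableT) mF).
Qed.

Lemma measurable_fcos phi : measurable_fun setT phi -> measurable_fun setT (fcos phi).
Proof.
move=> mphi.
apply: (measurable_Rintegral_param (fun z => phi z.2 * cos (2 * pi * dotv z.2 z.1))).
apply: measurable_funM; first exact: measurableT_comp.
apply: (measurableT_comp (continuous_measurable_fun (@continuous_cos R))).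
apply: measurable_funM => //.
under eq_fun do rewrite dotvC.
exact: measurable_dotv.
Qed.

Lemma measurable_fsin phi : measurable_fun setT phi -> measurable_fun setT (fsin phi).
Proof.
move=> mphi.
apply: (measurable_Rintegral_param (fun z => phi z.2 * sin (2 * pi * dotv z.2 z.1))).
apply: measurable_funM; first exact: measurableT_comp.
apply: (measurableT_comp (continuous_measurable_fun (@continuous_sin R))).
apply: measurable_funM => //.
under eq_fun do rewrite dotvC.
exact: measurable_dotv.
Qed.

End fourier_coefficients.

(** * Exponential damping on R^d and its transform *)

Section damping.
Context {R : realType}.
Local Notation leb1 := (@lebesgue_measure R).

Definition damping n (s : R) (xi : 'rV[R]_n) : R := \prod_j expR (- (s * `|xi ord0 j|)).
Definition cauchy_kernels n (s : R) (u : 'rV[R]_n) : R := \prod_j cauchy_kernel s (u ord0 j).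

Lemma measurable_damping n s : measurable_fun setT (@damping n s).
Proof.
apply: (measurable_rV_prod _ (fun _ t => expR (- (s * `|t|)))) => j.
exact: measurable_expR_abs.
Qed.

Lemma damping_ge0 n s xi : 0 <= @damping n s xi.
Proof. by apply: prodr_ge0 => j _; exact: expR_ge0. Qed.

Lemma integral_damping n s : 0 < s ->
  (\int[lebesgue_rV R n]_xi (damping n s xi)%:E)%E = (\prod_(j < n) (2 / s))%:E.
Proof.
move=> s0; apply: (ge0_integral_rV_prod _ (fun _ t => expR (- (s * `|t|))) (fun=> 2 / s)).
- by move=> j; exact: measurable_expR_abs.
- by move=> j t; exact: expR_ge0.
- by move=> j; exact: integral_expR_abs.
Qed.

Lemma integrable_damping n s : 0 < s ->
  (lebesgue_rV R n).-integrable setT (fun xi => (damping n s xi)%:E).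
Proof.
move=> s0; apply/integrableP; split.
  by apply/measurable_EFinP; exact: measurable_damping.
under eq_integral do rewrite abse_EFin ger0_norm ?damping_ge0//.
by rewrite integral_damping// ltry.
Qed.

Lemma measurable_cos_affine n (u : 'rV[R]_n) (al : R) :
  measurable_fun setT (fun xi : 'rV[R]_n => cos (al + 2 * pi * dotv u xi)).
Proof.
apply: (measurableT_comp (continuous_measurable_fun (@continuous_cos R))).
apply: measurable_funD => //; apply: measurable_funM => //.
rewrite (_ : dotv u = fun x => dotv x u); first exact: measurable_dotvr.
by apply/funext => x; exact: dotvC.
Qed.

(** The phase [al] is there for the induction: with the first coordinate [t] fixed, the integral
    over the others is of the same form with phase [al + a t]. In the remaining integral over [t]
    the sine part vanishes by oddness. *)
Lemma integral_damping_cos n (u : 'rV[R]_n) (al s : R) : 0 < s ->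
  (\int[lebesgue_rV R n]_xi (damping n s xi * cos (al + 2 * pi * dotv u xi))%:E)%E =
  (cos al * cauchy_kernels n s u)%:E.
Proof.
move=> s0; elim: n => [|n IH] in u al *.
  by rewrite integral_rV0 /damping /cauchy_kernels /dotv !big_ord0 mulr0 addr0 mulr1 mul1r.
rewrite integral_rVS; last first.
  apply: integrable_mul_le1; [exact: integrable_damping|exact: measurable_cos_affine|].
  by move=> xi; exact: normr_cos_le1.
pose u' : 'rV[R]_n := \row_k u ord0 (lift ord0 k).
have dotE t (x : 'rV[R]_n) : dotv u (rV_cons (t, x)) = u ord0 ord0 * t + dotv u' x.
  rewrite /dotv big_ord_recl mxE unlift_none/=; congr (_ + _).
  by apply: eq_bigr => j _; rewrite !mxE liftK.
pose K := cauchy_kernels n s u'; pose a := 2 * pi * u ord0 ord0.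
pose e (t : R) := expR (- (s * `|t|)).
have inner t : (\int[lebesgue_rV R n]_x (damping n.+1 s (rV_cons (t, x)) *
    cos (al + 2 * pi * dotv u (rV_cons (t, x))))%:E =
    (cos al * K)%:E * (e t * cos (a * t))%:E - (sin al * K)%:E * (e t * sin (a * t))%:E)%E.
  under eq_integral => x _.
    rewrite /damping (prod_rV_cons _ (fun _ t => expR (- (s * `|t|)))) dotE -mulrA.
    rewrite (_ : al + _ = (al + a * t) + 2 * pi * dotv u' x); last by rewrite /a; ring.
    rewrite -/(damping n s x) EFinM.
    over.
  rewrite integralZl//; last first.
    apply: integrable_mul_le1; [exact: integrable_damping|exact: measurable_cos_affine|].
    by move=> xi; exact: normr_cos_le1.
  rewrite IH -/K cosD -/(e t) -!EFinM -EFinB; congr EFin; ring.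
have mC : measurable_fun setT (fun t : R => cos (a * t)).
  apply: (measurableT_comp (continuous_measurable_fun (@continuous_cos R))).
  exact: measurable_funM.
have mS : measurable_fun setT (fun t : R => sin (a * t)).
  apply: (measurableT_comp (continuous_measurable_fun (@continuous_sin R))).
  exact: measurable_funM.
have mE := measurable_expR_abs s.
have iC : leb1.-integrable setT (fun t => (e t * cos (a * t))%:E).
  apply: (le_integrable _ _ _ (integrable_expR_abs s s0)) => //.
    by apply/measurable_EFinP; exact: measurable_funM.
  by move=> x _; rewrite !abse_EFin lee_fin normrM ler_piMr// normr_cos_le1.
have iS : leb1.-integrable setT (fun t => (e t * sin (a * t))%:E).
  apply: (le_integrable _ _ _ (integrable_expR_abs s s0)) => //.
    by apply/measurable_EFinP; exact: measurable_funM.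
  by move=> x _; rewrite !abse_EFin lee_fin normrM ler_piMr// normr_sin_le1.
under eq_integral do rewrite inner.
rewrite integralB//; [|exact: integrableZl|exact: integrableZl].
rewrite !integralZl// integral_expR_abs_cosM// integral_expR_abs_sin// mule0 sube0.
rewrite -EFinM; congr EFin.
rewrite [in RHS]/cauchy_kernels big_ord_recl (_ : \prod_(i < n) _ = K); last first.
  by apply: eq_bigr => j _; rewrite mxE.
by rewrite /cauchy_kernel -/a; ring.
Qed.

Lemma cauchy_kernels_ge0 n s u : 0 < s -> 0 <= cauchy_kernels n s u.
Proof. by move=> s0; apply: prodr_ge0 => j _; exact: cauchy_kernel_ge0. Qed.

Lemma measurable_cauchy_kernel s : 0 < s -> measurable_fun setT (cauchy_kernel s : R -> R).
Proof. by move=> s0; apply: continuous_measurable_fun; exact: continuous_cauchy_kernel. Qed.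

Lemma measurable_cauchy_kernels n s : 0 < s -> measurable_fun setT (cauchy_kernels n s).
Proof.
move=> s0; apply: (measurable_rV_prod _ (fun=> cauchy_kernel s)) => j.
exact: measurable_cauchy_kernel.
Qed.

Lemma integral_cauchy_kernels n s : 0 < s ->
  (\int[lebesgue_rV R n]_u (cauchy_kernels n s u)%:E)%E = 1%:E.
Proof.
move=> s0; rewrite (ge0_integral_rV_prod _ (fun=> cauchy_kernel s) (fun=> 1)).
- by rewrite big1.
- by move=> j; exact: measurable_cauchy_kernel.
- by move=> j t; exact: cauchy_kernel_ge0.
- by move=> j; exact: integral_cauchy_kernel.
Qed.

Lemma integrable_cauchy_kernels n s : 0 < s ->
  (lebesgue_rV R n).-integrable setT (fun u => (cauchy_kernels n s u)%:E).
Proof.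
move=> s0; apply/integrableP; split.
  by apply/measurable_EFinP; exact: measurable_cauchy_kernels.
under eq_integral do rewrite abse_EFin ger0_norm ?cauchy_kernels_ge0//.
by rewrite integral_cauchy_kernels// ltry.
Qed.

Lemma cauchy_kernels_concentrates n (j : 'I_n) :
  (\int[lebesgue_rV R n]_u (Num.min 1 `|u ord0 j| * cauchy_kernels n k.+1%:R^-1 u)%:E)%E
  @[k --> \oo] --> 0%E.
Proof.
pose s k : R := k.+1%:R^-1.
have s0 k : 0 < s k by rewrite invr_gt0.
have m0 (t : R) : 0 <= Num.min 1 `|t| by rewrite le_min ler01 normr_ge0.
have mm : measurable_fun setT (fun t : R => Num.min 1 `|t|).
  by apply: measurable_minr => //; exact: measurable_normr.
rewrite (_ : (fun k => _) =
  fun k => (\int[leb1]_u (Num.min 1 `|u| * cauchy_kernel (s k) u)%:E)%E).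
  exact: cauchy_kernel_concentrates.
apply/funext => k.
have fin : (\int[leb1]_u (Num.min 1 `|u| * cauchy_kernel (s k) u)%:E)%E \is a fin_num.
  rewrite ge0_fin_numE; last by apply: integral_ge0 => t _; rewrite lee_fin mulr_ge0// cauchy_kernel_ge0.
  apply: (@le_lt_trans _ _ (\int[leb1]_u (cauchy_kernel (s k) u)%:E)%E); last first.
    by rewrite integral_cauchy_kernel// ltry.
  apply: ge0_le_integral => //.
  - by move=> t _; rewrite lee_fin mulr_ge0// cauchy_kernel_ge0.
  - by apply/measurable_EFinP/measurable_funM => //; exact: measurable_cauchy_kernel.
  - by apply/measurable_EFinP; exact: measurable_cauchy_kernel.
  - by move=> t _; rewrite lee_fin ler_piMl ?cauchy_kernel_ge0// ge_min lexx.
rewrite -[RHS]fineK//.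
pose g (i : 'I_n) (t : R) := if i == j then Num.min 1 `|t| * cauchy_kernel (s k) t
  else cauchy_kernel (s k) t.
rewrite (_ : fine _ = \prod_i (if i == j then
  fine (\int[leb1]_u (Num.min 1 `|u| * cauchy_kernel (s k) u)%:E)%E else 1)); last first.
  by rewrite (bigD1 j)//= eqxx big1 ?mulr1// => i /negbTE ->.
rewrite -(ge0_integral_rV_prod _ g).
- apply: eq_integral => u _; congr EFin.
  rewrite /cauchy_kernels (bigD1 j)//= [in RHS](bigD1 j)//= /g eqxx mulrA.
  by congr (_ * _); apply: eq_bigr => i /negbTE ->.
- move=> i; rewrite /g; case: eqP => _; last exact: measurable_cauchy_kernel.
  by apply: measurable_funM => //; exact: measurable_cauchy_kernel.
- move=> i t; rewrite /g; case: eqP => _; last exact: cauchy_kernel_ge0.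
  by apply: mulr_ge0 => //; exact: cauchy_kernel_ge0.
- move=> i; rewrite /g; case: eqP => _; last exact: integral_cauchy_kernel.
  by rewrite fineK.
Qed.

End damping.

(** * Fourier inversion *)

Section fourier_inversion.
Context {R : realType} {d : nat}.
Local Notation leb := (lebesgue_rV R d).
Implicit Types (phi : 'rV[R]_d -> R) (x y xi : 'rV[R]_d).

Lemma dotvBl x y xi : dotv (x - y) xi = dotv x xi - dotv y xi.
Proof. by rewrite dotvDl -scaleN1r dotvZl mulN1r. Qed.

(* [freal] and [fimag] are the real and imaginary parts of the Fourier transform
   of [phi] at [xi], multiplied by [exp (2 i pi x.xi)]. *)
Definition freal phi x xi : R := fcos phi xi * wave cos x xi + fsin phi xi * wave sin x xi.

Definition fimag phi x xi : R := fcos phi xi * wave sin x xi - fsin phi xi * wave cos x xi.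

Lemma freal_shift phi x h xi :
  freal phi (x + h) xi = freal phi x xi * wave cos h xi - fimag phi x xi * wave sin h xi.
Proof.
rewrite /freal /fimag !(waveC _ _ xi) /wave dotvDl mulrDr cosD sinD; ring.
Qed.

Lemma frealE phi x xi : schwartz phi ->
  freal phi x xi = (\int[leb]_y (phi y * cos (0 + 2 * pi * dotv (y - x) xi)))%R.
Proof.
move=> sphi; have ip := schwartz_integrable _ sphi.
have ic := integrable_mul_cos _ xi ip; have is_ := integrable_mul_sin _ xi ip.
under eq_Rintegral do rewrite add0r -[cos _]/(wave cos xi (_ - x)) wave_cosB mulrDr !mulrA.
rewrite RintegralD//; last 2 first.
- exact: (integrableZr _ (wave cos xi x) ic).
- exact: (integrableZr _ (wave sin xi x) is_).
by rewrite !RintegralZr// /freal !(waveC _ x xi).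
Qed.

(** Fubini's theorem: thanks to the damping the double integral converges absolutely, with bound the
    integral of the damping times that of [|phi|]. *)
Lemma freal_damped phi x (s : R) : schwartz phi -> 0 < s ->
  (\int[leb]_xi (damping d s xi * freal phi x xi)%:E)%E =
  (\int[leb]_u (phi (u + x) * cauchy_kernels d s u)%:E)%E.
Proof.
move=> sphi s0; have ip := schwartz_integrable _ sphi; have mphi := schwartz_measurable _ sphi.
pose F (z : 'rV[R]_d * 'rV[R]_d) : R :=
  damping d s z.1 * (phi z.2 * cos (0 + 2 * pi * dotv (z.2 - x) z.1)).
have mF : measurable_fun setT F.
  apply: measurable_funM.
    exact: (measurableT_comp (measurable_damping d s) measurable_fst).
  apply: measurable_funM; first exact: (measurableT_comp mphi measurable_snd).
  apply: (measurableT_comp (continuous_measurable_fun (@continuous_cos R))).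
  apply: measurable_funD => //; apply: measurable_funM => //.
  under eq_fun do rewrite dotvBl dotvC.
  apply: measurable_funB; first exact: measurable_dotv.
  under eq_fun do rewrite dotvC.
  exact: (measurableT_comp (measurable_dotvr x) measurable_fst).
have mcos xi : measurable_fun setT (fun y : 'rV[R]_d => cos (0 + 2 * pi * dotv (y - x) xi)).
  apply: (measurableT_comp (continuous_measurable_fun (@continuous_cos R))).
  apply: measurable_funD => //; apply: measurable_funM => //.
  by under eq_fun do rewrite dotvBl; apply: measurable_funB => //; exact: measurable_dotvr.
have iphi xi : leb.-integrable setT (fun y => (phi y * cos (0 + 2 * pi * dotv (y - x) xi))%:E).
  by apply: integrable_mul_le1 => // y; exact: normr_cos_le1.
have iF : (leb \x leb)%E.-integrable setT (EFin \o F).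
  apply/integrable12ltyP; first exact/measurable_EFinP.
  pose M := (\int[leb]_y `|(phi y)%:E|)%E.
  have M0 : (0 <= M)%E by apply: integral_ge0.
  have Moo : (M < +oo)%E by have /integrableP[] := ip.
  apply: (@le_lt_trans _ _ (\int[leb]_xi ((damping d s xi)%:E * M))%E).
    apply: ge0_le_integral => //.
    - by move=> xi _; apply: integral_ge0.
    - apply: (measurable_fun_fubini_tonelli_F (abse \o (EFin \o F))) => [|z]; last exact: abse_ge0.
      by apply: measurableT_comp => //; exact/measurable_EFinP.
    - apply: emeasurable_funM => //; apply/measurable_EFinP; exact: measurable_damping.
    move=> xi _; rewrite -ge0_integralZl//; last 2 first.
    - by apply: measurableT_comp => //; exact/measurable_EFinP.
    - by rewrite lee_fin damping_ge0.
    apply: ge0_le_integral => //.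
    - apply: measurableT_comp => //; apply/measurable_EFinP.
      by rewrite /F/=; apply: measurable_funM => //; apply: measurable_funM => //; exact: mcos.
    - apply: emeasurable_funM => //; apply: measurableT_comp => //.
      exact/measurable_EFinP.
    move=> y _; rewrite /F /= -EFinM lee_fin normrM ger0_norm ?damping_ge0//.
    by rewrite ler_wpM2l ?damping_ge0// normrM ler_piMr// normr_cos_le1.
  rewrite ge0_integralZr//; last 2 first.
  - by apply/measurable_EFinP; exact: measurable_damping.
  - by move=> xi _; rewrite lee_fin damping_ge0.
  by rewrite integral_damping// lte_mul_pinfty// lee_fin prodr_ge0// => j _; rewrite divr_ge0// ltW.
transitivity (\int[leb]_xi \int[leb]_y (F (xi, y))%:E)%E.
  apply: eq_integral => xi _; rewrite /F/=.
  under eq_integral do rewrite EFinM.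
  rewrite integralZl// EFinM frealE//; congr (_ * _)%E.
  by rewrite /Rintegral fineK// (integrable_fin_num measurableT (iphi xi)).
rewrite (Fubini iF).
rewrite -(integral_rV_shift _ x (fun y => \int[leb]_xi (F (xi, y))%:E)%E); last first.
  exact: measurable_fubini_G iF.
apply: eq_integral => u _; rewrite /F/= addrK.
under eq_integral do rewrite mulrCA EFinM.
rewrite integralZl//; last first.
  apply: integrable_mul_le1; [exact: integrable_damping|exact: measurable_cos_affine|].
  by move=> xi; exact: normr_cos_le1.
by rewrite integral_damping_cos// cos0 mul1r -EFinM.
Qed.

Lemma coord_ball x (u : 'rV[R]_d) (r : R) : (forall j, `|u ord0 j| < r) -> 0 < r -> ball x r (u + x).
Proof.
move=> ur r0; split => // a j; rewrite (ord1 a) /ball/= !mxE.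
by rewrite opprD addrCA subrr addr0 normrN.
Qed.

(** The kernels have mass 1, so it suffices to integrate [phi (u + x) - phi x]. Continuity bounds it
    for small [u], and elsewhere a multiple of the sum of the [Num.min 1 |u_j|] does, whose
    integrals against the kernels tend to 0. *)
Lemma cauchy_kernels_approx phi x : schwartz phi ->
  (\int[leb]_u (phi (u + x) * cauchy_kernels d k.+1%:R^-1 u)%:E)%E @[k --> \oo] -->
  (phi x)%:E.
Proof.
move=> sphi; have mphi := schwartz_measurable _ sphi.
pose s k : R := k.+1%:R^-1.
have s0 k : 0 < s k by rewrite invr_gt0.
have [M M1 hM] : exists2 M : R, 0 <= M & forall y, `|phi y| <= M.
  have [C [C0 hC]] := schwartz_bound _ sphi; exists C => // y.
  apply: le_trans (hC y) _; rewrite ler_piMr//.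
  apply: prodr_ile1 => j _; rewrite invr_ge0 addr_ge0 ?sqr_ge0//=.
  by rewrite invf_le1 ?ltr_pwDl ?sqr_ge0// lerDl sqr_ge0.
have mphix : measurable_fun setT (fun u : 'rV[R]_d => phi (u + x)).
  by apply: (measurableT_comp mphi); exact: measurable_rV_shift.
have mK k := measurable_cauchy_kernels d _ (s0 k).
have K0 k u := cauchy_kernels_ge0 d _ u (s0 k).
have iK k := integrable_cauchy_kernels d _ (s0 k).
have IK k := integral_cauchy_kernels d _ (s0 k).
have iKb k (g : 'rV[R]_d -> R) B : measurable_fun setT g -> (forall u, `|g u| <= B) ->
    leb.-integrable setT (fun u => (g u * cauchy_kernels d (s k) u)%:E).
  move=> mg gB; apply: (le_integrable _ _ _ (integrableZl measurableT B (iK k))) => //.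
    by apply/measurable_EFinP; exact: measurable_funM.
  move=> u _; rewrite -EFinM !abse_EFin lee_fin !normrM ler_wpM2r//.
  by rewrite (le_trans (gB u))// ler_norm.
pose m (j : 'I_d) (u : 'rV[R]_d) := Num.min 1 `|u ord0 j|.
have m0 j u : 0 <= m j u by rewrite le_min ler01 normr_ge0.
have mm j : measurable_fun setT (m j).
  apply: measurable_minr => //; apply: measurableT_comp => //; exact: measurable_coord.
pose I j k := (\int[leb]_u (m j u * cauchy_kernels d (s k) u)%:E)%E.
have I_cvg : (\sum_j I j k)%E @[k --> \oo] --> 0%E.
  elim: (index_enum _) => [|j t IH].
    by under eq_fun do rewrite big_nil; exact: cvg_cst.
  under eq_fun do rewrite big_cons.
  have h : ((0 : \bar R) +? 0)%E by [].
  have h2 := cvgeD h (cauchy_kernels_concentrates d j) IH; rewrite adde0 in h2.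
  exact: h2.
have m1 j u : `|m j u| <= 1 by rewrite ger0_norm// ge_min lexx.
have I_fin k : (\sum_j I j k)%E \is a fin_num.
  apply/sum_fin_numP => j _ _.
  exact: (integrable_fin_num measurableT (iKb k (m j) 1 (mm j) (m1 j))).
have key (eta : R) : 0 < eta -> exists C : R, 0 <= C /\ forall k,
    (`|\int[leb]_u (phi (u + x) * cauchy_kernels d (s k) u)%:E - (phi x)%:E| <=
     eta%:E + C%:E * \sum_j I j k)%E.
  move=> eta0.
  have cphi : {for x, continuous phi}.
    exact/differentiable_continuous/schwartz_differentiable.
  have [r [r0 r1 hr]] : exists r : R, [/\ 0 < r, r <= 1 &
      forall u : 'rV[R]_d, (forall j, `|u ord0 j| < r) -> `|phi (u + x) - phi x| <= eta].
    have /cvgrPdist_lt/(_ _ eta0)/nbhs_ballP[r /= r0 hr] := cphi.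
    exists (Num.min r 1); split; [by rewrite lt_min r0 ltr01|by rewrite ge_min lexx orbT|].
    move=> u ur; rewrite distrC ltW//; apply: hr; apply: coord_ball => // j.
    by apply: lt_le_trans (ur j) _; rewrite ge_min lexx.
  (* If some [|u_j| >= r], then [Num.min 1 |u_j| >= r] because [r <= 1], and the trivial bound
     [2 * M] is absorbed. *)
  exists (2 * M / r); split; first by rewrite divr_ge0 ?mulr_ge0// ltW.
  move=> k.
  pose g u := phi (u + x) - phi x.
  have gle u : `|g u| <= eta + 2 * M / r * \sum_j m j u.
    have [ur|/existsNP[j /negP]] := pselect (forall j, `|u ord0 j| < r).
      rewrite (le_trans (hr u ur))// lerDl mulr_ge0 ?sumr_ge0 ?divr_ge0 ?mulr_ge0//.
      exact: ltW.
    rewrite -leNgt => ru.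
    apply: (@le_trans _ _ (2 * M)).
      by rewrite (le_trans (ler_normB _ _))// mulr_natl mulr2n lerD.
    apply: (@le_trans _ _ (2 * M / r * r)); first by rewrite divfK ?lt0r_neq0.
    rewrite -[leLHS]add0r lerD ?(ltW eta0)// ler_wpM2l ?divr_ge0 ?mulr_ge0 ?(ltW r0)//.
    rewrite (bigD1 j)//=; apply: (@le_trans _ _ (m j u)); first by rewrite le_min r1.
    by rewrite lerDl sumr_ge0.
  have -> : (\int[leb]_u (phi (u + x) * cauchy_kernels d (s k) u)%:E - (phi x)%:E =
      \int[leb]_u (g u * cauchy_kernels d (s k) u)%:E)%E.
    rewrite -[(phi x)%:E]mule1 -(IK k) -integralZl// -integralB//; last 2 first.
    - exact: (iKb k _ M).
    - exact: integrableZl.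
    by apply: eq_integral => u _; rewrite /g mulrBl EFinB.
  apply: le_trans (le_abse_integral leb measurableT _) _.
    by apply/measurable_EFinP/measurable_funM => //; exact: measurable_funB.
  apply: (@le_trans _ _ (\int[leb]_u ((eta + 2 * M / r * \sum_j m j u) *
     cauchy_kernels d (s k) u)%:E)%E).
    apply: ge0_le_integral => //.
    - apply: measurableT_comp => //; apply/measurable_EFinP/measurable_funM => //.
      exact: measurable_funB.
    - apply/measurable_EFinP/measurable_funM => //; apply: measurable_funD => //.
      by apply: measurable_funM => //; exact: measurable_sum.
    by move=> u _; rewrite abse_EFin lee_fin normrM [X in _ * X]ger0_norm// ler_wpM2r.
  under eq_integral do rewrite mulrDl EFinD -mulrA mulr_suml (EFinM (2 * M / r)) -sumEFin.
  have C0 : 0 <= 2 * M / r by rewrite divr_ge0 ?mulr_ge0// ltW.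
  have mKm j : measurable_fun setT (fun u => (m j u * cauchy_kernels d (s k) u)%:E).
    by apply/measurable_EFinP; exact: measurable_funM.
  have mKm0 j u : (0 <= (m j u * cauchy_kernels d (s k) u)%:E)%E by rewrite lee_fin mulr_ge0.
  rewrite ge0_integralD//; last 4 first.
  - by move=> u _; rewrite lee_fin mulr_ge0// ltW.
  - by apply/measurable_EFinP; exact: measurable_funM.
  - by move=> u _; rewrite mule_ge0// ?sume_ge0.
  - by apply: emeasurable_funM => //; exact: emeasurable_sum.
  rewrite ge0_integralZl//; last 2 first.
  - by apply: emeasurable_sum.
  - by move=> u _; exact: sume_ge0.
  rewrite ge0_integral_sum//.
  under eq_integral do rewrite EFinM.
  rewrite ge0_integralZl//; last 3 first.
  - by apply/measurable_EFinP.
  - by move=> u _; rewrite lee_fin.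
  - by rewrite lee_fin ltW.
  by rewrite IK mule1.
have u_fin k : (\int[leb]_u (phi (u + x) * cauchy_kernels d (s k) u)%:E)%E \is a fin_num.
  exact: (integrable_fin_num measurableT (iKb k _ M mphix (fun u => hM _))).
apply: cvg_EFin; first by apply: nearW => k; exact: u_fin.
have J_cvg : fine (\sum_j I j k)%E @[k --> \oo] --> (0 : R).
  by apply: fine_cvg.
apply/cvgrPdist_le => eta eta0.
have e2 : 0 < eta / 2 by rewrite divr_gt0.
have [C [C0 hC]] := key _ e2.
have CJ : C * fine (\sum_j I j k)%E @[k --> \oo] --> (0 : R).
  by rewrite -(mulr0 C); apply: cvgMr.
near=> k.
have h := hC k; rewrite -(fineK (u_fin k)) -(fineK (I_fin k)) -EFinB abse_EFin -EFinM -EFinD lee_fin in h.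
rewrite distrC (le_trans h)// [leRHS](_ : _ = eta / 2 + eta / 2); last by field.
rewrite lerD2l (le_trans (ler_norm _))// ltW//.
by near: k; move/cvgr0Pnorm_lt : CJ; exact.
Unshelve. all: by end_near. Qed.

Let damping_cvg xi : damping d k.+1%:R^-1 xi @[k --> \oo] --> (1 : R).
Proof.
rewrite /damping; elim: (index_enum _) => [|j t IH].
  by under eq_fun do rewrite big_nil; exact: cvg_cst.
under eq_fun do rewrite big_cons.
have h : expR (- (k.+1%:R^-1 * `|xi ord0 j|)) @[k --> \oo] --> expR (- (0 * `|xi ord0 j|)).
  apply: (cvg_comp (fun k => - (k.+1%:R^-1 * `|xi ord0 j|)) expR); last exact: continuous_expR.
  by apply: cvgN; apply: cvgMl; exact: cvg_harmonic.
by have := cvgM h IH; rewrite mul0r oppr0 expR0 mulr1; exact.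
Qed.

(* The inversion integral is damped by [exp (- s |xi_j|)], whose transform is a
   product of Cauchy kernels, and [s] tends to [0]. *)
Lemma schwartz_inversion phi x : schwartz phi ->
  (\int[leb]_xi (freal phi x xi)%:E)%E = (phi x)%:E.
Proof.
move=> sphi; pose s k : R := k.+1%:R^-1.
have s0 k : 0 < s k by rewrite invr_gt0.
have mphi := schwartz_measurable _ sphi.
have [C hC] := fcoef_weight _ sphi.
have mF : measurable_fun setT (freal phi x).
  apply: measurable_funD; apply: measurable_funM.
  - exact: measurable_fcos.
  - exact: measurable_wave (@continuous_cos R).
  - exact: measurable_fsin.
  - exact: measurable_wave (@continuous_sin R).
have Fle xi : `|freal phi x xi| <= 2 * C * weight xi.
  have [h1 h2] := hC xi; rewrite (le_trans (ler_normD _ _))// !normrM.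
  rewrite -mulrA mulr_natl mulr2n lerD//.
    by apply: le_trans h1; rewrite ler_piMr// normr_cos_le1.
  by apply: le_trans h2; rewrite ler_piMr// normr_sin_le1.
have lim1 : (\int[leb]_xi (damping d (s k) xi * freal phi x xi)%:E)%E @[k --> \oo] -->
    (\int[leb]_xi (freal phi x xi)%:E)%E.
  apply: (dct_real leb (fun k xi => damping d (s k) xi * freal phi x xi) _ _ _ _
    (integrable_weight (2 * C))).
  - by move=> k; apply: measurable_funM => //; exact: measurable_damping.
  - move=> xi; rewrite -[freal phi x xi in X in _ --> X]mul1r; apply: cvgMl.
    exact: damping_cvg.
  - move=> k xi; rewrite normrM (le_trans _ (Fle xi))// ler_piMl//.
    rewrite ger0_norm ?damping_ge0//; apply: prodr_ile1 => j _.
    by rewrite expR_ge0 -expR0 ler_expR oppr_le0 mulr_ge0// ltW.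
have lim2 := cauchy_kernels_approx _ x sphi.
rewrite -(cvg_lim _ lim1)// -(cvg_lim _ lim2)//; congr (limn _).
by apply/funext => k; rewrite freal_damped.
Qed.

End fourier_inversion.

(** * Fourier multipliers given by random vectors *)

Section multipliers.
Context {R : realType} {d : nat}.
Local Notation leb := (lebesgue_rV R d).
Implicit Types (phi : 'rV[R]_d -> R) (x y z xi : 'rV[R]_d) (X : seq bool -> 'rV[R]_d).

(* For [m] odd, the Fourier multiplier with symbol [- 'i m]. *)
Definition multiplier (m : 'rV[R]_d -> R) phi x : R :=
  (\int[leb]_xi (m xi * fimag phi x xi))%R.

(** The values are in a general [V] since the operator is needed both on scalar functions and on
    vector-valued tensors. *)
Definition averaged_dker {V : lmodType R} (A : pred nat) N X (f : 'rV[R]_d -> V) z : V :=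
  (2 ^+ N)^-1 *: \sum_(w <- words N) \sum_(w' <- words N)
    dker A w w' *: f (z + (X w' - X w)).

Lemma fimag_bound phi : schwartz phi -> exists C : R, 0 <= C /\
  forall x xi, `|fimag phi x xi| <= C * weight xi /\ `|freal phi x xi| <= C * weight xi.
Proof.
move=> sphi; have [C hC] := fcoef_weight _ sphi.
exists (2 * C); split.
  have [h _] := hC 0; have w0 := @weight_gt0 R d 0.
  have : 0 <= C * weight (0 : 'rV[R]_d) := le_trans (normr_ge0 _) h.
  by rewrite pmulr_lge0// => C0; rewrite mulr_ge0.
move=> x xi; have [h1 h2] := hC xi; rewrite -mulrA mulr_natl mulr2n.
have b u w t : `|u| <= w -> `|t| <= 1 -> `|u * t| <= w :> R.
  by move=> uw t1; rewrite normrM (le_trans _ uw)// ler_piMr.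
split.
  rewrite (le_trans (ler_normB _ _))// lerD//; apply: b => //.
    exact: normr_sin_le1.
  exact: normr_cos_le1.
rewrite (le_trans (ler_normD _ _))// lerD//; apply: b => //.
  exact: normr_cos_le1.
exact: normr_sin_le1.
Qed.

Lemma measurable_fimag phi x : schwartz phi -> measurable_fun setT (fimag phi x).
Proof.
move=> sphi; have mphi := schwartz_measurable _ sphi.
apply: measurable_funB; apply: measurable_funM.
- exact: measurable_fcos.
- exact: measurable_wave (@continuous_sin R).
- exact: measurable_fsin.
- exact: measurable_wave (@continuous_cos R).
Qed.

Lemma measurable_freal phi x : schwartz phi -> measurable_fun setT (freal phi x).
Proof.
move=> sphi; have mphi := schwartz_measurable _ sphi.
apply: measurable_funD; apply: measurable_funM.
- exact: measurable_fcos.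
- exact: measurable_wave (@continuous_cos R).
- exact: measurable_fsin.
- exact: measurable_wave (@continuous_sin R).
Qed.

Lemma integrable_fimag phi x : schwartz phi ->
  leb.-integrable setT (fun xi => (fimag phi x xi)%:E).
Proof.
move=> sphi; have [C [_ hC]] := fimag_bound _ sphi.
apply: (le_integrable _ _ _ (integrable_weight C)) => //.
  by apply/measurable_EFinP; exact: measurable_fimag.
by move=> xi _; rewrite !abse_EFin lee_fin (le_trans (hC x xi).1)// ler_norm.
Qed.

Lemma integrable_freal phi x : schwartz phi ->
  leb.-integrable setT (fun xi => (freal phi x xi)%:E).
Proof.
move=> sphi; have [C [_ hC]] := fimag_bound _ sphi.
apply: (le_integrable _ _ _ (integrable_weight C)) => //.
  by apply/measurable_EFinP; exact: measurable_freal.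
by move=> xi _; rewrite !abse_EFin lee_fin (le_trans (hC x xi).2)// ler_norm.
Qed.

(** The inversion formula is inserted at each point [z + (X w' - X w)]. By the addition formulas the
    sums over words become forms [dform]: those of cosine with cosine and sine with sine vanish by
    antisymmetry, and the two mixed ones add up to [m]. *)
Lemma averaged_dker_multiplier A N X v m phi z :
  realizes A N X v m -> schwartz phi ->
  averaged_dker A N X phi z = - multiplier m phi z.
Proof.
move=> rX sphi.
pose h w w' := X w' - X w.
pose F w w' xi := dker A w w' * freal phi (z + h w w') xi.
have iF w w' : leb.-integrable setT (fun xi => (F w w' xi)%:E).
  exact: (integrableZl measurableT (dker A w w') (integrable_freal _ (z + h w w') sphi)).
have E w w' : ((dker A w w' * phi (z + h w w'))%:E = \int[leb]_xi (F w w' xi)%:E)%E.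
  rewrite EFinM -(schwartz_inversion _ _ sphi) -integralZl//.
  exact: integrable_freal.
have iFs w : leb.-integrable setT (fun xi => \sum_(w' <- words N) (F w w' xi)%:E)%E.
  exact: integrable_sum.
have S : ((\sum_(w <- words N) \sum_(w' <- words N) dker A w w' * phi (z + h w w'))%:E =
    \int[leb]_xi (\sum_(w <- words N) \sum_(w' <- words N) F w w' xi)%:E)%E.
  under [RHS]eq_integral => xi _.
    rewrite -sumEFin; under eq_bigr do rewrite -sumEFin.
    over.
  rewrite integral_sum//; under [RHS]eq_bigr do rewrite integral_sum//.
  rewrite -sumEFin; apply: eq_bigr => w _; rewrite -sumEFin.
  by apply: eq_bigr => w' _; exact: E.
have -> : averaged_dker A N X phi z = (2 ^+ N)^-1 *
    (\int[leb]_xi (\sum_(w <- words N) \sum_(w' <- words N) F w w' xi))%R.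
  by rewrite /Rintegral -S.
have iS : leb.-integrable setT
    (fun xi => (\sum_(w <- words N) \sum_(w' <- words N) F w w' xi)%:E).
  rewrite (_ : (fun xi => _) =
    fun xi => (\sum_(w <- words N) \sum_(w' <- words N) (F w w' xi)%:E)%E).
    exact: integrable_sum.
  by apply/funext => xi; rewrite -sumEFin; apply: eq_bigr => w _; rewrite sumEFin.
have EF xi : (2 ^+ N)^-1 * (\sum_(w <- words N) \sum_(w' <- words N) F w w' xi) =
    - (m xi * fimag phi z xi).
  have [_ _ <-] := rX xi.
  have c w w' : wave cos (h w w') xi = coscos X xi w * coscos X xi w' + sinsin X xi w * sinsin X xi w'.
    by rewrite waveC /h wave_cosB /coscos /sinsin /phase /wave; ring.
  have s w w' : wave sin (h w w') xi = coscos X xi w * sinsin X xi w' - sinsin X xi w * coscos X xi w'.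
    by rewrite waveC /h wave_sinB /coscos /sinsin /phase /wave; ring.
  transitivity (freal phi z xi * (dform A N (coscos X xi) (coscos X xi) +
      dform A N (sinsin X xi) (sinsin X xi)) - fimag phi z xi *
     (dform A N (coscos X xi) (sinsin X xi) - dform A N (sinsin X xi) (coscos X xi))).
    rewrite /dform -!mulrDl -mulrBl ![_ * (_ / 2 ^+ N)]mulrA -mulrBl [LHS]mulrC.
    congr (_ / _); rewrite -!big_split/= -sumrB !mulr_sumr -sumrB.
    apply: eq_bigr => w _; rewrite -!big_split/= -sumrB !mulr_sumr -sumrB.
    by apply: eq_bigr => w' _; rewrite /F freal_shift c s; ring.
  by rewrite !dformff (dformC A N (coscos X xi)); ring.
have EF' xi : m xi * fimag phi z xi =
    - (2 ^+ N)^-1 * (\sum_(w <- words N) \sum_(w' <- words N) F w w' xi).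
  by rewrite mulNr EF opprK.
rewrite /multiplier; under [in RHS]eq_Rintegral do rewrite EF'.
by rewrite RintegralZl// mulNr opprK.
Qed.

Lemma riesz_scalarE (i : 'I_d) phi x : schwartz phi ->
  riesz_scalar i phi x = multiplier (fun xi => xi ord0 i / norm2 xi) phi x.
Proof.
move=> sphi; rewrite /riesz_scalar /inv_fourier /cintegral /= /multiplier.
apply: eq_Rintegral => xi _; rewrite /fourier /cintegral /=.
have -> : (\int[leb]_y (phi y * cos (- (2 * pi * dotv y xi)) -
    0 * sin (- (2 * pi * dotv y xi))))%R = fcos phi xi.
  by apply: eq_Rintegral => y _; rewrite mul0r subr0 cosN.
have -> : (\int[leb]_y (phi y * sin (- (2 * pi * dotv y xi)) +
    0 * cos (- (2 * pi * dotv y xi))))%R = - fsin phi xi.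
  rewrite -mulN1r -RintegralZl//; last first.
    exact: (integrable_mul_sin _ xi (schwartz_integrable _ sphi)).
  by apply: eq_Rintegral => y _; rewrite mul0r addr0 sinN mulN1r mulrN.
by rewrite /fimag -!(waveC _ xi x) /wave; ring.
Qed.

Lemma multiplier_cvg (m_ : nat -> 'rV[R]_d -> R) (m : 'rV[R]_d -> R) phi x :
  schwartz phi -> (forall n, measurable_fun setT (m_ n)) ->
  (forall n xi, `|m_ n xi| <= 1) -> (forall xi, m_ n xi @[n --> \oo] --> m xi) ->
  multiplier (m_ n) phi x @[n --> \oo] --> multiplier m phi x.
Proof.
move=> sphi mm m1 m_m; have [C [C0 hC]] := fimag_bound _ sphi.
have mfi := measurable_fimag _ x sphi.
have m1' xi : `|m xi| <= 1.
  have h : `|m_ n xi| @[n --> \oo] --> `|m xi| by apply: cvg_norm; exact: m_m.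
  by apply: (cvgr_to_le h); exact: nearW.
have mml : measurable_fun setT m.
  by apply: (measurable_fun_cvg mm) => xi _; exact: m_m.
have im : leb.-integrable setT (fun xi => (m xi * fimag phi x xi)%:E).
  by under eq_fun do rewrite mulrC; apply: integrable_mul_le1 => //; exact: integrable_fimag.
apply: fine_cvg; rewrite fineK; last exact: (integrable_fin_num measurableT im).
apply: (dct_real leb (fun n xi => m_ n xi * fimag phi x xi) _ _ _ _ (integrable_weight C)).
- by move=> n; exact: measurable_funM.
- by move=> xi; apply: cvgMl; exact: m_m.
- move=> n xi; rewrite normrM (le_trans _ (hC x xi).1)// ler_piMl//.
Qed.

End multipliers.

(** * Dyadic Riesz transforms of functions of finitely many digits *)

Section finite_partition.
Context {R : realType} {disp : measure_display} {T : measurableType disp}.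
Variable mu : {measure set T -> \bar R}.
Hypothesis mufin : (mu setT < +oo)%E.
Context {Z : choiceType} (zs : seq Z) (r : T -> Z).
Hypothesis zsU : uniq zs.
Hypothesis rzs : forall x, r x \in zs.
Hypothesis mr : forall z, measurable (r @^-1` [set z]).

Let w z : R := fine (mu (r @^-1` [set z])).

Let mu_fin A : measurable A -> mu A \is a fin_num.
Proof.
by move=> mA; rewrite ge0_fin_numE// (le_lt_trans _ mufin)// le_measure ?inE.
Qed.

Lemma partition_measure (P : set Z) :
  mu (r @^-1` P) = (\sum_(z <- zs | z \in P) w z)%:E.
Proof.
have -> : r @^-1` P = \bigcup_(z in [set` [seq z <- zs | z \in P]]) (r @^-1` [set z]).
  apply/seteqP; split => x /=.
    by move=> Px; exists (r x) => //=; rewrite mem_filter rzs andbT inE.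
  by move=> [z /=]; rewrite mem_filter => /andP[/set_mem zP _] ->; exact: zP.
rewrite measure_fin_bigcup//; last by move=> z1 z2 _ _ [x [/= <- <-]].
rewrite -fsbig_seq ?filter_uniq// big_filter -sumEFin.
by apply: eq_bigr => z _; rewrite /w fineK// mu_fin.
Qed.

Lemma integral_partition (psi : Z -> R) : (forall z, 0 <= psi z) ->
  (\int[mu]_x (psi (r x))%:E)%E = (\sum_(z <- zs) w z * psi z)%:E.
Proof.
move=> psi0.
transitivity (\int[mu]_x \sum_(z <- zs) ((psi z)%:E * (\1_(r @^-1` [set z]) x)%:E))%E.
  apply: eq_integral => x _; rewrite (big_rem _ (rzs x))/= indicE mem_set// mule1 big1_seq ?adde0//.
  move=> z /andP[_]; rewrite mem_rem_uniq// inE => /andP[zr _].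
  by rewrite indicE memNset ?mule0//= => /esym/eqP; rewrite (negbTE zr).
rewrite ge0_integral_sum//; last 2 first.
- by move=> z; apply/measurable_EFinP/measurable_funM => //; exact: measurable_indic.
- by move=> z x _; rewrite mule_ge0 ?lee_fin.
rewrite -sumEFin; apply: eq_bigr => z _.
rewrite ge0_integralZl//.
- by rewrite integral_indic// setIT /w muleC EFinM fineK// mu_fin.
- by apply/measurable_EFinP; exact: measurable_indic.
- by rewrite lee_fin.
Qed.

Lemma integral_simple_partition (X : normedModType R) (phi : Z -> X) :
  integral_simple mu (phi \o r) = \sum_(z <- zs) w z *: phi z.
Proof.
pose vs := undup [seq phi z | z <- zs].
have sub : range (phi \o r) `<=` [set` vs].
  by move=> _ [x _ <-] /=; rewrite mem_undup; apply: map_f.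
rewrite /integral_simple.
transitivity (\sum_(v <- vs) fine (mu ((phi \o r) @^-1` [set v])) *: v).
  rewrite [RHS]fsbig_seq ?undup_uniq//.
  apply: (fsbig_widen _ _ _ sub) => v [/= vvs nv].
  rewrite (_ : _ @^-1` _ = set0) ?measure0 ?scale0r//.
  by apply/seteqP; split => x //= px; apply: nv; exists x.
have E v : fine (mu ((phi \o r) @^-1` [set v])) = \sum_(z <- zs | phi z == v) w z.
  rewrite comp_preimage partition_measure/=; apply: eq_bigl => z.
  by apply/idP/eqP; rewrite inE.
under eq_bigr do rewrite E scaler_suml big_mkcond/=.
rewrite exchange_big/=; apply: eq_big_seq => z zz.
have pz : phi z \in vs by rewrite mem_undup map_f.
rewrite (big_rem _ pz)/= eqxx big1_seq ?addr0//.
move=> v /andP[_]; rewrite mem_rem_uniq ?undup_uniq// inE => /andP[vz _].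
by rewrite eq_sym (negbTE vz).
Qed.

End finite_partition.

(** * Bochner integrals of simple functions *)

Section bochner_simple.
Context {R : realType} {disp : measure_display} {T : measurableType disp}.
Context {X : normedModType R}.
Variable mu : {measure set T -> \bar R}.
Hypothesis mufin : (mu setT < +oo)%E.

Let finite_range (h : T -> X) : finite_set (range h) ->
  exists2 vs, uniq vs & forall x, h x \in vs.
Proof.
move=> /finite_seqP[vs hvs]; exists (undup vs); first exact: undup_uniq.
move=> x; rewrite mem_undup.
suff : [set` vs] (h x) by [].
by rewrite -hvs; exists x.
Qed.

Lemma integral_simple_dist (h s : T -> X) :
  simple_fun measurable h -> simple_fun measurable s ->
  (`|integral_simple mu h - integral_simple mu s|%:E <= \int[mu]_x (`|h x - s x|)%:E)%E.
Proof.
move=> [/finite_range[us uU hu] mh] [/finite_range[vs vU sv] ms].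
pose zs := [seq (u, v) | u <- us, v <- vs].
pose r x := (h x, s x).
have zsU : uniq zs by rewrite allpairs_uniq// => -[? ?] [? ?].
have rzs x : r x \in zs by apply: allpairs_f; [exact: hu|exact: sv].
have mr z : measurable (r @^-1` [set z]).
  rewrite (_ : _ @^-1` _ = h @^-1` [set z.1] `&` s @^-1` [set z.2]); first exact: measurableI.
  by apply/seteqP; split => x /=; [move=> <-|case: z => a b /= [<- <-]].
rewrite (integral_simple_partition mu mufin zs r zsU rzs mr _ fst).
rewrite (integral_simple_partition mu mufin zs r zsU rzs mr _ snd).
rewrite (integral_partition mu mufin zs r zsU rzs mr (fun z => `|z.1 - z.2|))//.
rewrite lee_fin -sumrB (le_trans (ler_norm_sum _ _ _))//.
apply: ler_sum => z _; rewrite -scalerBr normrZ ger0_norm// fine_ge0//.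
Qed.

(** The definition allows any approximating sequence; [integral_simple_dist] forces its integrals to
    converge to that of [h]. *)
Lemma is_bochner_integral_simple (h : T -> X) v : simple_fun measurable h ->
  is_bochner_integral mu h v -> v = integral_simple mu h.
Proof.
move=> sh [_ [s [ss s_cvg s_v]]].
apply: (cvg_unique _ s_v); first exact: norm_hausdorff.
apply/cvgrPdist_lt => e e0.
have /fine_cvgP[fin_near /cvgr0Pnorm_lt/(_ _ e0) near_e] := s_cvg.
near=> n.
have fin : (\int[mu]_x (`|h x - s n x|)%:E)%E \is a fin_num by near: n; exact: fin_near.
have lt_e : `|fine (\int[mu]_x (`|h x - s n x|)%:E)%E| < e by near: n; exact: near_e.
have := integral_simple_dist h (s n) sh (ss n).
rewrite -(fineK fin) lee_fin => /le_lt_trans; apply.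
exact: le_lt_trans (ler_norm _) lt_e.
Unshelve. all: by end_near. Qed.

Lemma simple_fun_partition (Z : choiceType) (zs : seq Z) (r : T -> Z) (phi : Z -> X) :
  (forall x, r x \in zs) -> (forall z, measurable (r @^-1` [set z])) ->
  simple_fun measurable (phi \o r).
Proof.
move=> rzs mr; split.
  apply: (sub_finite_set (B := [set` [seq phi z | z <- zs]])); last exact: finite_seq.
  by move=> _ [x _ <-] /=; apply: map_f.
move=> v; rewrite (_ : _ @^-1` _ = \bigcup_(z in [set` [seq z <- zs | phi z == v]]) r @^-1` [set z]).
  by apply: fin_bigcup_measurable => //; exact: finite_seq.
apply/seteqP; split => x /=.
  by move=> <-; exists (r x) => //=; rewrite mem_filter rzs eqxx.
by move=> [z /=]; rewrite mem_filter => /andP[/eqP zv _] ->.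
Qed.

Lemma bochner_simple_partition (Z : choiceType) (zs : seq Z) (r : T -> Z) (phi : Z -> X) :
  uniq zs -> (forall x, r x \in zs) -> (forall z, measurable (r @^-1` [set z])) ->
  bochner mu (phi \o r) = \sum_(z <- zs) fine (mu (r @^-1` [set z])) *: phi z.
Proof.
move=> zsU rzs mr; have sphi := simple_fun_partition _ zs r phi rzs mr.
rewrite -(integral_simple_partition mu mufin zs r zsU rzs mr _ phi).
have B : is_bochner_integral mu (phi \o r) (integral_simple mu (phi \o r)).
  split.
    split; first by exists (fun=> phi \o r); split => // x; exact: cvg_cst.
    by rewrite (integral_partition mu mufin zs r zsU rzs mr (fun z => `|phi z|)) ?ltry.
  exists (fun=> phi \o r); split => //; last exact: cvg_cst.
  under eq_fun do under eq_integral do rewrite subrr normr0.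
  by under eq_fun do rewrite integral0; exact: cvg_cst.
apply: xget_subset1 => // v w hv hw.
by rewrite (is_bochner_integral_simple _ _ sphi hv) (is_bochner_integral_simple _ _ sphi hw).
Qed.

End bochner_simple.

(** * Binary digits and dyadic intervals *)

Section binary_digits.
Context {R : realType}.
Local Notation leb01 := (@lebesgue01 R).

Fixpoint word_val (u : seq bool) : nat :=
  if u is b :: v then (b * 2 ^ size v + word_val v)%N else 0%N.

Lemma word_val_rcons u b : word_val (rcons u b) = ((word_val u).*2 + b)%N.
Proof.
elim: u => [|c u IH] /=; first by rewrite expn0 muln1 addn0.
by rewrite size_rcons expnS IH -!muln2; ring.
Qed.

Lemma sum_word_val (V : nmodType) k (G : nat -> V) :
  \sum_(m < 2 ^ k) G m = \sum_(u <- words k) G (word_val u).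
Proof.
elim: k G => [|k IH] G; first by rewrite expn0 big_ord1 sum_words0.
have -> : \sum_(m < 2 ^ k.+1) G m = \sum_(m < 2 ^ k) G m + \sum_(m < 2 ^ k) G (2 ^ k + m)%N.
  by rewrite expnS mul2n -addnn big_split_ord.
rewrite sum_wordsS (IH G) (IH (fun m => G (2 ^ k + m)%N)); congr (_ + _).
rewrite [LHS]big_seq [RHS]big_seq.
by apply: eq_bigr => u /mem_words su; rewrite /= mul1n su.
Qed.

(** The itinerary of [x] under the doubling map; it is the binary expansion for [x] in [0, 1). *)
Fixpoint digits (k : nat) (x : R) : seq bool :=
  if k is k'.+1 then ((2^-1 : R) <= x)%R :: digits k' (2 * x - ((2^-1 : R) <= x)%R%:R) else [::].

Lemma size_digits k x : size (digits k x) = k.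
Proof. by elim: k x => //= k IH x; rewrite IH. Qed.

Lemma take_digits k n x : (k <= n)%N -> take k (digits n x) = digits k x.
Proof. by elim: k n x => [|k IH] [|n] x //= kn; rewrite IH. Qed.

Lemma mem_words_size w : w \in words (size w).
Proof.
elim: w => //= b v IH; rewrite mem_cat; case: b; apply/orP; [right|left];
  by apply/mapP; exists v.
Qed.

Lemma digits_words k x : digits k x \in words k.
Proof. by rewrite -{2}(size_digits k x) mem_words_size. Qed.

Lemma uniq_words k : uniq (words k).
Proof.
elim: k => //= k IH; rewrite cat_uniq !map_inj_uniq ?IH//; [|by move=> ? ? []..].
by rewrite andbT; apply/hasPn => _ /mapP[v _ ->]; apply/mapP => -[].
Qed.

Lemma dyadic_digits k u x : size u = k ->
  dyadic k (word_val u) x <-> 0 <= x < 1 /\ digits k x = u.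
Proof.
move=> <- {k}; elim: u x => [|b u IH] x /=.
  by rewrite /dyadic/= in_itv/= expr0 !divr1; split=> [|[]].
have half : dyadic (size u).+1 (b * 2 ^ size u + word_val u) x <->
    dyadic (size u) (word_val u) (2 * x - b%:R).
  rewrite /dyadic/= !in_itv/= exprS.
  have e0 : 0 < 2 ^+ size u :> R by exact: exprn_gt0.
  rewrite -addnS !natrD natrM natrX.
  rewrite !ler_pdivrMr ?mulr_gt0// !ltr_pdivlMr ?mulr_gt0//.
  move: (word_val u)%:R (word_val u).+1%:R (2 ^+ size u) e0 (b%:R : R) => p q e e0 c.
  by split=> /andP[h1 h2]; apply/andP; split; nra.
rewrite half IH; split.
  move=> [/andP[h1 h2] uE].
  have bE : (2^-1 <= x) = b.
    case: b h1 h2 {half IH uE}; rewrite ?mulr1n ?mulr0n => h1 h2; first by apply/idP; lra.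
    by apply/negbTE; rewrite -ltNge; lra.
  rewrite bE uE; split=> //.
  by case: b h1 h2 {half IH uE bE}; rewrite ?mulr1n ?mulr0n => h1 h2; apply/andP; split; lra.
move=> [/andP[x0 x1] [<- uE]]; split; last exact: uE.
by case: (leP 2^-1 x) => h; rewrite ?mulr1n ?mulr0n; apply/andP; split; lra.
Qed.

Lemma lebesgue_dyadic k u : size u = k ->
  lebesgue_measure (dyadic k (word_val u) : set R) = (2 ^- k)%:E.
Proof.
move=> su; rewrite /dyadic lebesgue_measure_itv/= lte_fin.
rewrite ltr_pM2r ?invr_gt0 ?exprn_gt0// ltr_nat leqnn -EFinB; congr EFin.
by rewrite -mulrBl -natrB// subSnn mul1r.
Qed.

(** [lebesgue01] lives on the whole line, so the partition needs a further cell [None], of measure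
    0, outside [0, 1). *)
Definition digit_cell N (x : measurableTypeR R) : option (seq bool) :=
  if 0 <= x < 1 then Some (digits N x) else None.

Let cells N := None :: map Some (words N).

Lemma uniq_cells N : uniq (cells N).
Proof.
rewrite /= map_inj_uniq ?uniq_words ?andbT; last by move=> ? ? [].
by apply/negP => /mapP[].
Qed.

Lemma digit_cell_cells N x : digit_cell N x \in cells N.
Proof.
rewrite /digit_cell /cells inE; case: ifP => // _.
by rewrite (map_f Some) ?digits_words.
Qed.

Lemma digit_cellS N u : size u = N -> digit_cell N @^-1` [set Some u] = dyadic N (word_val u).
Proof.
move=> su; apply/seteqP; split => x /=; rewrite /digit_cell.
  by case: ifP => // x01 [du]; apply/(dyadic_digits _ _ _ su).
by move=> /(dyadic_digits _ _ _ su)[-> ->].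
Qed.

Lemma digit_cellN N : digit_cell N @^-1` [set None] = ~` `[0, 1[%classic.
Proof.
apply/seteqP; split => x /=; rewrite /digit_cell in_itv/=; first by case: ifP.
by move=> /negP/negbTE ->.
Qed.

Lemma measurable_digit_cell N z : measurable (digit_cell N @^-1` [set z]).
Proof.
case: z => [u|]; last by rewrite digit_cellN; apply: measurableC; exact: measurable_itv.
have [su|su] := eqVneq (size u) N; first by rewrite digit_cellS//; exact: measurable_itv.
rewrite (_ : _ @^-1` _ = set0); first exact: measurable0.
apply/seteqP; split => x //=; rewrite /digit_cell; case: ifP => // _ [du].
by move: su; rewrite -du size_digits eqxx.
Qed.

Lemma lebesgue01E (A : set R) : leb01 A = lebesgue_measure (A `&` `[0, 1[%classic).
Proof. by []. Qed.

Lemma lebesgue01_cell N u : size u = N ->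
  fine (leb01 (digit_cell N @^-1` [set Some u])) = 2 ^- N.
Proof.
move=> su; rewrite digit_cellS// lebesgue01E.
rewrite (_ : _ `&` _ = dyadic N (word_val u)) ?lebesgue_dyadic//.
by apply/setIidl => x /(dyadic_digits _ _ _ su)[]; rewrite /= in_itv.
Qed.

Lemma lebesgue01_outside N : fine (leb01 (digit_cell N @^-1` [set None])) = 0.
Proof. by rewrite digit_cellN lebesgue01E setICl measure0. Qed.

Lemma lebesgue01_fin : (leb01 setT < +oo)%E.
Proof. by rewrite lebesgue01E setTI lebesgue_measure_itv/= lte_fin ltr01 -EFinB ltry. Qed.

Lemma sum_cells (V : lmodType R) N (G : option (seq bool) -> V) :
  \sum_(z <- cells N) fine (leb01 (digit_cell N @^-1` [set z])) *: G z =
  2 ^- N *: \sum_(w <- words N) G (Some w).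
Proof.
rewrite big_cons lebesgue01_outside scale0r add0r big_map scaler_sumr.
rewrite [LHS]big_seq [RHS]big_seq; apply: eq_bigr => w /mem_words sw.
by rewrite lebesgue01_cell.
Qed.

Lemma integral_digit_cell N (psi : option (seq bool) -> R) : (forall z, 0 <= psi z) ->
  (\int[leb01]_x (psi (digit_cell N x))%:E)%E = (mean N (psi \o Some))%:E.
Proof.
move=> psi0; rewrite (integral_partition _ lebesgue01_fin (cells N) _ (uniq_cells N)
  (digit_cell_cells N) (measurable_digit_cell N))//.
by have := @sum_cells R^o N psi; rewrite /GRing.scale/= /mean mulrC => <-.
Qed.

Lemma bochner_digit_cell (X : normedModType R) N (F : option (seq bool) -> X) :
  bochner leb01 (F \o digit_cell N) = 2 ^- N *: \sum_(w <- words N) F (Some w).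
Proof.
rewrite (bochner_simple_partition _ lebesgue01_fin _ (cells N) _ _ (uniq_cells N)
  (digit_cell_cells N) (measurable_digit_cell N)).
exact: sum_cells.
Qed.

End binary_digits.

(** * The Haar expansion of the kernel *)

Section kernel_decomposition.
Context {R : realType}.
Implicit Types (A : pred nat) (u v w : seq bool).

(** The contribution to [dker] of the parents of generation [g]: words that first differ at the
    digit number [g], counted from 0. *)
Fixpoint tau (g : nat) (w w' : seq bool) : R :=
  match g, w, w' with
  | 0, b :: v, b' :: v' => (b != b')%:R * (-1) ^+ b * (lead v * lead v') / 2 ^+ size v
  | k.+1, b :: v, b' :: v' => (b == b')%:R * tau k v v'
  | _, _, _ => 0
  end.

Lemma dker_tau A n w w' : (size w <= n)%N ->
  dker A w w' = \sum_(g < n | A g) tau g w w'.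
Proof.
elim: w w' n A => [|b v IH] w' n A sn.
  by rewrite big1// => -[[|g] ?] _ //; case: w'.
case: w' => [|b' v']; first by rewrite big1// => -[[|g] ?] _.
case: n sn => // n sn; rewrite dker_cons big_mkcond big_ord_recl/=.
rewrite (_ : (if A 0%N then _ else 0) =
    (A 0%N)%:R * ((b != b')%:R * (-1) ^+ b * (lead v * lead v') / 2 ^+ size v)); last
  by case: (A 0%N); rewrite ?mul1r ?mul0r.
have -> : \sum_(g < n) (if A (bump 0 g) then (b == b')%:R * tau g v v' else 0) =
   (b == b')%:R * dker (fun k => A k.+1) v v'.
  rewrite (IH v' n)// mulr_sumr [RHS]big_mkcond/=.
  by apply: eq_bigr => g _; rewrite /bump/= add1n.
by case: eqVneq => _ /=; rewrite ?mul0r ?mulr0 ?add0r ?mul1r ?addr0 ?mulrA.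
Qed.

Lemma tau_eq0 g w w' : (size w <= g.+1)%N -> tau g w w' = 0.
Proof.
elim: g w w' => [|g IH] [|b v] [|b' v']//=; last by move=> /IH ->; rewrite mulr0.
by case: v => //= _; rewrite mul0r mulr0 mul0r.
Qed.

(** The Haar function of the interval of [u], without its normalisation, on the cell of [w]. *)
Definition sgn_word u w : R :=
  (take (size u).+1 w == rcons u true)%:R - (take (size u).+1 w == rcons u false)%:R.

Lemma sgn_word_cons b0 u b w : sgn_word (b0 :: u) (b :: w) = (b == b0)%:R * sgn_word u w.
Proof.
by rewrite /sgn_word /= !eqseq_cons; case: (b == b0); rewrite ?mul1r// mul0r subrr.
Qed.

(** The factor is [2 ^+ g.+1], the square of the normalisation of the two Haar functions, times the
    length [2 ^- N] of a cell. The signs in [lead] are opposite to those of the Haar functions,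
    which does not matter in a product of two. *)
Lemma tau_sgn g N w w' : size w = N -> size w' = N -> (g.+1 < N)%N ->
  tau g w w' = 2 ^+ g.+1 / 2 ^+ N * \sum_(u <- words g)
    (- (sgn_word (rcons u true) w * sgn_word (rcons u false) w') +
     sgn_word (rcons u false) w * sgn_word (rcons u true) w').
Proof.
elim: g N w w' => [|g IH] [|N] [|b v] [|b' v']//= [sv] [sv'] gN.
  case: v sv => [|c t] sv; first by rewrite -sv in gN.
  case: v' sv' => [|c' t'] sv'; first by rewrite -sv' in gN.
  rewrite big_seq1 !sgn_word_cons sv expr1 exprS /sgn_word/= !take0 !eqseq_cons !eqxx !andbT.
  have e0 : (2 : R) ^+ N != 0 by rewrite expf_neq0.
  by case: b b' c c' {sv sv'} => -[] [] [] /=; rewrite ?expr0 ?expr1; field.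
rewrite (IH N)//; have e0 : (2 : R) ^+ N != 0 by rewrite expf_neq0.
have E b0 : \sum_(u <- words g)
    (- (sgn_word (rcons (b0 :: u) true) (b :: v) * sgn_word (rcons (b0 :: u) false) (b' :: v')) +
     sgn_word (rcons (b0 :: u) false) (b :: v) * sgn_word (rcons (b0 :: u) true) (b' :: v')) =
  ((b == b0) && (b' == b0))%:R * \sum_(u <- words g)
    (- (sgn_word (rcons u true) v * sgn_word (rcons u false) v') +
     sgn_word (rcons u false) v * sgn_word (rcons u true) v').
  rewrite mulr_sumr; apply: eq_bigr => u _; rewrite !rcons_cons !sgn_word_cons.
  by case: (b == b0) (b' == b0) => -[]; rewrite /= ?mul1r ?mul0r ?mulr0 ?oppr0 ?addr0.
rewrite sum_wordsS !E [2 ^+ g.+2]exprS [2 ^+ N.+1]exprS.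
case: b b' {E} => -[]; rewrite ?mul1r ?mul0r ?addr0 ?add0r ?mulr0//; field; rewrite ?e0//.
Qed.

End kernel_decomposition.

Section dyadic_operator.
Context {R : realType} {X : normedModType R}.
Local Notation leb01 := (@lebesgue01 R).
Implicit Types (F : seq bool -> X).

Definition word_step N F (x : measurableTypeR R) : X := oapp F 0 (digit_cell N x).

Lemma indic_dyadic N k u (x : R) : size u = k -> (k <= N)%N ->
  \1_(dyadic k (word_val u)) x = oapp (fun w => (take k w == u)%:R) 0 (digit_cell N x) :> R.
Proof.
move=> su kN; rewrite indicE /digit_cell; case: ifP => x01 /=.
  rewrite take_digits//; congr ((nat_of_bool _)%:R); apply/idP/eqP => [|du].
    by rewrite inE => /(dyadic_digits _ _ _ su)[].
  by rewrite inE; apply/(dyadic_digits _ _ _ su).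
by rewrite memNset// => /(dyadic_digits _ _ _ su)[]; rewrite x01.
Qed.

Lemma haar_word N u (x : R) : (size u < N)%N ->
  haar (size u) (word_val u) x =
  oapp (fun w => sgn_word u w / Num.sqrt (2 ^- size u)) 0 (digit_cell N x).
Proof.
move=> uN; rewrite /haar.
have -> : (word_val u).*2.+1 = word_val (rcons u true) by rewrite word_val_rcons addn1.
have -> : (word_val u).*2 = word_val (rcons u false) by rewrite word_val_rcons addn0.
rewrite !(indic_dyadic N) ?size_rcons// /sgn_word.
by case: (digit_cell N x) => //=; rewrite subrr mul0r.
Qed.

Lemma haar_coef_word N F u : (size u < N)%N ->
  haar_coef (word_step N F) (size u) (word_val u) =
  2 ^- N *: \sum_(w <- words N) (sgn_word u w / Num.sqrt (2 ^- size u)) *: F w.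
Proof.
move=> uN; rewrite /haar_coef.
rewrite -(bochner_digit_cell _ N (oapp (fun w => (sgn_word u w / Num.sqrt (2 ^- size u)) *: F w) 0)).
congr bochner; apply/funext => x; rewrite (haar_word N)//= /word_step.
by case: (digit_cell N x) => //=; rewrite scaler0.
Qed.

Lemma sum_words_rcons (V : nmodType) k (G : seq bool -> V) :
  \sum_(w <- words k.+1) G w = \sum_(v <- words k) (G (rcons v false) + G (rcons v true)).
Proof.
elim: k G => [|k IH] G; first by rewrite sum_wordsS !sum_words0.
by rewrite sum_wordsS (IH (fun w => G (false :: w))) (IH (fun w => G (true :: w))) [RHS]sum_wordsS.
Qed.

(** The step function is constant on the interval of [u], and the Haar function has mean zero
    there. *)
Lemma haar_coef_word0 N F u : (N <= size u)%N ->
  haar_coef (word_step N F) (size u) (word_val u) = 0.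
Proof.
move=> Nu.
(* The function is read as one of [(size u).+1] digits so that [haar_coef_word] applies. *)
have -> : word_step N F = word_step (size u).+1 (fun w => F (take N w)).
  apply/funext => x; rewrite /word_step /digit_cell; case: ifP => //= _.
  by congr F; rewrite -(take_digits N (size u).+1)// ltnW.
rewrite haar_coef_word// sum_words_rcons big_seq big1 ?scaler0// => v /mem_words sv.
have tk b : take (size u).+1 (rcons v b) = rcons v b by rewrite take_oversize// size_rcons sv.
have tN b : take N (rcons v b) = take N v by rewrite -cats1 takel_cat// sv.
rewrite !tN -scalerDl /sgn_word !tk !eqseq_rcons/= !andbT !andbF.
by rewrite -mulrDl subr0 sub0r addNr mul0r scale0r.
Qed.

Definition dker_apply (A : pred nat) N F w : X := \sum_(w' <- words N) dker A w w' *: F w'.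

Lemma dyadic_riesz_term_sum N F g (x : measurableTypeR R) :
  \sum_(m < 2 ^ g) dyadic_riesz_term (word_step N F) g m x =
  word_step N (fun w => \sum_(w' <- words N) tau g w w' *: F w') x.
Proof.
rewrite (sum_word_val _ _ (fun m => dyadic_riesz_term (word_step N F) g m x)).
have valT u : (word_val u).*2.+1 = word_val (rcons u true) by rewrite word_val_rcons addn1.
have valF u : (word_val u).*2 = word_val (rcons u false) by rewrite word_val_rcons addn0.
(* If the children have generation at least [N], both sides vanish. *)
have [gN|Ng] := ltnP g.+1 N; last first.
  rewrite big_seq big1 => [|u /mem_words su]; last first.
    rewrite /dyadic_riesz_term valT valF -su -(size_rcons u true) haar_coef_word0; last first.
      by rewrite size_rcons su.
    rewrite [size (rcons u true)]size_rcons -(size_rcons u false) haar_coef_word0; last first.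
      by rewrite size_rcons su.
    by rewrite !scaler0 oppr0 addr0.
  rewrite /word_step /digit_cell; case: ifP => //= _.
  by rewrite big1// => w' _; rewrite tau_eq0 ?scale0r ?size_digits.
rewrite [LHS]big_seq.
rewrite (eq_bigr (fun u =>
     - (oapp (fun w => sgn_word (rcons u true) w / Num.sqrt (2 ^- g.+1)) 0 (digit_cell N x) *:
     (2 ^- N *: \sum_(w <- words N) (sgn_word (rcons u false) w / Num.sqrt (2 ^- g.+1)) *: F w))
   + oapp (fun w => sgn_word (rcons u false) w / Num.sqrt (2 ^- g.+1)) 0 (digit_cell N x) *:
     (2 ^- N *: \sum_(w <- words N) (sgn_word (rcons u true) w / Num.sqrt (2 ^- g.+1)) *: F w))); last first.
  move=> u /mem_words su; rewrite /dyadic_riesz_term valT valF -su.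
  rewrite -[X in haar X (word_val (rcons u true))](size_rcons u true).
  rewrite -[X in haar X (word_val (rcons u false))](size_rcons u false).
  rewrite -[X in haar_coef _ X (word_val (rcons u true))](size_rcons u true).
  rewrite -[X in haar_coef _ X (word_val (rcons u false))](size_rcons u false).
  by rewrite !(haar_word N) ?haar_coef_word ?size_rcons ?su.
rewrite -big_seq /word_step /digit_cell; case: ifP => /= _; last first.
  by rewrite big1// => u _; rewrite !scale0r oppr0 addr0.
under eq_bigr do rewrite !scalerA !scaler_sumr -sumrN -big_split/=.
rewrite exchange_big/= [LHS]big_seq [RHS]big_seq; apply: eq_bigr => w' /mem_words sw'.
rewrite (tau_sgn g N) ?size_digits// mulr_sumr scaler_suml; apply: eq_bigr => u _.
rewrite !scalerA -scaleNr -scalerDl; congr (_ *: _).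
have q0 : 0 < 2 ^- g.+1 :> R by rewrite invr_gt0 exprn_gt0.
have : (2 : R) ^+ g.+1 = (Num.sqrt (2 ^- g.+1))^-1 ^+ 2.
  by rewrite exprVn sqr_sqrtr ?invrK// ltW.
by move: (Num.sqrt _)^-1 => s ->; ring.
Qed.

End dyadic_operator.

Section normLp_facts.
Context {R : realType} {X : normedModType R}.
Context {disp : measure_display} {T : measurableType disp}.
Variable mu : {measure set T -> \bar R}.
Implicit Types (p C : R) (f : T -> X).

Lemma normLp_ge0 p f : (0 <= normLp mu p f)%E.
Proof. exact: Lnorm_ge0. Qed.

Lemma normLpE p f : normLp mu p f = ((\int[mu]_x (`|f x| `^ p)%:E) `^ p^-1)%E.
Proof.
rewrite /normLp unlock; congr poweR; apply: eq_integral => x _.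
by rewrite abse_EFin normr_id poweR_EFin.
Qed.

Lemma normLp_le p f C : 0 < p -> 0 <= C ->
  (normLp mu p f <= C%:E)%E = (\int[mu]_x (`|f x| `^ p)%:E <= (C `^ p)%:E)%E.
Proof.
move=> p0 C0.
have I0 : (0 <= \int[mu]_x (`|f x| `^ p)%:E)%E.
  by apply: integral_ge0 => x _; rewrite lee_fin powR_ge0.
have pV : p^-1 * p = 1 by rewrite mulVf// gt_eqF.
have pV' : p * p^-1 = 1 by rewrite divff// gt_eqF.
rewrite normLpE; apply/idP/idP => h.
  have := @gt0_ler_poweR _ p (ltW p0) _ _ _ _ h.
  rewrite -poweRrM pV poweRe1// poweR_EFin; apply.
    by rewrite in_itv/= poweR_ge0 leey.
  by rewrite in_itv/= lee_fin C0 leey.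
have p0' : 0 <= p^-1 by rewrite invr_ge0 ltW.
have := @gt0_ler_poweR _ p^-1 p0' _ _ _ _ h.
rewrite poweR_EFin -powRrM pV' powRr1//; apply.
  by rewrite in_itv/= I0 leey.
by rewrite in_itv/= lee_fin powR_ge0 leey.
Qed.

End normLp_facts.

(** * The dyadic Riesz transform on functions of finitely many digits *)

Section dyadic_bound.
Context {R : realType} {X : normedModType R} {d : nat}.
Local Notation leb01 := (@lebesgue01 R).
Variables (i : 'I_d) (p : R).
Hypothesis p0 : 0 < p.
Implicit Types (F : seq bool -> X).

Let A (k : nat) := (k %% d == i)%N.

Lemma integral_word_step N F :
  (\int[leb01]_x (`|word_step N F x| `^ p)%:E)%E = (mean N (fun w => `|F w| `^ p))%:E.
Proof.
exact: (integral_digit_cell N (fun z => `|oapp F 0 z| `^ p) (fun z => powR_ge0 _ _)).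
Qed.

Lemma LpX_word_step N F : LpX leb01 p (word_step N F).
Proof.
split.
  exists (fun=> word_step N F); split => [_|x]; last exact: cvg_cst.
  exact: (simple_fun_partition _ _ (digit_cell N) (oapp F 0) (digit_cell_cells N)
    (measurable_digit_cell N)).
rewrite normLpE integral_word_step poweR_EFin; exact: ltry.
Qed.

(** Parents of generation [N] or more contribute nothing, so the partial sums are stationary and the
    convergence in the definition of the operator becomes trivial. *)
Lemma dyadic_riesz_partial_word n N F : (N <= n)%N ->
  dyadic_riesz_partial i n (word_step N F) = word_step N (dker_apply A N F).
Proof.
move=> Nn; apply/funext => x; rewrite /dyadic_riesz_partial.
under eq_bigr do rewrite dyadic_riesz_term_sum.
pose G g := word_step N (fun w => \sum_(w' <- words N) tau g w w' *: F w') x.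
have d0 : (0 < d)%N by case: (d) i => [[]|].
(* Each block of [d] consecutive generations contains exactly one congruent to [i]. *)
have -> : \sum_(k < n) G (k * d + i)%N = \sum_(g < n * d | A g) G g.
  elim: n {Nn} => [|n IH]; first by rewrite !big_ord0.
  rewrite big_ord_recr/= IH mulSnr big_split_ord/=.
  congr (_ + _).
  rewrite (bigD1 i)/=; last by rewrite /A modnMDl modn_small.
  rewrite big1 ?addr0// => j /andP[].
  by rewrite /A modnMDl modn_small// => /eqP ij; rewrite -(inj_eq val_inj)/= ij eqxx.
rewrite /G /word_step /digit_cell; case: ifP => _ /=; last by rewrite big1.
rewrite exchange_big/=; apply: eq_bigr => w' _; rewrite -scaler_suml.
congr (_ *: _); rewrite (dker_tau _ (n * d))// size_digits (leq_trans Nn)//.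
exact: leq_pmulr.
Qed.

Lemma dyadic_riesz_word N F :
  dyadic_riesz p i (word_step N F) (word_step N (dker_apply A N F)).
Proof.
split; [exact: LpX_word_step..|].
apply: cvg_near_cst; exists N => // n /= Nn; rewrite dyadic_riesz_partial_word//.
rewrite normLpE (_ : (fun x => _) = cst 0%E) ?integral0 ?poweR0r ?invr_eq0 ?gt_eqF//.
by apply/funext => x /=; rewrite subrr normr0 powR0// gt_eqF.
Qed.

Lemma dker_applyZ c N F : dker_apply A N (fun w => c *: F w) = fun w => c *: dker_apply A N F w.
Proof.
apply/funext => w; rewrite /dker_apply scaler_sumr; apply: eq_bigr => w' _.
by rewrite !scalerA mulrC.
Qed.

Lemma mean_powRZ c N F : 0 <= c ->
  mean N (fun w => `|c *: F w| `^ p) = c `^ p * mean N (fun w => `|F w| `^ p).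
Proof.
move=> c0; rewrite /mean mulrA mulr_sumr; congr (_ / _); apply: eq_bigr => w _.
by rewrite normrZ (ger0_norm c0) powRM.
Qed.

(** [opnorm] only tests functions of norm at most 1; homogeneity gives the inequality for every
    [F]. *)
Lemma dker_apply_bound C N F : 0 <= C ->
  (opnorm leb01 p (@dyadic_riesz R X d p i) <= C%:E)%E ->
  mean N (fun w => `|dker_apply A N F w| `^ p) <= C `^ p * mean N (fun w => `|F w| `^ p).
Proof.
move=> C0 hC; pose M := mean N (fun w => `|F w| `^ p).
have M0 : 0 <= M by rewrite divr_ge0 ?exprn_ge0// sumr_ge0// => w _; exact: powR_ge0.
(* A function of norm 0 cannot be normalised; it vanishes on all words of length [N], and so does
   its transform. *)
have [Meq|Mne] := eqVneq M 0.
  have F0 w : w \in words N -> F w = 0.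
    move=> ww; have : \sum_(w <- words N) `|F w| `^ p == 0.
      by move: Meq => /eqP; rewrite mulf_eq0 invr_eq0 expf_eq0/= pnatr_eq0 andbF orbF.
    rewrite psumr_eq0; last by move=> *; exact: powR_ge0.
    by move=> /allP/(_ _ ww)/=; rewrite powR_eq0 normr_eq0 => /andP[/eqP].
  rewrite -/M Meq mulr0 /mean big1 ?mul0r// => w _.
  rewrite /dker_apply big_seq big1 ?normr0 ?powR0 ?gt_eqF// => w' /F0 ->.
  by rewrite scaler0.
have {Mne}Mgt : 0 < M by rewrite lt0r Mne.
(* The normalising factor: [c] to the power [p] is the inverse of [M]. *)
pose c := M `^ (- p^-1).
have c0 : 0 < c by exact: powR_gt0.
have cp : c `^ p = M^-1 by rewrite -powRrM mulNr mulVf ?gt_eqF// powRN powRr1.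
have h : (normLp leb01 p (word_step N (dker_apply A N (fun w => c *: F w))) <= C%:E)%E.
  apply: le_trans hC; apply: ereal_sup_ubound.
  exists (word_step N (fun w => c *: F w)), (word_step N (dker_apply A N (fun w => c *: F w))).
  split => //; [exact: LpX_word_step| |exact: dyadic_riesz_word].
  rewrite normLp_le// integral_word_step (mean_powRZ _ _ _ (ltW c0)) lee_fin cp mulVf ?gt_eqF//.
  by rewrite powR1.
move: h; rewrite normLp_le// integral_word_step lee_fin dker_applyZ (mean_powRZ _ _ _ (ltW c0)).
by rewrite cp ler_pdivrMl// mulrC.
Qed.

End dyadic_bound.

(** * Transference to R^d *)

Section finite_tensors.
Context {R : realType} {X : normedModType R}.
Context {disp : measure_display} {T : measurableType disp}.
Implicit Types f g : T -> X.

(** A class, stable under sums, scalings and measurable changes of variable, in which norms are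
    measurable: the norm of [f] is a continuous function of finitely many measurable real
    coefficients. *)
Definition finite_tensor f : Prop :=
  exists (K : finType) (phi : K -> T -> R) (v : K -> X),
    (forall k, measurable_fun setT (phi k)) /\ f = fun x => \sum_k phi k x *: v k.

Lemma measurable_norm_tensor f : finite_tensor f -> measurable_fun setT (fun x => `|f x|).
Proof.
move=> [K [phi [v [mphi ->]]]].
pose N (a : 'rV[R]_#|K|) : R := `|\sum_k a ord0 (enum_rank k) *: v k|.
have cN : continuous N.
  have cS (r : seq K) : continuous (fun b : 'rV[R]_#|K| => \sum_(k <- r) b ord0 (enum_rank k) *: v k).
    elim: r => [|k r IH] a.
      by under [X in continuous_at _ X]eq_fun do rewrite big_nil; exact: cst_continuous.
    under [X in continuous_at _ X]eq_fun do rewrite big_cons.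
    apply: (@continuousD _ _ _ (fun b : 'rV[R]_#|K| => b ord0 (enum_rank k) *: v k)); last exact: IH.
    apply: (@continuousZl _ _ _ (fun b : 'rV[R]_#|K| => b ord0 (enum_rank k))); exact: coord_continuous.
  move=> a; apply: (@continuous_comp _ _ _ (fun b : 'rV[R]_#|K| =>
      \sum_k b ord0 (enum_rank k) *: v k) (fun y : X => `|y|)); first exact: cS.
  exact: norm_continuous.
rewrite (_ : (fun x => _) = N \o (fun x => \row_j phi (enum_val j) x)).
  have mN := continuous_measurable_rV _ N cN.
  apply: (measurableT_comp mN).
  by apply: measurable_fun_rV => j; under eq_fun do rewrite mxE; exact: mphi.
by apply/funext => x; congr `|_|; apply: eq_bigr => k _; rewrite mxE enum_rankK.
Qed.

Lemma finite_tensor0 : finite_tensor (fun=> 0).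
Proof.
exists 'I_0, (fun=> cst 0), (fun=> 0); split => [[]//|].
by apply/funext => x; rewrite big_ord0.
Qed.

Lemma finite_tensorD f g : finite_tensor f -> finite_tensor g ->
  finite_tensor (fun x => f x + g x).
Proof.
move=> [K [phi [v [mphi ->]]]] [L [psi [w [mpsi ->]]]].
exists (K + L)%type, (fun kl => match kl with inl k => phi k | inr l => psi l end),
  (fun kl => match kl with inl k => v k | inr l => w l end).
by split => [[]//|]; apply/funext => x; rewrite big_sumType.
Qed.

Lemma finite_tensorZ c f : finite_tensor f -> finite_tensor (fun x => c *: f x).
Proof.
move=> [K [phi [v [mphi ->]]]]; exists K, phi, (fun k => c *: v k); split => //.
apply/funext => x; rewrite scaler_sumr; apply: eq_bigr => k _.
by rewrite !scalerA mulrC.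
Qed.

Lemma finite_tensor_sum (I : Type) (s : seq I) (F : I -> T -> X) :
  (forall j, finite_tensor (F j)) -> finite_tensor (fun x => \sum_(j <- s) F j x).
Proof.
move=> tF; elim: s => [|j s IH].
  by under [X in finite_tensor X]eq_fun do rewrite big_nil; exact: finite_tensor0.
by under [X in finite_tensor X]eq_fun do rewrite big_cons; exact: finite_tensorD.
Qed.

Lemma finite_tensor_comp (h : T -> T) f : measurable_fun setT h ->
  finite_tensor f -> finite_tensor (f \o h).
Proof.
move=> mh [K [phi [v [mphi ->]]]]; exists K, (fun k => phi k \o h), v; split => //.
by move=> k; exact: measurableT_comp.
Qed.

Lemma simple_finite_tensor f : simple_fun measurable f -> finite_tensor f.
Proof.
move=> [/finite_seqP[vs hvs] mf].
pose us := undup vs; pose e (v : X) : T -> R := \1_(f @^-1` [set v]).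
exists 'I_(size us), (fun k : 'I_(size us) => e (nth 0 us k)), (fun k : 'I_(size us) => nth 0 us k).
split => [k|]; first exact: measurable_indic.
apply/funext => x; have fx : f x \in us.
  by rewrite mem_undup; suff : [set` vs] (f x) by []; rewrite -hvs; exists x.
have E v : e v x = (f x == v)%:R.
  by rewrite /e indicE; congr ((nat_of_bool _)%:R); apply/idP/eqP; rewrite inE.
rewrite -(big_mkord xpredT (fun k => e (nth 0 us k) x *: nth 0 us k)).
rewrite -(big_nth 0 xpredT (fun v => e v x *: v)).
rewrite (big_rem _ fx)/= E eqxx scale1r big1_seq ?addr0// => v /andP[_].
rewrite mem_rem_uniq ?undup_uniq// inE => /andP[vx _].
by rewrite E eq_sym (negbTE vx) scale0r.
Qed.

Lemma measurable_norm_tensorB f g : finite_tensor f -> strongly_measurable measurable g ->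
  measurable_fun setT (fun x => `|f x - g x|).
Proof.
move=> tf [s [ss s_g]].
apply: (measurable_fun_cvg (h := fun n x => `|f x - s n x|)) => [n|x _].
  apply: measurable_norm_tensor.
  under [X in finite_tensor X]eq_fun do rewrite -scaleN1r.
  by apply: finite_tensorD => //; apply: finite_tensorZ; exact: simple_finite_tensor.
by apply: cvg_norm; apply: cvgB; [exact: cvg_cst|exact: s_g].
Qed.

Lemma measurable_norm_strongly g : strongly_measurable measurable g ->
  measurable_fun setT (fun x => `|g x|).
Proof.
move=> mg; have := measurable_norm_tensorB _ _ finite_tensor0 mg.
by under eq_fun do rewrite sub0r normrN.
Qed.

End finite_tensors.

Section averaged_bound.
Context {R : realType} {X : normedModType R}.
Variable p : R.
Hypothesis p1 : 1 < p.

Let p0 : 0 < p. Proof. exact: lt_trans p1. Qed.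

(** Jensen's inequality, from midpoint convexity by induction on the number of digits. *)
Lemma mean_powR_norm N (Y : seq bool -> X) :
  `|2 ^- N *: \sum_(w <- words N) Y w| `^ p <= mean N (fun w => `|Y w| `^ p).
Proof.
elim: N Y => [|N IH] Y; first by rewrite /mean !sum_words0 expr0 invr1 scale1r mulr1.
rewrite meanS sum_wordsS.
set a := \sum_(w <- words N) Y (false :: w); set b := \sum_(w <- words N) Y (true :: w).
have -> : 2 ^- N.+1 *: (a + b) = 2^-1 *: (2 ^- N *: a) + 2^-1 *: (2 ^- N *: b).
  by rewrite scalerDr !scalerA exprS invfM.
apply: (le_trans (y := ((`|2 ^- N *: a| `^ p) + (`|2 ^- N *: b| `^ p)) / 2)); last first.
  by rewrite ler_pM2r ?invr_gt0// lerD// IH.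
move: (2 ^- N *: a) (2 ^- N *: b) => {}a {}b.
have h x : `|x : X| \in (`[0, +oo[%classic : set R) by rewrite inE /= in_itv/= normr_ge0.
have : (2^-1 * `|a| + (1 - 2^-1) * `|b|) `^ p <= 2^-1 * `|a| `^ p + (1 - 2^-1) * `|b| `^ p.
  have h0 : 0 <= 2^-1 :> R by rewrite invr_ge0.
  have h1 : 2^-1 <= 1 :> R by rewrite invf_le1// ler1n.
  exact: (convex_powR (ltW p1) (Itv01 h0 h1) (h a) (h b)).
rewrite (_ : 1 - 2^-1 = 2^-1 :> R); last by field.
rewrite -!mulrDr [X in _ <= X]mulrC; apply: le_trans.
apply: ge0_ler_powR; [exact: ltW|by rewrite nnegrE|by rewrite nnegrE mulr_ge0 ?addr_ge0|].
by rewrite (le_trans (ler_normD _ _))// !normrZ -mulrDr ger0_norm ?invr_ge0.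
Qed.

Lemma measurable_powR_norm (disp : measure_display) (T : measurableType disp) (f : T -> X) :
  measurable_fun setT (fun x => `|f x|) -> measurable_fun setT (fun x => (`|f x| `^ p)%:E).
Proof.
by move=> mf; apply/measurable_EFinP; apply: (measurableT_comp (measurable_powR p) mf).
Qed.

Lemma ge0_integral_mean (disp : measure_display) (T : measurableType disp)
    (mu : {measure set T -> \bar R}) N (h : seq bool -> T -> R) :
  (forall w, measurable_fun setT (fun x => (h w x)%:E)) -> (forall w x, 0 <= h w x) ->
  (\int[mu]_x (mean N (fun w => h w x))%:E =
   (2 ^- N)%:E * \sum_(w <- words N) \int[mu]_x (h w x)%:E)%E.
Proof.
move=> mh h0; rewrite -ge0_integral_sum//; last by move=> w x _; rewrite lee_fin.
rewrite -ge0_integralZl//.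
- by apply: eq_integral => x _; rewrite /mean sumEFin -EFinM mulrC.
- exact: emeasurable_sum.
- by move=> x _; apply: sume_ge0 => w _; rewrite lee_fin.
Qed.

Lemma sum_words_cst N (c : \bar R) : (0 <= c)%E ->
  (\sum_(w <- words N) c = (2 ^+ N)%:E * c)%E.
Proof.
move=> c0; elim: N => [|N IH]; first by rewrite sum_words0 expr0 mul1e.
rewrite sum_wordsS IH -ge0_muleDl ?lee_fin ?exprn_ge0// -EFinD exprS.
by rewrite mulr_natl mulr2n.
Qed.

Context {d : nat}.
Local Notation leb := (lebesgue_rV R d).
Variables (A : pred nat) (C : R).
Hypothesis hC : forall N (F : seq bool -> X),
  mean N (fun w => `|dker_apply A N F w| `^ p) <= C `^ p * mean N (fun w => `|F w| `^ p).

(** [hC] is applied, for each fixed [z], to the function of digits [f (z + Y w')]; integrating over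
    [z] transfers the bound. *)
Lemma averaged_dker_bound N (Y : seq bool -> 'rV[R]_d) (f : 'rV[R]_d -> X) :
  finite_tensor f ->
  (\int[leb]_z (`|averaged_dker A N Y f z| `^ p)%:E <=
   (C `^ p)%:E * \int[leb]_z (`|f z| `^ p)%:E)%E.
Proof.
move=> tf.
have tY (a : 'rV[R]_d) : finite_tensor (fun z : 'rV[R]_d => f (z + a)).
  exact: (finite_tensor_comp _ _ (measurable_rV_shift d a) tf).
pose G w (z : 'rV[R]_d) := dker_apply A N (fun w' => f (z + Y w')) w.
have tG w : finite_tensor (G w).
  by apply: finite_tensor_sum => w'; exact: finite_tensorZ.
have mG w a : measurable_fun setT (fun z : 'rV[R]_d => (`|G w (z + a)| `^ p)%:E).
  apply: measurable_powR_norm; apply: measurable_norm_tensor.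
  exact: (finite_tensor_comp _ _ (measurable_rV_shift d a) (tG w)).
have mf a : measurable_fun setT (fun z : 'rV[R]_d => (`|f (z + a)| `^ p)%:E).
  by apply: measurable_powR_norm; apply: measurable_norm_tensor.
have mf0 : measurable_fun setT (fun z : 'rV[R]_d => (`|f z| `^ p)%:E).
  by apply: measurable_powR_norm; apply: measurable_norm_tensor.
have mG0 w : measurable_fun setT (fun z : 'rV[R]_d => (`|G w z| `^ p)%:E).
  by apply: measurable_powR_norm; apply: measurable_norm_tensor.
have tavg : finite_tensor (averaged_dker A N Y f).
  apply: finite_tensorZ; apply: finite_tensor_sum => w; apply: finite_tensor_sum => w'.
  exact: finite_tensorZ.
have mmean (h : seq bool -> 'rV[R]_d -> R) : (forall w, measurable_fun setT (fun x => (h w x)%:E)) ->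
    measurable_fun setT (fun z => (mean N (fun w => h w z))%:E).
  move=> mh; apply/measurable_EFinP; apply: measurable_funM => //.
  by apply: measurable_sum => w; apply/measurable_EFinP; exact: mh.
apply: (@le_trans _ _ (\int[leb]_z (mean N (fun w => `|G w (z - Y w)| `^ p))%:E)%E).
  apply: ge0_le_integral => //.
  - by apply: measurable_powR_norm; apply: measurable_norm_tensor.
  - by apply: mmean => w; exact: mG.
  - move=> z _; rewrite lee_fin (le_trans (mean_powR_norm N _))// /mean ler_pM2r ?invr_gt0 ?exprn_gt0//.
    apply: ler_sum => w _; rewrite /G /dker_apply le_eqVlt; apply/orP; left; apply/eqP.
    by congr (`| _ | `^ p); apply: eq_bigr => w' _; rewrite (addrC (Y w')) addrA.
rewrite ge0_integral_mean; [|by move=> w; exact: mG|by move=> w z; exact: powR_ge0].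
(* The base point [z - Y w] depends on [w]. Translating under each integral makes it common to all
   words, so that the mean over [w] is one to which [hC] applies. *)
under eq_bigr do rewrite (ge0_integral_rV_shift _ _ (fun z => (`|G _ z| `^ p)%:E))//.
rewrite -ge0_integral_mean; [|exact: mG0|by move=> w z; exact: powR_ge0].
apply: (@le_trans _ _ ((C `^ p)%:E * \int[leb]_z (mean N (fun w => `|f (z + Y w)| `^ p))%:E)%E).
  rewrite -ge0_integralZl//; last 3 first.
  - by apply: mmean => w; exact: mf.
  - by move=> z _; rewrite lee_fin divr_ge0 ?exprn_ge0// sumr_ge0// => w _; exact: powR_ge0.
  - by rewrite lee_fin powR_ge0.
  apply: ge0_le_integral => //.
  - by move=> z _; rewrite lee_fin divr_ge0 ?exprn_ge0// sumr_ge0// => w _; exact: powR_ge0.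
  - exact: mmean.
  - by apply/measurable_EFinP; apply: measurable_funM => //; apply/measurable_EFinP; apply: mmean => w; exact: mf.
  - by move=> z _; rewrite -EFinM lee_fin; exact: hC.
rewrite ge0_integral_mean; [|by move=> w; exact: mf|by move=> w z; exact: powR_ge0].
under eq_bigr do rewrite (ge0_integral_rV_shift _ _ (fun z => (`|f z| `^ p)%:E))//.
rewrite sum_words_cst; last by apply: integral_ge0 => z _; rewrite lee_fin powR_ge0.
by rewrite !muleA -!EFinM -mulrA mulVf ?mulr1// expf_neq0.
Qed.

End averaged_bound.

Section limits.
Context {R : realType}.
Variable p : R.
Hypothesis p1 : 1 < p.

Let p0 : 0 < p. Proof. exact: lt_trans p1. Qed.

Lemma cvg_powR (u : nat -> R) (l : R) : (forall n, 0 <= u n) ->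
  u n @[n --> \oo] --> l -> u n `^ p @[n --> \oo] --> l `^ p.
Proof.
move=> u0 ul; have l0 : 0 <= l by apply: (cvgr_to_ge ul); exact: nearW.
(* For a positive limit the power is [exp (p ln)]; at 0, where the logarithm is not continuous, the
   estimate is direct. *)
have [l0'|ln0] := eqVneq l 0; last first.
  have lgt : 0 < l by rewrite lt0r ln0.
  have h := cvg_comp u (@ln R) ul (continuous_ln lgt).
  have h' : p * ln (u n) @[n --> \oo] --> p * ln l by apply: cvgMr; exact: h.
  rewrite [X in _ --> X]/powR (negbTE ln0).
  apply: (cvg_trans _ (cvg_comp _ _ h' (@continuous_expR R (p * ln l)))).
  apply: near_eq_cvg => /=.
  have /cvgr_gt/(_ 0 lgt) := ul; apply: filterS => n un.
  by rewrite /powR gt_eqF.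
rewrite l0' powR0 ?gt_eqF//; apply/cvgr0Pnorm_lt => e e0.
have e0' : 0 < e `^ p^-1 by rewrite powR_gt0.
rewrite l0' in ul; have /cvgr0Pnorm_lt/(_ _ e0') := ul.
apply: filterS => n; rewrite !ger0_norm ?powR_ge0// => un.
have := gt0_ltr_powR p0 (u0 n) (ltW e0') un.
by rewrite -powRrM mulVf ?gt_eqF// powRr1// ltW.
Qed.

Context {disp : measure_display} {T : measurableType disp}.
Variable mu : {measure set T -> \bar R}.

Lemma fatou_le (f_ : nat -> T -> R) (f : T -> R) (B : \bar R) :
  (forall n, measurable_fun setT (fun x => (f_ n x)%:E)) -> (forall n x, 0 <= f_ n x) ->
  (forall x, f_ n x @[n --> \oo] --> f x) ->
  (forall n, \int[mu]_x (f_ n x)%:E <= B)%E -> (\int[mu]_x (f x)%:E <= B)%E.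
Proof.
move=> mf f0 f_f fB.
have E x : ((f x)%:E = limn_einf (fun n => (f_ n x)%:E))%E.
  by apply/esym; apply: (cvg_limn_einf_sup _).1; apply: cvg_EFin; [exact: nearW|exact: f_f].
under eq_integral do rewrite E.
apply: (le_trans (fatou mu measurableT mf _)); first by move=> n x _; rewrite lee_fin.
rewrite limn_einf_lim; apply: lime_le; first exact: is_cvg_einfs.
apply: nearW => n; apply: le_trans (fB n).
by apply: ereal_inf_lbound; exists n => /=.
Qed.

End limits.

Section Lp_estimates.
Context {R : realType} {X : normedModType R}.
Context {disp : measure_display} {T : measurableType disp}.
Variables (mu : {measure set T -> \bar R}) (p : R).
Hypothesis p1 : 1 < p.

Let p0 : 0 < p. Proof. exact: lt_trans p1. Qed.

Lemma le_normLp (Y : normedModType R) (f : T -> X) (g : T -> Y) :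
  measurable_fun setT (fun x => `|f x|) -> measurable_fun setT (fun x => `|g x|) ->
  (forall x, `|f x| <= `|g x|) -> (normLp mu p f <= normLp mu p g)%E.
Proof.
move=> mf mg fg; rewrite !normLpE; apply: gt0_ler_poweR.
- by rewrite invr_ge0 ltW.
- by rewrite in_itv/= leey andbT; apply: integral_ge0 => x _; rewrite lee_fin powR_ge0.
- by rewrite in_itv/= leey andbT; apply: integral_ge0 => x _; rewrite lee_fin powR_ge0.
apply: ge0_le_integral => //.
- exact: measurable_powR_norm.
- exact: measurable_powR_norm.
- by move=> x _; rewrite lee_fin ge0_ler_powR ?nnegrE// ltW.
Qed.

Lemma normLp_triangle (f g h : T -> X) :
  measurable_fun setT (fun x => `|f x|) -> measurable_fun setT (fun x => `|g x|) ->
  measurable_fun setT (fun x => `|h x|) -> (forall x, `|f x| <= `|g x| + `|h x|) ->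
  (normLp mu p f <= normLp mu p g + normLp mu p h)%E.
Proof.
move=> mf mg mh fgh; apply: le_trans (minkowski_EFin mu mg mh (ltW p1)).
rewrite (_ : EFin \o _ = (fun x => `|(`|g x| + `|h x| : R^o)|%:E)); last first.
  by apply/funext => x; rewrite /= ger0_norm.
apply: (le_normLp R^o _ (fun x => `|g x| + `|h x| : R^o)) => //.
- under eq_fun do rewrite ger0_norm//; exact: measurable_funD.
- by move=> x; rewrite [leRHS]ger0_norm.
Qed.

Lemma le_normLp_scale (C : R) (f g : T -> X) : 0 <= C ->
  (\int[mu]_x (`|f x| `^ p)%:E <= (C `^ p)%:E * \int[mu]_x (`|g x| `^ p)%:E)%E ->
  (normLp mu p f <= C%:E * normLp mu p g)%E.
Proof.
move=> C0 fg; rewrite !normLpE.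
have I0 (h : T -> X) : (0 <= \int[mu]_x (`|h x| `^ p)%:E)%E.
  by apply: integral_ge0 => x _; rewrite lee_fin powR_ge0.
have -> : C = (C `^ p) `^ p^-1 by rewrite -powRrM divff ?gt_eqF// powRr1.
rewrite -poweR_EFin -poweRM ?lee_fin ?powR_ge0//.
apply: gt0_ler_poweR fg.
- by rewrite invr_ge0 ltW.
- by rewrite in_itv/= leey andbT.
- by rewrite in_itv/= leey andbT mule_ge0 ?lee_fin ?powR_ge0.
Qed.

End Lp_estimates.

(** * Symbols bounded on Schwartz tensors, and their limits *)

Section bounded_multipliers.
Context {R : realType} {X : normedModType R} {d : nat}.
Local Notation leb := (lebesgue_rV R d).
Variables (p C : R).
Hypothesis p1 : 1 < p.

(** What survives a pointwise limit of symbols. The bound 1 serves dominated convergence under the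
    inversion integral, the third clause makes the norms measurable, and the last one is stated with
    integrals of p-th powers, the form to which Fatou's lemma applies. *)
Definition bounded_multiplier (m : 'rV[R]_d -> R) : Prop :=
  [/\ measurable_fun setT m, forall xi, `|m xi| <= 1,
      forall phi, schwartz phi -> measurable_fun setT (multiplier m phi) &
      forall n (phi : 'I_n -> 'rV[R]_d -> R) (v : 'I_n -> X), (forall k, schwartz (phi k)) ->
      (\int[leb]_x (`|(\sum_k multiplier m (phi k) x *: v k)%R| `^ p)%:E <=
       (C `^ p)%:E * \int[leb]_x (`|(\sum_k phi k x *: v k)%R| `^ p)%:E)%E].

Lemma bounded_multiplier_cvg m_ m : (forall n, bounded_multiplier (m_ n)) ->
  (forall xi, m_ n xi @[n --> \oo] --> m xi) -> bounded_multiplier m.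
Proof.
move=> bm m_m.
have mm n : measurable_fun setT (m_ n) by have [] := bm n.
have m1 n xi : `|m_ n xi| <= 1 by have [] := bm n.
have m_cvg phi x : schwartz phi -> multiplier (m_ n) phi x @[n --> \oo] --> multiplier m phi x.
  by move=> sphi; exact: multiplier_cvg.
split.
- by apply: (measurable_fun_cvg mm) => xi _; exact: m_m.
- move=> xi; have h : `|m_ n xi| @[n --> \oo] --> `|m xi| by apply: cvg_norm; exact: m_m.
  by apply: (cvgr_to_le h); exact: nearW.
- move=> phi sphi; apply: (measurable_fun_cvg (h := fun n => multiplier (m_ n) phi)) => [n|x _].
    by have [_ _ + _] := bm n; exact.
  exact: m_cvg.
- move=> n phi v sphi.
  apply: (fatou_le leb (fun k x => `|\sum_j multiplier (m_ k) (phi j) x *: v j| `^ p)).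
  + move=> k; apply: (measurable_powR_norm p); apply: measurable_norm_tensor.
    exists 'I_n, (fun j => multiplier (m_ k) (phi j)), v; split => // j.
    by have [_ _ + _] := bm k; exact.
  + by move=> k x; exact: powR_ge0.
  + move=> x; apply: (cvg_powR _ p1) => [k|]; first exact: normr_ge0.
    apply: cvg_norm.
    have cS (r : seq 'I_n) : \sum_(j <- r) multiplier (m_ k) (phi j) x *: v j @[k --> \oo] -->
        \sum_(j <- r) multiplier m (phi j) x *: v j.
      elim: r => [|j r IH].
        by rewrite big_nil; under eq_fun do rewrite big_nil; exact: cvg_cst.
      rewrite big_cons; under eq_fun do rewrite big_cons.
      by apply: cvgD => //; apply: cvgZr_tmp; exact: m_cvg.
    exact: cS.
  + by move=> k; have [_ _ _ +] := bm k; exact.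
Qed.

Variable A : pred nat.
Hypothesis hC : forall N (F : seq bool -> X),
  mean N (fun w => `|dker_apply A N F w| `^ p) <= C `^ p * mean N (fun w => `|F w| `^ p).

Lemma measurable_dform N (f g : 'rV[R]_d -> seq bool -> R) :
  (forall w, measurable_fun setT (f^~ w)) -> (forall w, measurable_fun setT (g^~ w)) ->
  measurable_fun setT (fun xi => dform A N (f xi) (g xi)).
Proof.
move=> mf mg; apply: measurable_funM => //; apply: measurable_sum => w.
by apply: measurable_sum => w'; apply: measurable_funM => //; apply: measurable_funM.
Qed.

Lemma realizable_bounded N v m : realizable A N v m -> (forall xi, `|m xi| <= 1) ->
  bounded_multiplier m.
Proof.
move=> [Y rY] m1.
have E phi x : schwartz phi -> multiplier m phi x = - averaged_dker A N Y phi x.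
  by move=> sphi; rewrite (averaged_dker_multiplier _ _ _ _ _ _ _ rY sphi) opprK.
split => //.
- have -> : m = fun xi => 2 * dform A N (coscos Y xi) (sinsin Y xi).
    by apply/funext => xi; have [_ _ ->] := rY xi.
  apply: measurable_funM => //; apply: measurable_dform => w.
    rewrite (_ : (fun xi => _) = wave cos (Y w)); last by apply/funext => xi; rewrite waveC.
    exact: (measurable_wave cos (Y w) (@continuous_cos R)).
  rewrite (_ : (fun xi => _) = wave sin (Y w)); last by apply/funext => xi; rewrite waveC.
  exact: (measurable_wave sin (Y w) (@continuous_sin R)).
- move=> phi sphi; rewrite (_ : multiplier m phi = fun x => - averaged_dker A N Y phi x); last first.
    by apply/funext => x; exact: E.
  apply: measurableT_comp => //; apply: measurable_funM => //.
  apply: measurable_sum => w; apply: measurable_sum => w'; apply: measurable_funM => //.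
  exact: (measurableT_comp (schwartz_measurable _ sphi) (measurable_rV_shift d _)).
- move=> n phi u sphi.
  pose f x := \sum_k phi k x *: u k.
  have tf : finite_tensor f.
    by exists 'I_n, phi, u; split => // k; exact: schwartz_measurable.
  apply: le_trans (averaged_dker_bound p p1 A C hC N Y f tf).
  rewrite le_eqVlt; apply/orP; left; apply/eqP; apply: eq_integral => x _.
  congr ((_ `^ p)%:E); rewrite -normrN; congr `|_|.
  rewrite /averaged_dker /f -sumrN.
  under eq_bigr do rewrite E// -scaleNr opprK /averaged_dker -scalerA scaler_suml.
  rewrite -scaler_sumr exchange_big/=; congr (_ *: _); apply: eq_bigr => w _.
  under eq_bigr do rewrite scaler_suml.
  rewrite exchange_big/=; apply: eq_bigr => w' _.
  by rewrite scaler_sumr; apply: eq_bigr => k _; rewrite scalerA.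
Qed.

Variable i : 'I_d.
Hypothesis Ai : A = (fun k => k %% d == i)%N.

Lemma bounded_riesz_symbol : bounded_multiplier (fun xi => xi ord0 i / norm2 xi).
Proof.
apply: (bounded_multiplier_cvg (fun k => limit_symb i k.+1%:R^-1)); last first.
  by move=> xi; exact: limit_symb_cvg.
move=> k; set t : R := k.+1%:R^-1.
apply: (bounded_multiplier_cvg (fun y xi => limit_symb i t xi * (1 - walk_root (step_char t xi) ^+ y ^+ 2))); last first.
  by move=> xi; exact: walk_symb_cvg_height.
move=> y; apply: (bounded_multiplier_cvg (fun n xi => walk_symb (step_char t xi) (step_drift i t xi) n y)); last first.
  by move=> xi; exact: walk_symb_cvg_time.
move=> n; have [N rN] := realizable_walk_shift i t n y.
apply: (realizable_bounded N); first by rewrite Ai; exact: rN.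
by move=> xi; exact: walk_symb_step_le1.
Qed.

End bounded_multipliers.

Section riesz_bound.
Context {R : realType} {X : normedModType R} {d : nat}.
Local Notation leb := (lebesgue_rV R d).
Variables (i : 'I_d) (p C : R).
Hypothesis p1 : 1 < p.
Hypothesis C0 : 0 <= C.
Hypothesis hC : forall N (F : seq bool -> X),
  mean N (fun w => `|dker_apply (fun k => k %% d == i)%N N F w| `^ p) <=
  C `^ p * mean N (fun w => `|F w| `^ p).

Lemma riesz_tensor_bound (f g : 'rV[R]_d -> X) : riesz_tensor i f g ->
  [/\ finite_tensor f, finite_tensor g & (normLp leb p g <= C%:E * normLp leb p f)%E].
Proof.
move=> [n [phi [v [sphi /funext -> /funext ->]]]].
have [_ _ mm bm] := bounded_riesz_symbol p C p1 _ hC i erefl.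
have E : (fun x => \sum_k riesz_scalar i (phi k) x *: v k) =
    fun x => \sum_k multiplier (fun xi => xi ord0 i / norm2 xi) (phi k) x *: v k.
  by apply/funext => x; apply: eq_bigr => k _; rewrite riesz_scalarE.
split.
- by exists 'I_n, phi, v; split => // k; exact: schwartz_measurable.
- by rewrite E; do 3 eexists; split; last reflexivity; move=> k; exact: mm.
- by rewrite E; apply: le_normLp_scale => //; exact: bm.
Qed.

(** The pair lies in the closure of the graph on tensors. Two triangle inequalities reduce the bound
    to the one for the approximating tensors, with errors that tend to 0. *)
Lemma riesz_bound (f g : 'rV[R]_d -> X) : riesz p i f g ->
  (normLp leb p f <= 1)%E -> (normLp leb p g <= C%:E)%E.
Proof.
move=> [[mf _] [mg _] [f_ [g_ [fg f_f g_g]]]] f1.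
have tf n : finite_tensor (f_ n) by have [] := riesz_tensor_bound _ _ (fg n).
have tg n : finite_tensor (g_ n) by have [] := riesz_tensor_bound _ _ (fg n).
have step n : (normLp leb p g <=
    normLp leb p (g_ n \- g)%R + C%:E * (normLp leb p (f_ n \- f)%R + 1%:E))%E.
  apply: (@le_trans _ _ (normLp leb p (g_ n \- g)%R + normLp leb p (g_ n))%E).
    apply: normLp_triangle => //.
    - exact: measurable_norm_strongly.
    - exact: measurable_norm_tensorB.
    - exact: measurable_norm_tensor.
    - move=> x /=; rewrite [X in _ <= X + _]distrC.
      by rewrite -[X in `|X| <= _](subrK (g_ n x)) ler_normD.
  apply: leeD => //; have [_ _ +] := riesz_tensor_bound _ _ (fg n).
  move=> /le_trans; apply; apply: lee_pmul => //; first exact: normLp_ge0.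
  apply: (@le_trans _ _ (normLp leb p (f_ n \- f)%R + normLp leb p f)%E); last exact: leeD.
  apply: normLp_triangle => //.
  - exact: measurable_norm_tensor.
  - exact: measurable_norm_tensorB.
  - exact: measurable_norm_strongly.
  - by move=> x /=; rewrite -[X in `|X| <= _](subrK (f x)) ler_normD.
have lim : (normLp leb p (g_ n \- g)%R + C%:E * (normLp leb p (f_ n \- f)%R + 1%:E))%E
    @[n --> \oo] --> C%:E.
  rewrite -[X in _ --> X]add0e -[X in (0 + X)%E]mule1 -[X in (C%:E * X)%E]add0e.
  apply: cvgeD => //; apply: cvgeZl => //; apply: cvgeD => //; exact: cvg_cst.
by apply: (cvge_to_ge lim); exact: nearW.
Qed.

End riesz_bound.

Theorem theorem1 (R : realType) (X : completeNormedModType R) (p : R) (d : nat)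
    (i : 'I_d) :
  UMD X -> 1 < p -> (1 <= d)%N ->
  (opnorm (lebesgue_rV R d) p (@riesz R d X p i)
   <= opnorm (@lebesgue01 R) p (@dyadic_riesz R X d p i))%E.
Proof.
move=> _ p1 _; have p0 : 0 < p := lt_trans ltr01 p1.
(* The supremum is not over the empty set, as the zero function is admissible; hence it is
   nonnegative, which [dker_apply_bound] needs of a finite [C]. *)
have S0 : (0 <= opnorm (@lebesgue01 R) p (@dyadic_riesz R X d p i))%E.
  pose F (w : seq bool) : X := 0.
  pose SF := dker_apply (fun k => k %% d == i)%N 0 F.
  apply: (@le_trans _ _ (normLp (@lebesgue01 R) p (word_step 0 SF))).
    exact: normLp_ge0.
  apply: ereal_sup_ubound; exists (word_step 0 F), (word_step 0 SF).
  split => //; [exact: LpX_word_step| |exact: dyadic_riesz_word].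
  rewrite normLp_le// integral_word_step /mean sum_words0 normr0 powR0 ?gt_eqF//.
  by rewrite mul0r lee_fin powR_ge0.
(* If the dyadic norm is infinite there is nothing to prove. *)
move: S0; case E : (opnorm _ p _) => [C| |]; [|by move=> _; rewrite leey|by []].
rewrite lee_fin => C0.
apply: ge_ereal_sup => _ [f [g [_ f1 fg ->]]].
apply: (riesz_bound i p C p1 C0 _ f g fg f1) => N F.
by apply: (dker_apply_bound i p p0 C N F C0); rewrite E.
Qed.
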